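(* Assume that the system $(M,\mathcal{B}(M),\mu,T)$ is exponentially mixing. Let $x^*\in M$ be a slowly recurrent point with $\rho(x^* )>0$, and let $f\in C^{\kappa}(M\setminus\{x^*\})$ be a non-negative function with a power singularity of order $\mathrm{Ord}_{x^*}(f)=d$ at $x^*$. Then, for every fixed integer $K\ge 1$, $$\lim_{N\to\infty}\frac{S_N^K(f)(x)}{N\log N}=\mathrm{Res}_{x^*}(f)\,B_d\,\rho(x^* )\quad\text{for $\mu$-almost every } x.$$
   Context: Setting: $M$ is a compact smooth $d$-dimensional Riemannian manifold with geodesic distance $\mathrm{dist}(\cdot,\cdot)$; $\kappa\ge 1$ is fixed; $T:M\to M$ is a $C^\kappa$ map preserving a probability measure $\mu$ that is absolutely continuous with respect to the Riemannian volume, with continuous density $\rho=d\mu/d\mathrm{vol}$. $\mathbb{E}$ denotes integration with respect to $\mu$; $B_r(x^* )$ is the ball of radius $r$ around $x^*$; $B_d$ is the volume of the $d$-dimensional Euclidean unit ball. Exponential mixing of order $m$: there are constants $C_m\ge 0$ and $\gamma>0$ such that for all $f_0,\dots,f_{m-1}\in C^\kappa(M)$ and integers $0\le k_0\le\dots\le k_{m-1}$, $$\Big|\mathbb{E}\Big(\prod_{j=0}^{m-1}f_j\circ T^{k_j}\Big)-\prod_{j=0}^{m-1}\mathbb{E}f_j\Big|\le C_m e^{-\gamma\min_{0\le j\le m-2}(k_{j+1}-k_j)}\prod_{j=0}^{m-1}\|f_j\|_{C^\kappa}.$$ ''Exponentially mixing'' means exponentially mixing of order $2$. Power singularity: a non-negative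 $f\in C^\kappa(M\setminus\{x^*\})$ has a power singularity of order $\mathrm{Ord}_{x^*}(f)=\beta>0$ at $x^*$ if $g(x)=f(x)\,\mathrm{dist}(x,x^* )^\beta$, $x\ne x^*$, admits a $C^\kappa$ extension to a neighborhood of $x^*$ with $g(x^* )>0$; then $\mathrm{Res}_{x^*}(f)=g(x^* )$. Slowly recurrent point: $x^*\in M$ is slowly recurrent if for every $A,C>0$ there is $r_0>0$ such that for all $0<r<r_0$ and positive integers $n\le C|\log r|$, $\mu\big(B_r(x^* )\cap T^{-n}(B_r(x^* ))\big)\le\mu(B_r(x^* ))\,|\log r|^{-A}$. Trimmed sums: $S_N(f)(x)=\sum_{n=0}^{N-1}f(T^nx)$, and for $0\le k\le N-1$, $S_N^{k}(f)(x)=S_N(f)(x)-\sum_{i=1}^{k}f(x_i^N)$, where $x_1^N,\dots,x_N^N$ is a reordering of $x,Tx,\dots,T^{N-1}x$ with $f(x_1^N)\ge f(x_2^N)\ge\dots\ge f(x_N^N)$ (i.e. the $k$ largest values are removed). *)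

(* Defs.v *)
From HB Require Import structures.
From mathcomp Require Import all_boot all_order all_algebra.
From mathcomp Require Import all_classical all_reals all_analysis.
Set Implicit Arguments.
Unset Strict Implicit.
Unset Printing Implicit Defensive.
Import Order.TTheory GRing.Theory Num.Theory.
Import numFieldNormedType.Exports.
Local Open Scope classical_set_scope.
Local Open Scope ring_scope.

Section Euclidean.
Context {R : realType}.

(* Iterated one-dimensional Lebesgue integrals.  On non-negative Borel functions
   this is, by Tonelli, the integral against d-dimensional Lebesgue measure. *)
Fixpoint lebesgue_int (d : nat) : ('rV[R]_d -> \bar R) -> \bar R :=
  match d return ('rV[R]_d -> \bar R) -> \bar R with
  | 0%N => fun f => f 0
  | e.+1 => fun f => (\int[lebesgue_measure]_t
      lebesgue_int (fun v : 'rV[R]_e => f (row_mx (t%:M : 'rV[R]_1) v)))%E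
  end.

(* The norm of ['rV_d] in the library is the sup norm, hence the explicit sum. *)
Definition unit_ball_volume (d : nat) : R :=
  fine (lebesgue_int
    (fun v : 'rV[R]_d => (\1_[set w : 'rV[R]_d | \sum_i w 0 i ^+ 2 < 1] v)%:E)).

Definition partials (d : nat) (s : seq 'I_d) (f : 'rV[R]_d -> R) : 'rV[R]_d -> R :=
  foldr (fun i g => 'D_(delta_mx 0 i) g) f s.

(* [f] is of class C^kappa on the open set [U], for real [kappa >= 0]: with
   k the integer part of [kappa], all partial derivatives up to order k exist
   and are continuous, and those of order k are locally Hoelder of exponent
   [kappa - k].  For integer [kappa] the exponent is 0 and, since
   [x `^ 0 = 1], the last clause is only local boundedness, which continuity
   already gives: this is the usual C^k. *)
Definition class_C (kappa : R) (d : nat) (U : set 'rV[R]_d) (f : 'rV[R]_d -> R) :=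
  let k := Num.truncn kappa in
  forall s : seq 'I_d, (size s <= k)%N ->
  [/\ forall x, U x -> {for x, continuous (partials s f)},
      (size s < k)%N ->
        forall i x, U x -> derivable (partials s f) x (delta_mx 0 i) &
      size s = k -> forall x, U x ->
        exists C V, nbhs x V /\ forall y z, V y -> V z ->
          `|partials s f y - partials s f z| <= C * `|y - z| `^ (kappa - k%:R)].

Definition smooth (d : nat) (U : set 'rV[R]_d) (f : 'rV[R]_d -> R) :=
  forall n : nat, class_C n%:R U f.

End Euclidean.

(* Smooth d-dimensional Riemannian manifolds without boundary, given by an
   atlas.  [phi i] is a chart with open domain [dom i] and [psi i] its inverse
   (values outside [dom i] and [img i] are irrelevant); [metric i] is the Gram
   matrix of the Riemannian metric in the chart [i], tangent vectors being row
   vectors.  Second countability is not required here; it is automatic for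
   compact manifolds.  Connectedness is not assumed. *)
Record riemannianManifold (R : realType) (d : nat) (M : ptopologicalType) := {
  idx : Type;
  dom : idx -> set M;
  phi : idx -> M -> 'rV[R]_d;
  psi : idx -> 'rV[R]_d -> M;
  metric : idx -> 'rV[R]_d -> 'M[R]_d;
  manifold_hausdorff : hausdorff_space M;
  dom_cover : forall x, exists i, dom i x;
  dom_open : forall i, open (dom i);
  img_open : forall i, open (phi i @` dom i);
  phiK : forall i x, dom i x -> psi i (phi i x) = x;
  phi_continuous : forall i x, dom i x -> {for x, continuous (phi i)};
  psi_continuous : forall i v, (phi i @` dom i) v -> {for v, continuous (psi i)};
  transition_smooth : forall i j (l : 'I_d),
    smooth (phi i @` (dom i `&` dom j)) (fun v => phi j (psi i v) 0 l);
  metric_smooth : forall i (l m : 'I_d),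
    smooth (phi i @` dom i) (fun v => metric i v l m);
  metric_sym : forall i v, (phi i @` dom i) v -> (metric i v)^T = metric i v;
  metric_pos : forall i v, (phi i @` dom i) v -> forall w : 'rV[R]_d, w != 0 ->
    0 < (w *m metric i v *m w^T) 0 0;
  metric_compat : forall i j v, (phi i @` (dom i `&` dom j)) v ->
    let J := jacobian (phi j \o psi i) v in
    metric i v = J *m metric j (phi j (psi i v)) *m J^T
}.

Notation borel M := (g_sigma_algebraType (@open M)).

Section Manifold.
Context {R : realType} {d : nat} {M : ptopologicalType}.
Variable X : riemannianManifold R d M.

Definition img (i : idx X) : set 'rV[R]_d := phi i @` dom i.

Definition arc_length (i : idx X) (c : R -> 'rV[R]_d) : \bar R :=
  (\int[lebesgue_measure]_(t in `[0%R, 1%R])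
    (Num.sqrt ((derive1 c t *m metric i (c t) *m (derive1 c t)^T) 0 0))%R%:E)%E.

(* [path_length x y l]: some piecewise C^1 path from [x] to [y] has length [l].
   Such a path is a finite concatenation of C^1 arcs on [0, 1], each inside one
   chart; an arc is the restriction of a C^1 map on the real line. *)
Inductive path_length : M -> M -> \bar R -> Prop :=
| path_nil x : path_length x x 0%E
| path_cons (i : idx X) (c : R -> 'rV[R]_d) y l :
    (forall t, derivable c t 1) -> continuous (derive1 c) ->
    (forall t, 0 <= t <= 1 -> img i (c t)) ->
    path_length (psi i (c 1)) y l ->
    path_length (psi i (c 0)) y (arc_length i c + l)%E.

(* Equal to [+oo] between distinct connected components. *)
Definition dist (x y : M) : \bar R := ereal_inf [set l | path_length x y l].

Definition geoball (x : M) (r : R) : set M := [set y | (dist x y < r%:E)%E].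

Definition is_riemannian_volume (vol : {measure set (borel M) -> \bar R}) :=
  forall (i : idx X) (A : set (borel M)), measurable A -> A `<=` dom i ->
    vol A = lebesgue_int (fun v =>
      (\1_(phi i @` A : set 'rV[R]_d) v * Num.sqrt (\det (metric i v)))%:E).

(* [f] is of class C^kappa on the open set [W] of the manifold. *)
Definition class_CM (kappa : R) (W : set M) (f : M -> R) :=
  forall i : idx X, class_C kappa (phi i @` (dom i `&` W)) (f \o psi i).

Definition class_C_map (kappa : R) (T : M -> M) :=
  continuous T /\
  forall (i j : idx X) (l : 'I_d),
    class_C kappa (phi i @` (dom i `&` T @^-1` dom j))
      (fun v => phi j (T (psi i v)) 0 l).

Definition chart_cover (n : nat) (ci : 'I_n -> idx X) (K : 'I_n -> set M) :=
  (forall a, compact (K a) /\ K a `<=` dom (ci a)) /\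
  (forall x, exists a, K a x).

(* The C^kappa norm read in finitely many charts: the largest of the sup norms
   over the [K a] of the partial derivatives of order at most k, and of the
   Hoelder quotients of those of order k (for integer [kappa] these quotients
   are dominated by twice the sup norm). *)
Definition norm_C (kappa : R) (n : nat) (ci : 'I_n -> idx X) (K : 'I_n -> set M)
    (f : M -> R) : \bar R :=
  let k := Num.truncn kappa in
  let D a s x := partials s (f \o psi (ci a)) (phi (ci a) x) in
  ereal_sup
    ([set u | exists a s x,
        [/\ (size s <= k)%N, K a x & u = `|D a s x|%:E]] `|`
     [set u | exists a s x y,
        [/\ size s = k, K a x, K a y, x <> y &
            u = (`|D a s x - D a s y| /
                 `|phi (ci a) x - phi (ci a) y| `^ (kappa - k%:R))%:E]]).

(* Exponential mixing of order [m >= 2].  Different covers of the compact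
   manifold give equivalent C^kappa norms, so the choice of the cover only
   affects the constant [C].  The minimum of the gaps is seeded with the first
   gap, since [minn] has no neutral element. *)
Definition exp_mixing_order (kappa : R) (mu : probability (borel M) R)
    (T : M -> M) (m : nat) :=
  exists (n : nat) (ci : 'I_n -> idx X) (K : 'I_n -> set M),
  chart_cover ci K /\
  exists C gamma : R, [/\ 0 <= C, 0 < gamma &
  forall (f : nat -> M -> R) (k : nat -> nat),
    (forall j, (j < m)%N -> class_CM kappa setT (f j)) ->
    (forall j, (j.+1 < m)%N -> (k j <= k j.+1)%N) ->
    let gap := \big[minn/(k 1 - k 0)%N]_(0 <= j < m.-1) (k j.+1 - k j)%N in
    (`| \int[mu]_x (\prod_(j < m) f j (iter (k j) T x))
        - \prod_(j < m) \int[mu]_x f j x |%:E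
     <= (C * expR (- gamma * gap%:R))%:E *
        \big[mule/1]_(j < m) norm_C kappa ci K (f j))%E].

Definition exp_mixing (kappa : R) (mu : probability (borel M) R) (T : M -> M) :=
  exp_mixing_order kappa mu T 2.

Definition slowly_recurrent (mu : probability (borel M) R) (T : M -> M) (xs : M) :=
  forall A C : R, 0 < A -> 0 < C ->
  exists2 r0 : R, 0 < r0 &
  forall (r : R) (n : nat), 0 < r < r0 -> (0 < n)%N -> n%:R <= C * `|ln r| ->
    (mu (geoball xs r `&` iter n T @^-1` geoball xs r)
     <= mu (geoball xs r) * (`|ln r| `^ (- A))%:E)%E.

(* [f] is non-negative and C^kappa on M \ {xs} and has a power singularity of
   order [beta] and residue [res] at [xs].  The value of [f] at [xs] itself is
   irrelevant. *)
Definition power_singularity (kappa : R) (xs : M) (f : M -> R) (beta res : R) :=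
  [/\ class_CM kappa [set~ xs] f,
      (forall x, x <> xs -> 0 <= f x),
      0 < beta &
      exists (U : set M) (g : M -> R),
        [/\ open_nbhs xs U, class_CM kappa U g,
            (forall x, U x -> x <> xs -> g x = f x * fine (dist x xs) `^ beta),
            0 < g xs & res = g xs]].

End Manifold.

Definition trimmed_sum (R : realType) (M : Type) (T : M -> M) (f : M -> R)
    (K N : nat) (x : M) : R :=
  let values := [seq f (iter n T x) | n <- iota 0 N] in
  \sum_(v <- values) v - \sum_(v <- take K (sort (fun a b => b <= a) values)) v.

(* Main.v *)
Require Import Defs.
From HB Require Import structures.
From mathcomp Require Import all_boot all_order all_algebra.
From mathcomp Require Import zify.
From mathcomp Require Import ring lra.
From mathcomp Require Import all_classical all_reals all_analysis.
From mathcomp Require Import measurable_realfun.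
Import Order.TTheory GRing.Theory Num.Theory.
Import numFieldNormedType.Exports.
Set Implicit Arguments.
Unset Strict Implicit.
Unset Printing Implicit Defensive.
Local Open Scope classical_set_scope.
Local Open Scope ring_scope.

(* Near [xs], [f] behaves like [res * q^(-d/2)], where [q] is a smooth function
   on [M] that is asymptotic to the squared distance to [xs].  So the truncated
   observables [(q + L^(-2/d))^(-d/2)], of height [L], have C^kappa norms
   polynomial in [L], mean [~ c ln L] and second moment [O(L)], where
   [c = B_d * rho xs] because [mu (q < s) ~ c s^(d/2)].  On the block
   [a^j <= N < a^(j+1)] take [L] slightly smaller than [a^j j].  For time gaps
   larger than a multiple of [j], exponential mixing decorrelates these
   observables; for shorter gaps slow recurrence bounds their correlations.
   Chebyshev and Borel-Cantelli then give [~ N c ln N] for the truncated Birkhoff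
   sums.  The same two ingredients show that, almost surely, in each large block
   at most one orbit point sees a value above a slightly lower level [Lam], so
   trimming it leaves only values that are [o(N ln N)] and that the truncation
   does not change to first order.  Letting [a] tend to 1 concludes. *)

(** * Calculus on row vectors *)

(** Mixing tests only functions of class C^kappa on all of [M]. Smoothness of the squared distance
    near [xs] would require geodesics, so [q] is built from the quadratic form of the metric at [xs]
    in one chart. The distance enters only through its first-order asymptotics: straight segments in
    the chart bound it from above, the Lipschitz property of [sqrt q] from below. Joint visits to a
    small set are never tested with smoothed indicators. On that set the squared truncated
    observable is at least a constant times L^2, so mixing of the squares suffices, and the squares
    are again shifted powers of [q], of exponent -d. The levels are a^j times powers of w = j^(1/6).
    Truncation at a^j w^u gives a normalised variance of order w^(u-12); the mean number of pairs of
    visits above a^j w^v is of order w^(-2v). Both are summable over j when u < 6 and v > 3, and v <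
    u separates the two levels, so u = 5 and v = 4 is the only integral choice. *)

Section RowVectors.
Context {R : realType} {d : nat}.
Implicit Types (x y z w : 'rV[R]_d).

Lemma rV_norm_le x (r : R) : 0 <= r ->
  (`|x| <= r) <-> (forall i, `|x 0 i| <= r).
Proof.
move=> r0; rewrite [leLHS]/Num.Def.normr/= mx_normrE; split.
  move=> h i; apply: le_trans h.
  exact: (le_bigmax _ (fun i : 'I_1 * 'I_d => `|x i.1 i.2|) (0, i)).
by move=> h; apply: bigmax_le => // -[i j] _ /=; rewrite ord1.
Qed.

Lemma rV_norm_lt x (r : R) : 0 < r ->
  (`|x| < r) <-> (forall i, `|x 0 i| < r).
Proof.
move=> r0; rewrite [ltLHS]/Num.Def.normr/= mx_normrE; split.
  move=> h i; apply: le_lt_trans h.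
  exact: (le_bigmax _ (fun i : 'I_1 * 'I_d => `|x i.1 i.2|) (0, i)).
by move=> h; apply: bigmax_lt => // -[i j] _ /=; rewrite ord1.
Qed.

Lemma rV_coord_le x i : `|x 0 i| <= `|x|.
Proof. by apply: (rV_norm_le x (normr_ge0 x)).1. Qed.

Lemma is_derive_line (f : 'rV[R]_d -> R) x w (t : R) :
  derivable f (x + t *: w) w ->
  is_derive t 1 (fun s : R => f (x + s *: w)) ('D_w f (x + t *: w)).
Proof.
move=> df.
have E : (fun h : R => h^-1 *: (((fun s : R => f (x + s *: w)) \o shift t) (h *: 1)
      - f (x + t *: w)))
   = (fun h : R => h^-1 *: ((f \o shift (x + t *: w)) (h *: w) - f (x + t *: w))).
  apply/funext => h /=; congr (_ *: (f _ - _)).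
  by rewrite [h *: 1]mulr1 scalerDl addrCA addrA addrAC -addrA addrC -addrA addrC.
by split; [rewrite /derivable E | rewrite /derive E].
Qed.

(* The increment of [f] is split along the edges of the box spanned by [y] and
   [z], one coordinate at a time. *)
Lemma partials_mean_value (f : 'rV[R]_d -> R) x (r : R) y z :
  ball x r y -> ball x r z ->
  (forall w i, ball x r w -> derivable f w (delta_mx 0 i)) ->
  exists xi : 'I_d -> 'rV[R]_d,
    (forall i, ball x r (xi i) /\ `|xi i - y| <= `|z - y|) /\
    f z - f y = \sum_i (z - y) 0 i * 'D_(delta_mx 0 i) f (xi i).
Proof.
move=> yB zB df.
have yr : `|x - y| < r by move: yB; rewrite -ball_normE.
have zr : `|x - z| < r by move: zB; rewrite -ball_normE.
have r0 : 0 < r by apply: le_lt_trans yr.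
pose p (m : nat) (t : R) : 'rV[R]_d :=
  \row_j (if (j < m)%N then z 0 j else
          if (j == m :> nat) then y 0 j + t * (z 0 j - y 0 j) else y 0 j).
(* Balls of the sup norm are boxes, so the edge path between two points of a ball stays inside
   it. *)
have pball m t : 0 <= t <= 1 -> `|x - p m t| < r.
  move=> /andP[t0 t1]; apply/rV_norm_lt => // j; rewrite !mxE.
  have := (rV_norm_lt _ r0).1 yr j; have := (rV_norm_lt _ r0).1 zr j.
  rewrite !mxE; case: ifP => // _; case: ifP => // _.
  move=> zl yl.
  set a := x 0 j - z 0 j in zl *; set b := x 0 j - y 0 j in yl *.
  have -> : x 0 j - (y 0 j + t * (z 0 j - y 0 j)) = (1 - t) * b + t * a.
    by rewrite /a /b; ring.
  have lt_max : Num.max `|b| `|a| < r by rewrite gt_max yl.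
  apply: le_lt_trans lt_max; apply: le_trans (ler_normD _ _) _.
  rewrite !normrM (ger0_norm t0) ger0_norm ?subr_ge0//.
  have bm : `|b| <= Num.max `|b| `|a| by rewrite le_max lexx.
  have am : `|a| <= Num.max `|b| `|a| by rewrite le_max lexx orbT.
  by nra.
have pdist m t : 0 <= t <= 1 -> `|p m t - y| <= `|z - y|.
  move=> /andP[t0 t1]; apply/rV_norm_le => // j.
  have := rV_coord_le (z - y) j; rewrite !mxE.
  case: ifP => // _; case: ifP => // _; last by rewrite subrr normr0.
  rewrite addrAC subrr add0r normrM ger0_norm// => h.
  by apply: le_trans h; apply: ler_piMl.
have step (i : 'I_d) t : p i t = p i 0 + t *: (((z - y) 0 i) *: delta_mx 0 i).
  apply/rowP => j; rewrite !mxE !mul0r eqxx /=.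
  rewrite -(inj_eq val_inj) /=.
  case: ltngtP => [ji|ji|/val_inj ->]; rewrite ?mulr0 ?addr0//.
  by rewrite mulr1.
have edge (i : 'I_d) : exists w, (ball x r w /\ `|w - y| <= `|z - y|) /\
    f (p i 1) - f (p i 0) = (z - y) 0 i * 'D_(delta_mx 0 i) f w.
  pose g := fun s : R => f (p i 0 + s *: (((z - y) 0 i) *: delta_mx 0 i)).
  pose G := fun s : R => (z - y) 0 i * 'D_(delta_mx 0 i) f (p i s).
  have gd (s : R) : 0 <= s <= 1 -> is_derive s 1 g (G s).
    move=> s01; have dps := df (p i s) i.
    have {}dps : derivable f (p i s) (delta_mx 0 i).
      by apply: dps; rewrite -ball_normE; exact: pball.
    have -> : g = (fun t => f (p i s + (t - s) *: (((z - y) 0 i) *: delta_mx 0 i))).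
      by apply/funext => t; rewrite /g (step i s) -addrA -scalerDl [s + _]addrC subrK.
    pose k := fun u : R => f (p i s + u *: delta_mx 0 i).
    have kd : is_derive (0 : R) 1 k ('D_(delta_mx 0 i) f (p i s)).
      have := @is_derive_line f (p i s) (delta_mx 0 i) 0.
      by rewrite scale0r addr0; apply.
    have -> : (fun t => f (p i s + (t - s) *: (((z - y) 0 i) *: delta_mx 0 i)))
       = k \o (fun t => (t - s) * ((z - y) 0 i)).
      by apply/funext => t /=; rewrite /k scalerA.
    have hd : is_derive s 1 (fun t : R => (t - s) * ((z - y) 0 i)) ((z - y) 0 i).
      apply: is_derive_eq.
      by rewrite subr0 /= scaler0 add0r /GRing.scale /= mulr1.
    have kd' : is_derive ((fun t : R => (t - s) * ((z - y) 0 i)) s) 1 k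
        ('D_(delta_mx 0 i) f (p i s)) by rewrite subrr mul0r.
    have := @is_derive1_comp R k (fun t => (t - s) * ((z - y) 0 i)) s _ _ kd' hd.
    by rewrite mulrC.
  have [] := @MVT_segment R g G 0 1 ler01.
  - by move=> s /[!in_itv]/= /andP[s0 s1]; apply: gd; rewrite !ltW.
  - apply: derivable_within_continuous => s /[!in_itv]/= s01.
    by have [] := gd _ s01.
  move=> s /[!in_itv]/= s01 gE; exists (p i s); split.
    by split; [rewrite -ball_normE; exact: pball | exact: pdist].
  by move: gE; rewrite /g -!step subr0 mulr1.
have [xi xiP] := choice edge.
exists xi; split=> [i|]; first by have [] := xiP i.
under eq_bigr do rewrite -(xiP _).2.
have p1 m : (m < d)%N -> p m 1 = p m.+1 0.
  move=> md; apply/rowP => j; rewrite !mxE ltnS mul0r addr0.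
  case: ltngtP => //= jm; last first.
    by rewrite mul1r addrC subrK.
  by case: ifP.
have -> : f z - f y = f (p d 0) - f (p 0 0).
  congr (f _ - f _); apply/rowP => j; rewrite !mxE ?ltn_ord//.
  by rewrite ltn0 mul0r addr0; case: ifP.
rewrite -(telescope_sumr (fun m => f (p m 0)))// big_mkord.
by apply: eq_bigr => i _; rewrite p1.
Qed.

End RowVectors.
Lemma cvg_sumr {K : numFieldType} {V : pseudoMetricNormedZmodType K} {T I : Type}
    (F : set_system T) (FF : Filter F) (r : seq I) (P : pred I)
    (f : I -> T -> V) (a : I -> V) :
  (forall i, P i -> f i x @[x --> F] --> a i) ->
  \sum_(i <- r | P i) f i x @[x --> F] --> \sum_(i <- r | P i) a i.
Proof.
move=> fa; elim: r => [|i r IH].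
  by rewrite big_nil; under eq_cvg do rewrite big_nil; exact: cvg_cst.
rewrite big_cons; under eq_cvg do rewrite big_cons.
by case: ifP => // Pi; apply: cvgD => //; exact: fa.
Qed.

(** A named function, so that the linear structure which [diff_unique] asks of a differential can be
    attached to it. *)
Definition partials_form (R : realType) (d : nat) (c : 'I_d -> R) (v : 'rV[R]_d) : R :=
  \sum_i v 0 i * c i.

Section PartialsForm.
Context {R : realType} {d : nat} (c : 'I_d -> R).

Let partials_form_linear : linear (partials_form c).
Proof.
move=> a u v; rewrite /partials_form scaler_sumr -big_split /=.
by apply: eq_bigr => i _; rewrite !mxE mulrDl -mulrA.
Qed.

HB.instance Definition _ := GRing.isLinear.Build R 'rV[R]_d R _ (partials_form c)
  partials_form_linear.

Lemma partials_form_continuous : continuous (partials_form c).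
Proof.
move=> v; apply: (@cvg_sumr _ R _ _ (nbhs v)) => i _.
by apply: continuousM; [exact: coord_continuous | exact: cst_continuous].
Qed.

End PartialsForm.

Section ContinuousPartials.
Context {R : realType} {d : nat}.

(** By [partials_mean_value] the remainder is a sum of coordinates of [h] times increments of the
    partial derivatives, which continuity makes small. *)
Lemma diff_continuous_partials (f : 'rV[R]_d -> R) x :
  (\forall w \near x, forall i, derivable f w (delta_mx 0 i)) ->
  (forall i, {for x, continuous ('D_(delta_mx 0 i) f)}) ->
  is_diff x f (partials_form (fun i => 'D_(delta_mx 0 i) f x)).
Proof.
move=> fd fc; set c := fun i => 'D_(delta_mx 0 i) f x.
have E : f \o shift x = cst (f x) + (partials_form c : {linear _ -> _}) +o_ 0 id.
  apply/eqaddoP => _/posnumP[e].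
  (* [d.+1] instead of [d] covers dimension 0. *)
  have e1 : 0 < e%:num / d.+1%:R by [].
  have [r /= r0 rP] : exists2 r : R, 0 < r & forall w, ball x r w ->
      (forall i, derivable f w (delta_mx 0 i)) /\
      (forall i, `|'D_(delta_mx 0 i) f w - c i| <= e%:num / d.+1%:R).
    have : \forall w \near x, (forall i, derivable f w (delta_mx 0 i)) /\
      (forall i, `|'D_(delta_mx 0 i) f w - c i| <= e%:num / d.+1%:R).
      apply: filterI => //.
      apply: (@filter_forall _ _ _ (nbhs x)) => i.
      have /cvgrPdist_le /(_ _ e1) := fc i; apply: filterS => w.
      by rewrite distrC.
    by move=> /nbhs_ballP[r /= r0 rP]; exists r => // w; exact: rP.
  apply/nbhs_ballP; exists r => //= h; rewrite -ball_normE /= sub0r normrN => hr.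
  have xB : ball x r x by exact: ballxx.
  have hB : ball x r (h + x).
    by rewrite -ball_normE /= opprD addrCA subrr addr0 normrN.
  have [xi [xiB fE]] := partials_mean_value xB hB (fun w i wB => (rP w wB).1 i).
  have -> : (f \o shift x - (cst (f x) + partials_form c)) h
      = \sum_i h 0 i * ('D_(delta_mx 0 i) f (xi i) - c i).
    rewrite -[LHS]/(f (h + x) - (f x + partials_form c h)) opprD addrA fE addrK.
    rewrite /partials_form -sumrB; apply: eq_bigr => i _.
    by rewrite mulrBr.
  apply: le_trans (ler_norm_sum _ _ _) _.
  apply: (@le_trans _ _ (\sum_(i < d) `|h| * (e%:num / d.+1%:R))).
    apply: ler_sum => i _; rewrite normrM; apply: ler_pM => //.
      exact: rV_coord_le.
    exact: (rP _ (xiB i).1).2.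
  have e2 : e%:num / d.+1%:R * d%:R <= e%:num.
    by rewrite mulrAC ler_pdivrMr// ler_pM2l// ler_nat.
  rewrite sumr_const card_ord -[leLHS]mulr_natr.
  have := ler_wpM2l (normr_ge0 h) e2; rewrite mulrA => he.
  by apply: le_trans he _; rewrite mulrC.
have cc := @partials_form_continuous R d c.
have dE := diff_unique cc E; split => //.
by apply/diff_locallyP; rewrite dE; split.
Qed.

Lemma differentiable_rowP {V : normedModType R} {e : nat} (f : V -> 'rV[R]_e) x :
  (forall j, differentiable (fun v => f v 0 j) x) -> differentiable f x.
Proof.
move=> fd.
have -> : f = \sum_(j < e) (fun v => f v 0 j *: (delta_mx 0 j : 'rV[R]_e)).
  apply/funext => v; rewrite fct_sumE [LHS]row_sum_delta.
  by apply: eq_bigr.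
by apply: differentiable_sum => j; exact: differentiableZl.
Qed.

Lemma lipschitz_partials (f : 'rV[R]_d -> R) x (r C : R) y z :
  ball x r y -> ball x r z ->
  (forall w i, ball x r w -> derivable f w (delta_mx 0 i)) ->
  (forall w i, ball x r w -> `|'D_(delta_mx 0 i) f w| <= C) ->
  `|f y - f z| <= d%:R * C * `|y - z|.
Proof.
move=> yB zB fd fC; have [xi [xiB fE]] := partials_mean_value zB yB fd.
rewrite fE; apply: le_trans (ler_norm_sum _ _ _) _.
apply: (@le_trans _ _ (\sum_(i < d) `|y - z| * C)).
  apply: ler_sum => i _; rewrite normrM; apply: ler_pM => //.
    exact: rV_coord_le.
  exact: fC (xiB i).1.
rewrite sumr_const card_ord -[leLHS]mulr_natr le_eqVlt; apply/orP; left.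
by apply/eqP; ring.
Qed.

End ContinuousPartials.

(** * Families with polynomially bounded derivatives *)
Lemma near_eq_continuous {Z W : topologicalType} (f g : Z -> W) x :
  (\near x, f x = g x) -> {for x, continuous f} -> {for x, continuous g}.
Proof.
move=> fg; rewrite /prop_for /continuous_at (nbhs_singleton fg) => fc.
by apply: cvg_trans fc; apply: near_eq_cvg.
Qed.

Section DirectionalChainRule.
Context {R : realType} {d : nat}.

(** Brings the chain rule back to one variable, so that derivability in the single direction [v]
    suffices. *)
Lemma is_derive_line0 (f : 'rV[R]_d -> R) x v (l : R) :
  is_derive x v f l <-> is_derive (0 : R) 1 (fun s : R => f (x + s *: v)) l.
Proof.
have E : (fun h : R => h^-1 *: (((fun s : R => f (x + s *: v)) \o shift 0) (h *: 1)
      - f (x + 0 *: v)))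
   = (fun h : R => h^-1 *: ((f \o shift x) (h *: v) - f x)).
  apply/funext => h /=; rewrite scale0r !addr0 [x + _]addrC; congr (_ *: (f _ - _)).
  by rewrite [h *: 1]mulr1.
split=> -[]; rewrite /derivable /derive => fd <-.
  by split; [rewrite /derivable E | rewrite /derive E].
by split; [rewrite /derivable -E | rewrite /derive -E].
Qed.

Lemma is_derive_comp_dir (b : R -> R) (f : 'rV[R]_d -> R) x v (b' l : R) :
  is_derive (f x) 1 b b' -> is_derive x v f l -> is_derive x v (b \o f) (b' * l).
Proof.
move=> bd /is_derive_line0 fd; apply/is_derive_line0.
apply: (@is_derive1_comp R b (fun s => f (x + s *: v))) => //.
by rewrite scale0r addr0.
Qed.

End DirectionalChainRule.

Section Tame.
Context {R : realType} {d : nat}.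
Implicit Types (U V : set 'rV[R]_d) (F G : R -> 'rV[R]_d -> R) (f : 'rV[R]_d -> R).

(** The neighbourhood and the constants are chosen before [t]. In the application [t] is L^(-2/d),
    so a power of 1/t is a power of the truncation height L. *)
Definition loc_poly_bounded {Z : topologicalType} (A : set Z) (F : R -> Z -> R) :=
  forall x, A x -> exists (C : R) (m : nat), \forall y \near x,
    forall t, 0 < t <= 1 -> `|F t y| <= C * t^-1 ^+ m.

(* A family [F t], [0 < t <= 1], of C^n functions on [U] whose partial
   derivatives of order at most [n] are O(t^-m), locally uniformly on [U].
   The case of a constant family is that of a single C^n function. *)
Fixpoint tame (n : nat) U F : Prop :=
  [/\ forall t x, 0 < t <= 1 -> U x -> {for x, continuous (F t)},
      loc_poly_bounded U F &
      if n is n'.+1 then forall i,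
        (forall t x, 0 < t <= 1 -> U x -> derivable (F t) x (delta_mx 0 i)) /\
        tame n' U (fun t => 'D_(delta_mx 0 i) (F t))
      else True].

Lemma poly_bound_widen (C t : R) (m m' : nat) : 0 < t <= 1 -> (m <= m')%N ->
  C * t^-1 ^+ m <= `|C| * t^-1 ^+ m'.
Proof.
move=> /andP[t0 t1] mm'; apply: (@le_trans _ _ (`|C| * t^-1 ^+ m)).
  by apply: ler_wpM2r; rewrite ?exprn_ge0 ?invr_ge0 ?(ltW t0)// ler_norm.
by apply: ler_wpM2l => //; apply: ler_weXn2l => //; rewrite invf_ge1.
Qed.

Lemma loc_poly_boundedD {Z : topologicalType} (A : set Z) (F G : R -> Z -> R) :
  loc_poly_bounded A F -> loc_poly_bounded A G ->
  loc_poly_bounded A (fun t x => F t x + G t x).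
Proof.
move=> FA GA x Ax; have [C [m H]] := FA x Ax; have [C' [m' H']] := GA x Ax.
exists (`|C| + `|C'|), (maxn m m'); near=> y => t t01.
have Hy : `|F t y| <= C * t^-1 ^+ m by move: t t01; near: y.
have Hy' : `|G t y| <= C' * t^-1 ^+ m' by move: t t01 {Hy}; near: y.
apply: le_trans (ler_normD _ _) _; rewrite mulrDl lerD//.
  by apply: le_trans Hy _; apply: poly_bound_widen => //; exact: leq_maxl.
by apply: le_trans Hy' _; apply: poly_bound_widen => //; exact: leq_maxr.
Unshelve. all: by end_near. Qed.

Lemma loc_poly_boundedM {Z : topologicalType} (A : set Z) (F G : R -> Z -> R) :
  loc_poly_bounded A F -> loc_poly_bounded A G ->
  loc_poly_bounded A (fun t x => F t x * G t x).
Proof.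
move=> FA GA x Ax; have [C [m H]] := FA x Ax; have [C' [m' H']] := GA x Ax.
exists (C * C'), (m + m')%N; near=> y => t t01.
have Hy : `|F t y| <= C * t^-1 ^+ m by move: t t01; near: y.
have Hy' : `|G t y| <= C' * t^-1 ^+ m' by move: t t01 {Hy}; near: y.
by rewrite normrM exprD mulrACA ler_pM.
Unshelve. all: by end_near. Qed.

Lemma loc_poly_bounded_continuous {Z : topologicalType} (A : set Z) (f : Z -> R) :
  (forall x, A x -> {for x, continuous f}) -> loc_poly_bounded A (fun=> f).
Proof.
move=> fc x Ax; exists (`|f x| + 1), 0%N.
have /cvgrPdist_le /(_ _ ltr01) := fc x Ax; apply: filterS => y xy t _.
rewrite expr0 mulr1; have := ler_normB (f x) (f x - f y).
by rewrite opprB addrCA subrr addr0 => /le_trans; apply; rewrite lerD2l.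
Qed.

Lemma tame_le n n' U F : (n' <= n)%N -> tame n U F -> tame n' U F.
Proof.
elim: n' n F => [|n' IH] [|n] F //=; first by move=> _ [].
move=> nn [c b H]; split => // i; have [dF tF] := H i; split => //.
exact: IH tF.
Qed.

Lemma tame0 n U F : tame n U F -> tame 0 U F.
Proof. exact: tame_le. Qed.

(** Every clause of [tame] is about germs at points, so it can be checked separately around each
    point of [U]. *)
Lemma tame_local n U F :
  (forall x, U x -> exists V, V x /\ tame n V F) -> tame n U F.
Proof.
elim: n F => [|n IH] F H /=.
  by split => // [t x t01|x] Ux; have [V [Vx [c b _]]] := H x Ux;
    [exact: c | exact: b].
split => [t x t01 Ux|x Ux|i].
- by have [V [Vx [c _ _]]] := H x Ux; exact: c.
- by have [V [Vx [_ b _]]] := H x Ux; exact: b.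
split=> [t x t01 Ux|].
  by have [V [Vx [_ _ /(_ i)[dF _]]]] := H x Ux; exact: dF.
by apply: IH => x Ux; have [V [Vx [_ _ /(_ i)[_ tF]]]] := H x Ux; exists V.
Qed.

Lemma tame_eq n U F G : open U ->
  (forall t x, 0 < t <= 1 -> U x -> F t x = G t x) -> tame n U F -> tame n U G.
Proof.
move=> oU; elim: n F G => [|n IH] F G FG /=.
  have FGx t x : 0 < t <= 1 -> U x -> \near x, F t x = G t x.
    by move=> t01 Ux; near=> y; apply: FG => //; near: y; exact: open_nbhs_nbhs.
  move=> [c b _]; split => // [t x t01 Ux|x Ux].
    exact: near_eq_continuous (FGx _ _ t01 Ux) (c t x t01 Ux).
  have [C [m H]] := b x Ux; exists C, m; near=> y => t t01.
  rewrite -FG//; last by near: y; exact: open_nbhs_nbhs.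
  by move: t t01; near: y.
have FGx t x : 0 < t <= 1 -> U x -> \near x, F t x = G t x.
  by move=> t01 Ux; near=> y; apply: FG => //; near: y; exact: open_nbhs_nbhs.
move=> [c b H]; split => [t x t01 Ux|x Ux|i].
- exact: near_eq_continuous (FGx _ _ t01 Ux) (c t x t01 Ux).
- have [C [m H']] := b x Ux; exists C, m; near=> y => t t01.
  rewrite -FG//; last by near: y; exact: open_nbhs_nbhs.
  by move: t t01; near: y.
have [dF tF] := H i; split=> [t x t01 Ux|].
  by apply: near_eq_derivable (dF t x t01 Ux); exact: FGx.
by apply: IH tF => t x t01 Ux; apply: near_eq_derive; exact: FGx.
Unshelve. all: by end_near. Qed.

Lemma tame_cst n U (c : R) : tame n U (fun _ _ => c).
Proof.
have base c' : loc_poly_bounded U (fun (_ : R) (_ : 'rV[R]_d) => c').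
  by apply: loc_poly_bounded_continuous => *; exact: cst_continuous.
elim: n c => [|n IH] c /=.
  by split=> // *; exact: cst_continuous.
split=> // [*|i]; first exact: cst_continuous.
split=> [*|]; first exact: derivable_cst.
rewrite (_ : (fun t : R => _) = fun _ _ => 0)//.
by apply/funext => t; apply/funext => x; rewrite (derive_cst c).
Qed.

Lemma tameD n U F G : open U -> tame n U F -> tame n U G ->
  tame n U (fun t x => F t x + G t x).
Proof.
move=> oU; elim: n F G => [|n IH] F G /= [Fc Fb HF] [Gc Gb HG].
  split => // [t x t01 Ux|]; last exact: loc_poly_boundedD.
  by apply: continuousD; [exact: Fc | exact: Gc].
split=> [t x t01 Ux||i]; last first.
- have [dF tF] := HF i; have [dG tG] := HG i.
  split=> [t x t01 Ux|]; first by apply: derivableD; [exact: dF | exact: dG].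
  apply: tame_eq (IH _ _ tF tG) => // t x t01 Ux /=.
  by rewrite -deriveD//; [exact: dF | exact: dG].
- exact: loc_poly_boundedD.
by apply: continuousD; [exact: Fc | exact: Gc].
Qed.

Lemma tameM n U F G : open U -> tame n U F -> tame n U G ->
  tame n U (fun t x => F t x * G t x).
Proof.
move=> oU; elim: n F G => [|n IH] F G.
  move=> [Fc Fb HF] [Gc Gb HG].
  split => // [t x t01 Ux|]; last exact: loc_poly_boundedM.
  by apply: continuousM; [exact: Fc | exact: Gc].
move=> tF tG; have tF' := tame_le (leqnSn n) tF; have tG' := tame_le (leqnSn n) tG.
move: tF tG => /= [Fc Fb HF] [Gc Gb HG].
split=> [t x t01 Ux||i]; last first.
- have [dF tF] := HF i; have [dG tG] := HG i.
  split=> [t x t01 Ux|]; first by apply: derivableM; [exact: dF | exact: dG].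
  apply: tame_eq (tameD oU (IH _ _ tF' tG) (IH _ _ tG' tF)) => // t x t01 Ux /=.
  rewrite [RHS](_ : _ = 'D_(delta_mx 0 i) (F t * G t) x)//.
  by rewrite deriveM//; [exact: dF | exact: dG].
- exact: loc_poly_boundedM.
by apply: continuousM; [exact: Fc | exact: Gc].
Qed.

Lemma tame_sum n U (I : Type) (r : seq I) (F : I -> R -> 'rV[R]_d -> R) :
  open U -> (forall i, tame n U (F i)) ->
  tame n U (fun t x => \sum_(i <- r) F i t x).
Proof.
move=> oU tF; elim: r => [|i r IH].
  by apply: tame_eq (tame_cst n U 0) => // t x _ _; rewrite big_nil.
by apply: tame_eq (tameD oU (tF i) IH) => // t x _ _; rewrite big_cons.
Qed.

End Tame.
Section TamePowers.
Context {R : realType} {d : nat}.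
Implicit Types (U V : set 'rV[R]_d) (F G : R -> 'rV[R]_d -> R) (f : 'rV[R]_d -> R).

Lemma tame_continuous n U F t x : tame n U F -> 0 < t <= 1 -> U x ->
  {for x, continuous (F t)}.
Proof. by case: n => [|n] [c _ _]; exact: c. Qed.

(** An exponent of at least 2 flattens the corner of [Num.max 0] at the origin: the difference
    quotient there is at most |h|^(m+1). *)
Lemma is_derive_pos_pow (m : nat) (x : R) :
  is_derive x 1 (fun y : R => Num.max 0 y ^+ m.+2) (m.+2%:R * Num.max 0 x ^+ m.+1).
Proof.
have [x0|x0|->] := ltgtP x 0.
- have E : \near x, (cst 0 : R -> R) x = Num.max 0 x ^+ m.+2.
    near=> y; rewrite max_l ?exprS ?mul0r// ltW//.
    by near: y; exact: lt_nbhsl.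
  apply: (near_eq_is_derive E); rewrite exprS mul0r mulr0.
  exact: is_derive_cst.
- have E : \near x, (fun y : R => y ^+ m.+2) x = Num.max 0 x ^+ m.+2.
    near=> y; rewrite max_r// ltW//; near: y; exact: lt_nbhsr.
  apply: (near_eq_is_derive E).
  split; first exact: exprn_derivable.
  by rewrite exp_derive [LHS]mulr1.
rewrite exprS mul0r mulr0.
have H : (fun h : R => h^-1 *: (((fun y : R => Num.max 0 y ^+ m.+2) \o shift 0) (h *: 1)
      - Num.max 0 0 ^+ m.+2)) @ 0^' --> (0 : R).
  apply/cvgrPdist_le => e e0; near=> h.
  have h0 : h != 0 by near: h; exact: nbhs_dnbhs_neq.
  have he : `|h| <= e by near: h; exact: dnbhs0_le.
  have h1 : `|h| <= 1 by near: h; exact: dnbhs0_le.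
  rewrite /= addr0 [h *: 1]mulr1 maxxx [0 ^+ _]exprS mul0r subr0 sub0r normrN.
  rewrite normrZ normfV ler_pdivrMl ?normr_gt0// normrX.
  have mh : `|Num.max 0 h| <= `|h|.
    by case: (leP 0 h) => // _; rewrite normr0.
  apply: (@le_trans _ _ (`|h| ^+ m.+2)); first by rewrite lerXn2r ?nnegrE.
  rewrite exprS; apply: ler_wpM2l => //; apply: le_trans he.
  by rewrite exprS; apply: ler_piMr => //; apply: exprn_ile1.
split; first by apply/cvg_ex; exists 0.
exact: cvg_lim H.
Unshelve. all: by end_near. Qed.

(** Each derivative costs one power, and the last derivative must still be continuous, hence
    [n < m]. *)
Lemma tame_pos_pow (n m : nat) U f : open U -> (n < m)%N ->
  tame n U (fun=> f) -> tame n U (fun _ x => Num.max 0 (f x) ^+ m).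
Proof.
move=> oU; elim: n m => [|n IH] m nm tf.
  have cf x : U x -> {for x, continuous (fun x => Num.max 0 (f x) ^+ m)}.
    move=> Ux; apply: (@continuous_comp _ _ _ (fun x => Num.max 0 (f x)) (fun y => y ^+ m)).
      apply: (@continuous_max _ _ (cst 0) f); first exact: cst_continuous.
      by apply: (tame_continuous (t := 1) tf) => //; rewrite ltr01 lexx.
    exact: exprn_continuous.
  split => // [t x _|]; first exact: cf.
  exact: loc_poly_bounded_continuous.
have {IH} IH := IH _ _ (tame_le (leqnSn n) tf).
case: m nm => [|[|m]]// nm; have t1 : 0 < (1 : R) <= 1 by rewrite ltr01 lexx.
have dE i x : U x -> is_derive x (delta_mx 0 i) (fun x => Num.max 0 (f x) ^+ m.+2)
    (m.+2%:R * Num.max 0 (f x) ^+ m.+1 * 'D_(delta_mx 0 i) f x).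
  move=> Ux; apply: (@is_derive_comp_dir _ _ (fun y => Num.max 0 y ^+ m.+2)).
    exact: is_derive_pos_pow.
  apply: derivableP; move: tf => /= [_ _ /(_ i)[df _]]; exact: (df 1).
have [c b _] := tame0 (IH m.+2 (ltnW nm)).
split=> // i; split=> [t x _ /(dE i)[]//|].
have tDf : tame n U (fun=> 'D_(delta_mx 0 i) f) by move: tf => /= [_ _ /(_ i)[]].
apply: tame_eq (tameM oU (tameM oU (tame_cst n U m.+2%:R) (IH m.+1 nm)) tDf) => //.
by move=> t x _ Ux; have [_ ->] := dE i x Ux.
Qed.

(** [f x + t >= t] bounds every negative power by an integral power of 1/t. Differentiating only
    replaces the exponent [- p] by [- (p + 1)], so the induction on [n] keeps [p] general. *)
Lemma tame_shift_powR (n : nat) (p : R) U f : open U -> 0 < p ->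
  (forall x, U x -> 0 <= f x) -> tame n U (fun=> f) ->
  tame n U (fun t x => (f x + t) `^ (- p)).
Proof.
move=> oU p0 f0.
have cF q t x : 0 < t <= 1 -> U x -> {for x, continuous f} ->
    {for x, continuous (fun x => (f x + t) `^ (- q))}.
  move=> /andP[t0 t1] Ux cf.
  have ft : 0 < f x + t by rewrite ltr_wpDl ?f0.
  apply: (@continuous_comp _ _ _ (fun x => f x + t) (fun y => y `^ (- q))).
    by apply: continuousD => //; exact: cst_continuous.
  apply: differentiable_continuous; apply/derivable1_diffP.
  by have [] := is_derive1_powR (- q) ft.
have bF q : 0 < q -> loc_poly_bounded U (fun t x => (f x + t) `^ (- q)).
  move=> q0 x Ux; exists 1, (Num.truncn q).+1.
  have : \near x, U x by exact: open_nbhs_nbhs.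
  apply: filterS => y Uy t /andP[t0 t1].
  have ft : t <= f y + t by rewrite lerDr f0.
  rewrite ger0_norm ?powR_ge0// mul1r powRN exprVn.
  rewrite lef_pV2 ?posrE ?powR_gt0 ?exprn_gt0 ?(lt_le_trans t0)//.
  rewrite -powR_mulrn ?(ltW t0)//; apply: (@le_trans _ _ (t `^ q)).
    by apply: ger_powR; rewrite ?t0 ?t1 // ltW // truncnS_gt.
  by apply: ge0_ler_powR; rewrite ?nnegrE ?(ltW q0) ?(ltW t0) ?(le_trans (ltW t0)).
elim: n p p0 => [|n IH] p p0 tf.
  split => //; last exact: bF.
  move=> t x t01 Ux; apply: cF => //.
  exact: (tame_continuous tf t01).
have tf' := tame_le (leqnSn n) tf.
have dE i t x : 0 < t <= 1 -> U x ->
    is_derive x (delta_mx 0 i) (fun x => (f x + t) `^ (- p))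
      (- p * (f x + t) `^ (- (p + 1)) * 'D_(delta_mx 0 i) f x).
  move=> /andP[t0 t1] Ux.
  have ft : 0 < f x + t by rewrite ltr_wpDl ?f0.
  apply: (@is_derive_comp_dir _ _ (fun y => y `^ (- p)) (fun x => f x + t)).
    by rewrite opprD; exact: is_derive1_powR.
  have df : derivable f x (delta_mx 0 i).
    by move: tf => /= [_ _ /(_ i)[df _]]; apply: (df 1) => //; rewrite ltr01 lexx.
  apply: (@is_derive_eq _ _ _ (f + cst t)); first exact: is_deriveD (derivableP df) _.
  by rewrite addr0.
split.
- move=> t x t01 Ux; apply: cF => //; exact: (tame_continuous tf t01).
- exact: bF.
move=> i; split=> [t x t01 Ux|]; first by have [] := dE i t x t01 Ux.
have tDf : tame n U (fun=> 'D_(delta_mx 0 i) f) by move: tf => /= [_ _ /(_ i)[]].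
have p10 : 0 < p + 1 by rewrite addr_gt0.
apply: tame_eq (tameM oU (tameM oU (tame_cst n U (- p)) (IH _ p10 tf')) tDf) => //.
by move=> t x t01 Ux; have [_ ->] := dE i t x t01 Ux.
Qed.
End TamePowers.

Section TameClassC.
Context {R : realType} {d : nat}.
Implicit Types (U V : set 'rV[R]_d) (F G : R -> 'rV[R]_d -> R) (f : 'rV[R]_d -> R).

(** [partials] applies the last index of [s] first and [tame] recurses on the innermost derivative,
    so index sequences are taken apart from the right. *)
Lemma partials_rcons s (i : 'I_d) f :
  partials (rcons s i) f = partials s ('D_(delta_mx 0 i) f).
Proof. by rewrite /partials -cats1 foldr_cat. Qed.

Lemma class_C_tame (kappa : R) (n : nat) U f : n = Num.truncn kappa ->
  class_C kappa U f -> tame n U (fun=> f).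
Proof.
move=> nE cf; have {cf nE} : forall s : seq 'I_d, (size s <= n)%N ->
    (forall x, U x -> {for x, continuous (partials s f)}) /\
    ((size s < n)%N -> forall i x, U x -> derivable (partials s f) x (delta_mx 0 i)).
  by move=> s; rewrite {1}nE => /cf[c dd _]; rewrite nE.
elim: n f => [|n IH] f H.
  have [c _] := H [::] (leqnn _).
  split => //; first by move=> *; exact: c.
  exact: loc_poly_bounded_continuous.
have [c dd] := H [::] isT.
split=> [*||i]; [exact: c | exact: loc_poly_bounded_continuous |].
split=> [t x _ Ux|]; first exact: dd.
apply: IH => s sn; have [] := H (rcons s i); first by rewrite size_rcons.
by rewrite size_rcons ltnS partials_rcons.
Qed.

Lemma smooth_tame (n : nat) U f : smooth U f -> tame n U (fun=> f).
Proof. by move=> /(_ n); apply: class_C_tame; rewrite natrK. Qed.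

Lemma tame_partials n U F s : (size s <= n)%N -> tame n U F ->
  tame (n - size s) U (fun t => partials s (F t)).
Proof.
elim/last_ind: s n F => [|s i IH] n F; first by rewrite subn0.
rewrite size_rcons; case: n => [|n]//= sn [_ _ /(_ i)[_ tF]].
rewrite subSS (_ : (fun t => _) = fun t => partials s ('D_(delta_mx 0 i) (F t))).
  exact: IH tF.
by apply/funext => t; rewrite partials_rcons.
Qed.

Lemma tame_lipschitz n U F x : open U -> U x -> tame n.+1 U F ->
  exists (C : R) (m : nat) (r : R), [/\ 0 <= C, 0 < r &
    forall t y z, 0 < t <= 1 -> ball x r y -> ball x r z ->
      `|F t y - F t z| <= C * t^-1 ^+ m * `|y - z|].
Proof.
move=> oU Ux /= [_ _ HF].
have HD (i : 'I_d) : exists Cm : R * nat, \forall y \near x,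
    forall t, 0 < t <= 1 -> `|'D_(delta_mx 0 i) (F t) y| <= Cm.1 * t^-1 ^+ Cm.2.
  have [_ /tame0[_ b _]] := HF i; have [C [m H]] := b x Ux.
  by exists (C, m).
have [Cm CmP] := choice HD.
pose C := \sum_i `|(Cm i).1|; pose m := \max_i (Cm i).2.
have : \forall y \near x, U y /\ (forall i : 'I_d, forall t, 0 < t <= 1 ->
    `|'D_(delta_mx 0 i) (F t) y| <= (Cm i).1 * t^-1 ^+ (Cm i).2).
  apply: filterI; first exact: open_nbhs_nbhs.
  exact: (@filter_forall _ _ _ (nbhs x)).
move=> /nbhs_ballP[r /= r0 rP].
exists (d%:R * C), m, r; split => //.
  by rewrite mulr_ge0 ?sumr_ge0// => i _; rewrite normr_ge0.
move=> t y z t01 yB zB; rewrite -(mulrA d%:R C).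
apply: lipschitz_partials yB zB _ _ => w i wB; have [Uw Dw] := rP _ wB.
  have [dF _] := HF i; exact: dF.
apply: le_trans (Dw i t t01) _.
apply: (@le_trans _ _ (`|(Cm i).1| * t^-1 ^+ m)).
  by apply: poly_bound_widen => //; exact: (leq_bigmax i).
apply: ler_wpM2r.
  by move: t01 => /andP[t0 _]; rewrite exprn_ge0// invr_ge0 ltW.
by rewrite /C (bigD1 i)//= lerDl sumr_ge0.
Qed.

Lemma powR_le_pow_frac (a y : R) : 0 <= a <= 1 -> 0 <= y <= 1 -> y <= y `^ a.
Proof.
move=> /andP[a0 a1] /andP[]; rewrite le_eqVlt => /orP[/eqP <- _|y0 y1].
  exact: powR_ge0.
by apply: ger1_powR; rewrite ?y0.
Qed.

(** One derivative beyond the integer part of [kappa] makes the top partial derivatives locally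
    Lipschitz, hence Hoelder of any exponent at most 1 on sets of diameter at most 1. No fractional
    regularity has to be carried through the calculus. *)
Lemma tame_class_C (kappa : R) U F t : 0 <= kappa -> open U ->
  tame (Num.truncn kappa).+1 U F -> 0 < t <= 1 -> class_C kappa U (F t).
Proof.
move=> k0 oU + t01; rewrite /class_C /=; set k := Num.truncn kappa => tF s sk.
have := tame_partials (leqW sk) tF; rewrite subSn// => tP; split.
- by move=> x Ux; exact: (tame_continuous tP t01).
- move=> _ i x Ux; move: tP => /= [_ _ /(_ i)[dP _]]; exact: dP.
move=> sE x Ux; have [C [m [r [C0 r0 rP]]]] := tame_lipschitz oU Ux tP.
exists (C * t^-1 ^+ m), (ball x (Num.min r (1 / 2))); split.
  by apply: nbhsx_ballx; rewrite lt_min r0 divr_gt0.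
move=> y z yB zB.
have yr : ball x r y by apply: le_ball yB; rewrite ge_min lexx.
have zr : ball x r z by apply: le_ball zB; rewrite ge_min lexx.
apply: le_trans (rP t y z t01 yr zr) _.
have yz : `|y - z| <= 1.
  have yh : ball x (1 / 2) y by apply: le_ball yB; rewrite ge_min lexx orbT.
  have zh : ball x (1 / 2) z by apply: le_ball zB; rewrite ge_min lexx orbT.
  have := ball_triangle (ball_sym yh) zh; rewrite -splitr -ball_normE /=.
  exact: ltW.
apply: ler_wpM2l.
  by move: t01 => /andP[t0 _]; rewrite mulr_ge0// exprn_ge0// invr_ge0 ltW.
apply: powR_le_pow_frac; last by rewrite normr_ge0.
apply/andP; split; first by rewrite subr_ge0 truncn_le.
by rewrite lerBlDl natr1 ltW// truncnS_gt.
Qed.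

End TameClassC.

(** * Polynomial bounds, uniform on compact sets, for derivatives, Hoelder quotients and C^kappa
    norms *)

Section CompactPolyBounds.
Context {R : realType}.

(** One integer is both the constant and the degree, so bounds are monotone in [N] and finitely many
    of them merge by taking a maximum. *)
Definition pbound (N : nat) (t : R) : R := N%:R * t^-1 ^+ N.

Lemma pbound_ge0 N t : 0 < t <= 1 -> 0 <= pbound N t.
Proof. by move=> /andP[t0 _]; rewrite mulr_ge0// exprn_ge0// invr_ge0 ltW. Qed.

Lemma pbound_le N N' t : 0 < t <= 1 -> (N <= N')%N -> pbound N t <= pbound N' t.
Proof.
move=> /andP[t0 t1] NN; rewrite /pbound ler_pM ?ler_nat ?exprn_ge0 ?invr_ge0 ?(ltW t0)//.
by apply: ler_weXn2l => //; rewrite invf_ge1.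
Qed.

Lemma le_pbound (C : R) (m : nat) : exists N, forall t, 0 < t <= 1 ->
  C * t^-1 ^+ m <= pbound N t.
Proof.
exists (maxn (Num.truncn `|C|).+1 m) => t t01.
apply: le_trans (poly_bound_widen C t01 (leq_maxr (Num.truncn `|C|).+1 m)) _.
apply: ler_wpM2r.
  by move: t01 => /andP[t0 _]; rewrite exprn_ge0// invr_ge0 ltW.
apply: (@le_trans _ _ (Num.truncn `|C|).+1%:R); first by rewrite ltW// truncnS_gt.
by rewrite ler_nat leq_maxl.
Qed.

Lemma finite_common_bound (I : finType) (P : I -> nat -> Prop) :
  (forall i n n', (n <= n')%N -> P i n -> P i n') ->
  (forall i, exists n, P i n) -> exists n, forall i, P i n.
Proof.
move=> Pmon Pex; have [N NP] := choice Pex.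
by exists (\max_i N i) => i; apply: Pmon (NP i); exact: leq_bigmax.
Qed.

Lemma compact_poly_bounded {Z : topologicalType} (A : set Z) (F : R -> Z -> R) :
  compact A -> loc_poly_bounded A F ->
  exists N, forall t x, 0 < t <= 1 -> A x -> `|F t x| <= pbound N t.
Proof.
move=> cA FA.
have : near_covering A by rewrite -compact_near_coveringP.
move=> /(_ nat \oo (fun N x => forall t, 0 < t <= 1 -> `|F t x| <= pbound N t)).
case=> [x Ax|N _ NP]; last by exists N => t x t01 Ax; apply: (NP N) => /=.
have [C [m H]] := FA x Ax; have [N0 N0P] := le_pbound C m.
exists ([set y | forall t, 0 < t <= 1 -> `|F t y| <= C * t^-1 ^+ m], [set n | (N0 <= n)%N]).
  by split => //=; exact: nbhs_infty_ge.
move=> [y n] /= [yP nP] t t01; apply: le_trans (yP t t01) _.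
by apply: le_trans (N0P t t01) _; exact: pbound_le.
Qed.

Context {d : nat}.
Implicit Types (U V A : set 'rV[R]_d) (F G : R -> 'rV[R]_d -> R).

Lemma tame_partials_bound n U A F : compact A -> A `<=` U -> tame n U F ->
  exists N, forall s t x, (size s <= n)%N -> 0 < t <= 1 -> A x ->
    `|partials s (F t) x| <= pbound N t.
Proof.
move=> cA AU; elim: n F => [|n IH] F tF.
  have [_ /(_ _ (AU _ _)) b _] := tF.
  have [N NP] := compact_poly_bounded cA b.
  by exists N => -[|//] t x _; exact: NP.
have [_ b _] := tame0 tF.
have [N NP] := compact_poly_bounded cA (fun x Ax => b x (AU x Ax)).
have [N' N'P] := @finite_common_bound 'I_d (fun i N => forall s t x,
    (size s <= n)%N -> 0 < t <= 1 -> A x ->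
    `|partials s ('D_(delta_mx 0 i) (F t)) x| <= pbound N t)
  (fun i n1 n2 n12 H s t x sn t01 Ax => le_trans (H s t x sn t01 Ax) (pbound_le t01 n12))
  (fun i => IH _ (let: And3 _ _ H := tF in (H i).2)).
exists (maxn N N') => s t x; elim/last_ind: s => [|s i _] sn t01 Ax.
  by apply: le_trans (NP t x t01 Ax) (pbound_le t01 (leq_maxl _ _)).
rewrite partials_rcons; apply: le_trans (pbound_le t01 (leq_maxr _ _)).
by apply: N'P => //; move: sn; rewrite size_rcons.
Qed.

(** [A] may fail to be convex, so a local Lipschitz bound gives no global one. The quotient is
    bounded near each point of [A x A]: on the diagonal by the Lipschitz bound, elsewhere because
    the denominator stays away from 0. Compactness of the product concludes. *)
Lemma tame_holder_bound0 (a : R) U A F : 0 <= a <= 1 -> open U -> compact A ->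
  A `<=` U -> tame 1 U F ->
  exists N, forall t y z, 0 < t <= 1 -> A y -> A z ->
    `|F t y - F t z| / `|y - z| `^ a <= pbound N t.
Proof.
move=> a01 oU cA AU tF; have [a0 a1] := andP a01.
pose G (t : R) (yz : 'rV[R]_d * 'rV[R]_d) :=
  `|F t yz.1 - F t yz.2| / `|yz.1 - yz.2| `^ a.
have [] := @compact_poly_bounded _ (A `*` A) G (compact_setX cA cA).
  move=> [y z] /= [Ay Az]; have [yz|yz] := eqVneq y z.
    rewrite -{z Az}yz; have [C [m [r [C0 r0 rP]]]] := tame_lipschitz oU (AU _ Ay) tF.
    exists C, m; exists (ball y (Num.min r (1 / 2)), ball y (Num.min r (1 / 2))).
      by split; apply: nbhsx_ballx; rewrite lt_min r0 divr_gt0.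
    move=> [u v] /= [yu yv] t t01; rewrite /G /=.
    have ur : ball y r u by apply: le_ball yu; rewrite ge_min lexx.
    have vr : ball y r v by apply: le_ball yv; rewrite ge_min lexx.
    have uv1 : `|u - v| <= 1.
      have uh : ball y (1 / 2) u by apply: le_ball yu; rewrite ge_min lexx orbT.
      have vh : ball y (1 / 2) v by apply: le_ball yv; rewrite ge_min lexx orbT.
      have := ball_triangle (ball_sym uh) vh; rewrite -splitr -ball_normE /=.
      exact: ltW.
    rewrite ger0_norm ?mulr_ge0 ?invr_ge0 ?powR_ge0//.
    have t0 : 0 <= C * t^-1 ^+ m.
      by move: t01 => /andP[t0 _]; rewrite mulr_ge0// exprn_ge0// invr_ge0 ltW.
    have [uv|uv] := eqVneq u v; first by rewrite uv subrr normr0 mul0r.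
    rewrite ler_pdivrMr ?powR_gt0 ?normr_gt0 ?subr_eq0//.
    apply: le_trans (rP _ _ _ t01 ur vr) _; apply: ler_wpM2l => //.
    by apply: powR_le_pow_frac => //; rewrite normr_ge0.
  have dlt : 0 < `|y - z| by rewrite normr_gt0 subr_eq0.
  set dl := `|y - z| in dlt.
  have [_ b _] := tame0 tF.
  have [C [m H]] := b y (AU _ Ay); have [C' [m' H']] := b z (AU _ Az).
  exists ((`|C| + `|C'|) * ((dl / 2) `^ a)^-1), (maxn m m').
  exists ([set u | (forall t, 0 < t <= 1 -> `|F t u| <= C * t^-1 ^+ m)] `&` ball y (dl / 4),
          [set u | (forall t, 0 < t <= 1 -> `|F t u| <= C' * t^-1 ^+ m')] `&` ball z (dl / 4)).
    by split; apply: filterI => //; apply: nbhsx_ballx; rewrite divr_gt0.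
  move=> [u v] /= [[uC yu] [vC zv]] t t01; rewrite /G /=.
  have duv : dl / 2 <= `|u - v|.
    move: yu zv; rewrite -!ball_normE /= => yu zv.
    have h1 := ler_distD u y z; have h2 := ler_distD v u z.
    by rewrite (distrC v z) in h2; rewrite /dl; rewrite /dl in yu zv; lra.
  rewrite ger0_norm ?mulr_ge0 ?invr_ge0 ?powR_ge0// mulrAC ler_pM ?invr_ge0 ?powR_ge0//.
    apply: le_trans (ler_normB _ _) _; rewrite mulrDl lerD//.
      by apply: le_trans (uC _ t01) _; apply: poly_bound_widen => //; exact: leq_maxl.
    by apply: le_trans (vC _ t01) _; apply: poly_bound_widen => //; exact: leq_maxr.
  rewrite lef_pV2 ?posrE ?powR_gt0 ?divr_gt0 ?(lt_le_trans _ duv) ?divr_gt0//.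
  by apply: ge0_ler_powR; rewrite ?nnegrE ?(ltW dlt) ?divr_ge0 ?(ltW dlt).
move=> N NP; exists N => t y z t01 Ay Az.
have := NP t (y, z) t01 (conj Ay Az); apply: le_trans.
by rewrite /G /= ler_norm.
Qed.

Lemma tame_holder_bound (a : R) n U A F : 0 <= a <= 1 -> open U -> compact A ->
  A `<=` U -> tame n.+1 U F ->
  exists N, forall s t y z, size s = n -> 0 < t <= 1 -> A y -> A z ->
    `|partials s (F t) y - partials s (F t) z| / `|y - z| `^ a <= pbound N t.
Proof.
move=> a01 oU cA AU; elim: n F => [|n IH] F tF.
  have [N NP] := tame_holder_bound0 a01 oU cA AU tF.
  by exists N => s t y z /size0nil -> /=; exact: NP.
have [N NP] := @finite_common_bound 'I_d (fun i N => forall s t y z,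
    size s = n -> 0 < t <= 1 -> A y -> A z ->
    `|partials s ('D_(delta_mx 0 i) (F t)) y - partials s ('D_(delta_mx 0 i) (F t)) z|
      / `|y - z| `^ a <= pbound N t)
  (fun i n1 n2 n12 H s t y z sn t01 Ay Az =>
     le_trans (H s t y z sn t01 Ay Az) (pbound_le t01 n12))
  (fun i => IH _ (let: And3 _ _ H := tF in (H i).2)).
exists N => s t y z; case/lastP: s => [//|s i].
by rewrite size_rcons !partials_rcons => -[sn]; exact: NP.
Qed.

End CompactPolyBounds.

Section NormC.
Context {R : realType} {d : nat} {M : ptopologicalType}.
Variable X : riemannianManifold R d M.

Lemma norm_C_poly_bound (kappa : R) (n : nat) (ci : 'I_n -> idx X) (K : 'I_n -> set M)
    (w : R -> M -> R) : 0 <= kappa -> chart_cover ci K ->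
  (forall i : idx X, tame (Num.truncn kappa).+1 (img i) (fun t => w t \o psi i)) ->
  exists N, forall t, 0 < t <= 1 ->
    (0 <= norm_C kappa ci K (w t) <= (pbound N t)%:E)%E.
Proof.
move=> k0 [cK Kcov] tw; set k := Num.truncn kappa in tw *.
have a01 : 0 <= kappa - k%:R <= 1.
  apply/andP; split; first by rewrite subr_ge0 truncn_le.
  by rewrite lerBlDl natr1 ltW// truncnS_gt.
pose A a : set 'rV[R]_d := phi (ci a) @` K a.
have cA a : compact (A a).
  apply: continuous_compact; last by have [] := cK a.
  apply: continuous_in_subspaceT => x /set_mem Kx.
  by apply: phi_continuous; have [_] := cK a; exact.
have AU a : A a `<=` img (ci a).
  by move=> _ [x Kx <-]; exists x => //; have [_] := cK a; exact.
have oU a : open (img (ci a)) by exact: img_open.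
have [N NP] := @finite_common_bound 'I_n (fun a N => forall s t x,
    (size s <= k.+1)%N -> 0 < t <= 1 -> A a x ->
    `|partials s (w t \o psi (ci a)) x| <= pbound N t)
  (fun i n1 n2 n12 H s t x sn t01 Ax => le_trans (H s t x sn t01 Ax) (pbound_le t01 n12))
  (fun a => tame_partials_bound (cA a) (AU a) (tw (ci a))).
have [N' N'P] := @finite_common_bound 'I_n (fun a N => forall s t y z,
    size s = k -> 0 < t <= 1 -> A a y -> A a z ->
    `|partials s (w t \o psi (ci a)) y - partials s (w t \o psi (ci a)) z|
      / `|y - z| `^ (kappa - k%:R) <= pbound N t)
  (fun i n1 n2 n12 H s t y z sn t01 Ay Az =>
     le_trans (H s t y z sn t01 Ay Az) (pbound_le t01 n12))
  (fun a => tame_holder_bound a01 (oU a) (cA a) (AU a) (tw (ci a))).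
exists (maxn N N') => t t01; apply/andP; split.
  (* A point of [M] has to be produced: the supremum of an empty set would be -oo. *)
  have [a Ka] := Kcov point.
  apply: (@le_trans _ _ `|partials [::] (w t \o psi (ci a)) (phi (ci a) point)|%:E).
    by rewrite lee_fin.
  by apply: ereal_sup_ubound; left; exists a, [::], point.
apply: ge_ereal_sup => _ [[a [s [x [sk Kx ->]]]]|[a [s [x [y [sk Kx Ky xy ->]]]]]].
  rewrite lee_fin; apply: le_trans (pbound_le t01 (leq_maxl _ _)).
  by apply: NP => //; [exact: leqW | exists x].
rewrite lee_fin; apply: le_trans (pbound_le t01 (leq_maxr _ _)).
by apply: N'P => //; [exists x | exists y].
Qed.

End NormC.

(** * Volumes of ellipsoids *)
Section RealLineIntegral.
Context {R : realType}.
Local Notation lambda := (@lebesgue_measure R).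

(** No measurability is involved: the integral of a non-negative function is a supremum over the
    simple functions below it. Hence [le_lebesgue_int] compares arbitrary non-negative
    integrands. *)
Lemma ge0_le_integralT d (T : measurableType d) (m : {measure set T -> \bar R})
    (f g : T -> \bar R) :
  (forall x, 0 <= f x)%E -> (forall x, f x <= g x)%E ->
  (\int[m]_x f x <= \int[m]_x g x)%E.
Proof.
move=> f0 fg; have g0 x : (0 <= g x)%E by apply: le_trans (fg x).
rewrite !ge0_integralTE//; apply: le_ereal_sup => _ [h hf <-]; exists h => // x.
by apply: le_trans (fg x); exact: hf.
Qed.

Section Affine.
Variables (a b : R) (a0 : 0 < a).
Let phi (t : measurableTypeR R) : measurableTypeR R := (a * t + b)%R.

Let mphi : measurable_fun setT phi.
Proof.
by apply: measurable_funD => //; exact: measurable_funM.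
Qed.

(** The image of Lebesgue measure under t -> a t + b, multiplied by [a], agrees with Lebesgue
    measure on half-open intervals, hence everywhere. *)
Lemma integral_affine (f : R -> \bar R) :
  measurable_fun [set: R] f -> (forall x, 0 <= f x)%E ->
  (\int[lambda]_t f (a * t + b)%R = (a^-1)%:E * \int[lambda]_t f t)%E.
Proof.
move=> mf f0; have ai0 : 0 <= a^-1 by rewrite invr_ge0 ltW.
pose m' := (mscale (NngNum (ltW a0)) (pushforward lambda phi) :
  {measure set (measurableTypeR R) -> \bar R}).
pose m := m' mphi.
have mE A : measurable A -> lambda A = m A.
  apply: lebesgue_measure_unique => _ [[x y] _ <-] /=.
  rewrite /m /= /mscale /= /pushforward.
  rewrite (_ : phi @^-1` `]x, y]%classic = `](x - b) / a, (y - b) / a]%classic); last first.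
    apply/seteqP; split=> t /=; rewrite !in_itv /= /phi /=.
      by rewrite ltr_pdivrMr// ler_pdivlMr// ltrBlDr lerBrDr mulrC.
    by rewrite ltr_pdivrMr// ler_pdivlMr// ltrBlDr lerBrDr mulrC.
  rewrite !lebesgue_measure_itv /= !lte_fin ltr_pM2r ?invr_gt0// ltrD2r.
  case: ifP => _; last by rewrite mule0.
  rewrite -!EFinB -EFinM; congr EFin; field; exact: lt0r_neq0.
have -> : (\int[lambda]_t f t = \int[m]_t f t)%E.
  by apply: eq_measure_integral => A mA _; exact: mE.
rewrite ge0_integral_mscale//= ge0_integral_pushforward// muleA -EFinM mulVf ?gt_eqF//.
by rewrite mul1e preimage_setT.
Qed.

End Affine.
End RealLineIntegral.

Section Ellipsoids.
Context {R : realType}.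
Local Notation lambda := (@lebesgue_measure R).

Lemma lebesgue_int_ge0 d (f : 'rV[R]_d -> \bar R) : (forall v, 0 <= f v)%E ->
  (0 <= lebesgue_int f)%E.
Proof.
elim: d f => [|d IH] f f0 /=; first exact: f0.
by apply: integral_ge0 => t _; exact: IH.
Qed.

Lemma le_lebesgue_int d (f g : 'rV[R]_d -> \bar R) : (forall v, 0 <= f v)%E ->
  (forall v, f v <= g v)%E -> (lebesgue_int f <= lebesgue_int g)%E.
Proof.
elim: d f g => [|d IH] f g f0 fg /=; first exact: fg.
by apply: ge0_le_integralT => t; [exact: lebesgue_int_ge0 | exact: IH].
Qed.

(** Parametrised by the squared radius: slicing then turns [s] into [s - t ^+ 2], without square
    roots. *)
Definition ball_volume (d : nat) (s : R) : \bar R :=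
  lebesgue_int (fun v : 'rV[R]_d => (\1_[set w : 'rV[R]_d | \sum_i w 0 i ^+ 2 < s] v)%:E).

Lemma ball_volume_ge0 d s : (0 <= ball_volume d s)%E.
Proof. by apply: lebesgue_int_ge0 => v; rewrite lee_fin. Qed.

Lemma ball_volume_le d s s' : s <= s' -> (ball_volume d s <= ball_volume d s')%E.
Proof.
move=> ss; apply: le_lebesgue_int => v; first by rewrite lee_fin.
rewrite lee_fin !indicE ler_nat; case: (boolP (v \in _)) => //=.
by rewrite inE /= => vs; rewrite mem_set//=; exact: lt_le_trans ss.
Qed.

Lemma sumsq_row_mx d t (v : 'rV[R]_d) :
  \sum_i (row_mx (t%:M : 'rV[R]_1) v : 'rV[R]_d.+1) 0 i ^+ 2 = t ^+ 2 + \sum_i v 0 i ^+ 2.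
Proof.
rewrite big_ord_recl; congr (_ + _).
  have -> : ord0 = lshift d (ord0 : 'I_1) :> 'I_(1 + d) by apply: val_inj.
  by rewrite (row_mxEl (t%:M : 'rV[R]_1) v 0 ord0) mxE eqxx.
apply: eq_bigr => i _.
have -> : lift ord0 i = rshift 1 i :> 'I_(1 + d) by apply: val_inj.
by rewrite (row_mxEr (t%:M : 'rV[R]_1) v 0 i).
Qed.

Lemma ball_volumeS d s :
  ball_volume d.+1 s = (\int[lambda]_t ball_volume d (s - t ^+ 2)%R)%E.
Proof.
apply: eq_integral => t _; congr lebesgue_int; apply/funext => v.
congr (_%:E); rewrite !indicE; congr (nat_of_bool _)%:R.
apply/idP/idP; rewrite !inE /= sumsq_row_mx; lra.
Qed.

Lemma ball_volume_eq0 d s : s <= 0 -> ball_volume d s = 0%E.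
Proof.
move=> s0; rewrite /ball_volume (_ : (fun v => _) = fun=> 0%E).
  elim: d => [//|d IH] /=.
  by rewrite (eq_integral (fun=> 0%E)) ?integral0// => t _; exact: IH.
apply/funext => v; rewrite indicE memNset//= => vs.
have : 0 <= \sum_i v 0 i ^+ 2 by apply: sumr_ge0 => i _; exact: sqr_ge0.
by rewrite leNgt (lt_le_trans vs s0).
Qed.

Lemma ball_volume_fin d s : ball_volume d s \is a fin_num.
Proof.
elim: d s => [|d IH] s.
  by rewrite /ball_volume /=.
have [s0|s0] := leP s 0; first by rewrite ball_volume_eq0.
rewrite ge0_fin_numE ?ball_volume_ge0// ball_volumeS.
(* Slices with |t| > s + 1 are empty, because then t^2 >= s. *)
apply: (@le_lt_trans _ _ (\int[lambda]_(t in `[(- (s + 1))%R, (s + 1)%R]) ball_volume d s)%E).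
  rewrite [leRHS]integral_mkcond; apply: ge0_le_integralT => t; first exact: ball_volume_ge0.
  rewrite patchE; case: ifPn => [_|].
    by apply: ball_volume_le; rewrite lerBlDr lerDl sqr_ge0.
  rewrite notin_setE /= in_itv /= => /negP ts.
  rewrite ball_volume_eq0// subr_le0; apply: contraNT ts.
  by rewrite -ltNge => ts; apply/andP; split; nra.
rewrite integral_cst//= lebesgue_measure_itv /= lte_fin.
case: ifP => _; last by rewrite mule0 ltry.
by rewrite -/(ball_volume d s) -(fineK (IH s)) -EFinD -EFinM ltry.
Qed.

Lemma measurable_ball_volume d : measurable_fun [set: R] (ball_volume d).
Proof.
rewrite (_ : ball_volume d = EFin \o (fine \o ball_volume d)); last first.
  by apply/funext => s /=; rewrite fineK// ball_volume_fin.
apply/measurable_EFinP; apply: nondecreasing_measurable => // s s' ss /=.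
by apply: fine_le; rewrite ?ball_volume_fin//; exact: ball_volume_le.
Qed.

Definition qform d (G : 'M[R]_d) (v : 'rV[R]_d) : R := (v *m G *m v^T) 0 0.

Definition posdef d (G : 'M[R]_d) := G^T = G /\ forall v, v != 0 -> 0 < qform G v.

(* Completing the square, [qform G] on R^(1+d) is [c t^2 + qform G' (v + t w)]
   with [c] the Schur complement of the lower right block [G']. *)
Lemma qform_row_mx d (g : R) (b : 'rV[R]_d) (G' : 'M[R]_d) t v :
  qform (block_mx (g%:M : 'M[R]_1) b b^T G') (row_mx (t%:M : 'rV[R]_1) v) =
  g * t ^+ 2 + 2 * t * (b *m v^T) 0 0 + qform G' v.
Proof.
have sym : (v *m b^T) 0 0 = (b *m v^T) 0 0.
  by rewrite -[v *m b^T]trmxK trmx_mul trmxK mxE.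
have addE (A B : 'M[R]_1) : (A + B) 0 0 = A 0 0 + B 0 0 by rewrite mxE.
have scaleE x (A : 'M[R]_1) : (x *: A) 0 0 = x * A 0 0 by rewrite mxE.
rewrite /qform mul_row_block tr_row_mx mul_row_col !mulmxDl tr_scalar_mx.
rewrite !mul_scalar_mx !mul_mx_scalar -!scalemxAl.
by rewrite !addE !scaleE sym [g%:M 0 0]mxE eqxx mulr1n; ring.
Qed.

Lemma qformD_scale d (G : 'M[R]_d) (v w : 'rV[R]_d) t : G^T = G ->
  qform G (v + t *: w) = qform G v + 2 * t * (w *m G *m v^T) 0 0 + t ^+ 2 * qform G w.
Proof.
move=> sG; have sym : (v *m G *m w^T) 0 0 = (w *m G *m v^T) 0 0.
  have -> : v *m G *m w^T = (w *m G *m v^T)^T by rewrite !trmx_mul trmxK sG mulmxA.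
  by rewrite mxE.
have addE (A B : 'M[R]_1) : (A + B) 0 0 = A 0 0 + B 0 0 by rewrite mxE.
have scaleE x (A : 'M[R]_1) : (x *: A) 0 0 = x * A 0 0 by rewrite mxE.
rewrite /qform linearD /= linearZ /= !mulmxDl !mulmxDr -!scalemxAl -!scalemxAr.
by rewrite !addE !scaleE sym; ring.
Qed.

(** Positivity of [\det G'] is a premise of the second half because it is itself proved by induction
    from this statement, in [posdef_det_gt0]. *)
Lemma posdef_schur d (G : 'M[R]_(1 + d)) : posdef G ->
  exists (G' : 'M[R]_d), posdef G' /\ (0 < \det G' ->
  exists (w : 'rV[R]_d) (c : R),
  [/\ 0 < c, \det G = c * \det G' &
      forall (t : R) v,
      qform G (row_mx (t%:M : 'rV[R]_1) v) = c * t ^+ 2 + qform G' (v + t *: w)]).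
Proof.
move=> [sG pG]; pose G' := drsubmx G; pose b := ursubmx G; pose g := ulsubmx G 0 0.
have GE : G = block_mx (g%:M : 'M[R]_1) b b^T G'.
  rewrite -[LHS]submxK; congr block_mx; first exact: mx11_scalar.
  by rewrite /b trmx_ursub sG.
have sG' : G'^T = G' by rewrite /G' trmx_drsub sG.
exists G'; split.
  split => // v v0; have := pG (row_mx (0%:M : 'rV[R]_1) v).
  rewrite {1}GE qform_row_mx expr0n /= !mulr0 mul0r !add0r; apply.
  by apply: contraNneq v0 => v0; rewrite -(row_mxKr (0%:M : 'rV[R]_1) v) v0 linear0.
move=> dG'; have uG' : G' \in unitmx by rewrite unitmxE unitfE gt_eqF.
have [w wG] : exists w, w *m G' = b.
  by exists (b *m invmx G'); rewrite -mulmxA mulVmx// mulmx1.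
pose c := g - (b *m w^T) 0 0.
have Gw : G' *m w^T = b^T by rewrite -wG trmx_mul sG'.
have qE t v : qform G (row_mx (t%:M : 'rV[R]_1) v) = c * t ^+ 2 + qform G' (v + t *: w).
  by rewrite GE qform_row_mx qformD_scale// /qform wG /c; ring.
exists w, c; split => //.
  have := qE 1 (- w); rewrite scale1r addNr expr1n mulr1 => cE.
  have q0 : qform G' 0 = 0 by rewrite /qform !mul0mx mxE.
  rewrite q0 addr0 in cE; rewrite -cE; apply: pG; apply/eqP => r0.
  have := row_mxKl (1%:M : 'rV[R]_1) (- w); rewrite r0 linear0 => /rowP/(_ 0).
  by rewrite !mxE eqxx => /eqP; rewrite eq_sym oner_eq0.
have -> : G = block_mx (1%:M : 'M[R]_1) w 0 1%:M *m block_mx (c%:M : 'M[R]_1) 0 0 G' *m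
    block_mx (1%:M : 'M[R]_1) 0 w^T 1%:M.
  rewrite !mulmx_block !mul1mx !mul0mx !mulmx0 !mulmx1 !addr0 !add0r wG Gw GE.
  by congr block_mx; rewrite [b *m w^T]mx11_scalar -raddfD /= /c subrK.
by rewrite !det_mulmx !det_ublock det_lblock !det1 det_scalar1 !mul1r !mulr1.
Qed.

Lemma posdef_det_gt0 d (G : 'M[R]_d) : posdef G -> 0 < \det G.
Proof.
elim: d G => [|d IH] G pG; first by rewrite det_mx00.
have [G' [/IH dG' /(_ dG')[w [c [c0 -> _]]]]] := @posdef_schur d G pG.
exact: mulr_gt0.
Qed.

(** Replaces the linear change of variables. Completing the square in the first coordinate leaves an
    inner integral over an ellipsoid of [G'] translated by a multiple of [w] that depends on [t];
    the induction therefore carries an arbitrary translation [a]. *)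
Lemma lebesgue_int_ellipsoid d (G : 'M[R]_d) a (s k : R) : posdef G -> 0 <= k ->
  lebesgue_int (fun v => (k * \1_[set v | qform G (v + a) < s] v)%:E) =
  ((k / Num.sqrt (\det G))%:E * ball_volume d s)%E.
Proof.
elim: d G a s k => [|d IH] G a s k pG k0.
  rewrite /ball_volume /= det_mx00 sqrtr1 divr1 -EFinM; congr (_ * _)%:E.
  rewrite !indicE; congr (nat_of_bool _)%:R.
  by apply/idP/idP; rewrite !inE /= big_ord0 /qform mxE big_ord0.
have [G' [pG']] := @posdef_schur d G pG; have dG' := posdef_det_gt0 pG'.
move=> /(_ dG')[w [c [c0 dG qE]]] /=.
pose a0 := lsubmx (a : 'rV[R]_(1 + d)) 0 0; pose a' := rsubmx (a : 'rV[R]_(1 + d)).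
have aE : a = row_mx (a0%:M : 'rV[R]_1) a'.
  by rewrite -mx11_scalar (@hsubmxK _ _ 1 d).
have inner t : lebesgue_int (fun v : 'rV[R]_d =>
    (k * \1_[set v | qform G (v + a) < s] (row_mx (t%:M : 'rV[R]_1) v))%:E)
  = ((k / Num.sqrt (\det G'))%:E * ball_volume d (s - (Num.sqrt c * t + Num.sqrt c * a0) ^+ 2)%R)%E.
  rewrite -(IH _ (a' + (t + a0) *: w))//; congr lebesgue_int; apply/funext => v.
  congr (_ * _)%:E; rewrite !indicE; congr (nat_of_bool _)%:R.
  have rE : row_mx (t%:M : 'rV[R]_1) v + a = row_mx ((t + a0)%:M : 'rV[R]_1) (v + a').
    by rewrite aE add_row_mx -raddfD.
  have cE : (Num.sqrt c * t + Num.sqrt c * a0) ^+ 2 = c * (t + a0) ^+ 2.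
    by rewrite -mulrDr exprMn sqr_sqrtr// ltW.
  by apply/idP/idP; rewrite !inE /= rE qE cE addrA; lra.
under eq_integral do rewrite inner.
have mb : measurable_fun [set: R] (fun u : R => ball_volume d (s - u ^+ 2)).
  apply: (measurableT_comp (measurable_ball_volume d)).
  by apply: measurable_funB => //; exact: measurable_funX.
have kd0 : (0 <= (k / Num.sqrt (\det G'))%:E)%E by rewrite lee_fin divr_ge0// sqrtr_ge0.
rewrite ge0_integralZl//; last 2 first.
  - apply: (measurableT_comp mb).
    by apply: measurable_funD => //; exact: measurable_funM.
  - by move=> t _; exact: ball_volume_ge0.
have sc : 0 < Num.sqrt c by rewrite sqrtr_gt0.
rewrite (integral_affine _ sc mb); last by move=> u; exact: ball_volume_ge0.
rewrite -ball_volumeS muleA -EFinM dG sqrtrM ?(ltW c0)// invfM.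
by congr (_%:E * _)%E; rewrite mulrAC mulrA.
Qed.

(** The ball of squared radius [s] is the ellipsoid of the scalar matrix 1/s. *)
Lemma ball_volume_homog d (s : R) : 0 < s ->
  ball_volume d s = ((s `^ (d%:R / 2))%:E * ball_volume d 1)%E.
Proof.
move=> s0; have si : 0 < s^-1 by rewrite invr_gt0.
have qE v : qform (s^-1%:M : 'M[R]_d) v = s^-1 * \sum_i v 0 i ^+ 2.
  rewrite /qform mul_mx_scalar -scalemxAl mxE; congr (_ * _).
  by rewrite mxE; apply: eq_bigr => i _; rewrite mxE expr2.
have pG : posdef (s^-1%:M : 'M[R]_d).
  split=> [|v v0]; first exact: tr_scalar_mx.
  rewrite qE mulr_gt0// lt_neqAle sumr_ge0 ?andbT; last by move=> i _; exact: sqr_ge0.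
  apply: contraNneq v0 => /esym/eqP; rewrite psumr_eq0; last by move=> i _; exact: sqr_ge0.
  move=> /allP h; apply/eqP/rowP => i; rewrite mxE; apply/eqP.
  by have := h i (mem_index_enum i); rewrite sqrf_eq0.
have sE : s `^ (d%:R / 2) = 1 / Num.sqrt (\det (s^-1%:M : 'M[R]_d)).
  rewrite det_scalar div1r exprVn sqrtrV ?exprn_ge0 ?(ltW s0)// invrK powRrM.
  by rewrite powR12_sqrt ?powR_ge0// powR_mulrn// ltW.
rewrite sE -(lebesgue_int_ellipsoid 0 1 pG ler01); congr lebesgue_int.
apply/funext => v; rewrite mul1r !indicE; congr (nat_of_bool _)%:R%:E.
by apply/idP/idP; rewrite !inE /= addr0 qE ltr_pdivrMl// mulr1.
Qed.

Lemma unit_ball_volumeE d : (unit_ball_volume d)%:E = ball_volume d 1 :> \bar R.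
Proof. exact: (fineK (ball_volume_fin d 1)). Qed.
End Ellipsoids.

(** * Second moments along orbits *)
Section BoundedMeasurable.
Context d (W : measurableType d) {R : realType} (mu : probability W R).

Definition bmeas (h : W -> R) :=
  measurable_fun setT h /\ exists B, forall x, `|h x| <= B.

Lemma bmeas_integrable h : bmeas h -> mu.-integrable setT (EFin \o h).
Proof.
move=> [mh [B hB]]; apply: measurable_bounded_integrable => //.
  by rewrite (le_lt_trans (probability_le1 mu measurableT)) ?ltry.
exists B; split; first exact: num_real.
by move=> y By x _ /=; apply: le_trans (hB x) (ltW By).
Qed.

Lemma bmeas_cst c : bmeas (fun=> c).
Proof. by split=> //; exists `|c|. Qed.

Lemma bmeasD h k : bmeas h -> bmeas k -> bmeas (fun x => h x + k x).
Proof.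
move=> [mh [B hB]] [mk [C kC]]; split; first exact: measurable_funD.
by exists (B + C) => x; apply: le_trans (ler_normD _ _) _; exact: lerD.
Qed.

Lemma bmeasM h k : bmeas h -> bmeas k -> bmeas (fun x => h x * k x).
Proof.
move=> [mh [B hB]] [mk [C kC]]; split; first exact: measurable_funM.
by exists (B * C) => x; rewrite normrM ler_pM.
Qed.

Lemma bmeasZ c h : bmeas h -> bmeas (fun x => c * h x).
Proof. by move=> bh; apply: bmeasM => //; exact: bmeas_cst. Qed.

Lemma bmeas_sum (I : Type) (r : seq I) (P : pred I) (h : I -> W -> R) :
  (forall i, bmeas (h i)) -> bmeas (fun x => \sum_(i <- r | P i) h i x).
Proof.
move=> bh; elim: r => [|i r IH].
  by under eq_fun do rewrite big_nil; exact: bmeas_cst.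
under eq_fun do rewrite big_cons; case: (P i) => //.
exact: bmeasD.
Qed.

Lemma bmeas_indic A : measurable A -> bmeas (\1_A : W -> R).
Proof.
move=> mA; split; first exact: measurable_indic.
by exists 1 => x; rewrite indicE; case: (_ \in _); rewrite ?normr1// normr0.
Qed.

Definition Ex (h : W -> R) : R := (\int[mu]_x h x)%R.

Lemma ExD h k : bmeas h -> bmeas k -> Ex (fun x => h x + k x) = Ex h + Ex k.
Proof. by move=> bh bk; apply: RintegralD => //; exact: bmeas_integrable. Qed.

Lemma ExZ c h : bmeas h -> Ex (fun x => c * h x) = c * Ex h.
Proof. by move=> bh; apply: RintegralZl => //; exact: bmeas_integrable. Qed.

Lemma Ex_cst c : Ex (fun=> c) = c.
Proof. by rewrite /Ex Rintegral_cst//= probability_setT mulr1. Qed.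

Lemma Ex_sum (I : Type) (r : seq I) (P : pred I) (h : I -> W -> R) :
  (forall i, bmeas (h i)) ->
  Ex (fun x => \sum_(i <- r | P i) h i x) = \sum_(i <- r | P i) Ex (h i).
Proof.
move=> bh; elim: r => [|i r IH].
  by under [X in Ex X]eq_fun do rewrite big_nil; rewrite Ex_cst big_nil.
under [X in Ex X]eq_fun do rewrite big_cons; rewrite big_cons; case: (P i) => //.
by rewrite ExD// ?IH//; exact: bmeas_sum.
Qed.

Lemma Ex_le h k : bmeas h -> bmeas k -> (forall x, h x <= k x) -> Ex h <= Ex k.
Proof. by move=> bh bk hk; apply: le_Rintegral => //; exact: bmeas_integrable. Qed.

Lemma Ex_ge0 h : (forall x, 0 <= h x) -> 0 <= Ex h.
Proof. by move=> h0; exact: Rintegral_ge0. Qed.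

Lemma Ex_indic A : measurable A -> Ex \1_A = fine (mu A).
Proof. by move=> mA; rewrite /Ex /Rintegral integral_indic// setIT. Qed.

Lemma EFin_Ex h : bmeas h -> (Ex h)%:E = (\int[mu]_x (h x)%:E)%E.
Proof.
move=> bh; rewrite /Ex /Rintegral fineK//.
exact: integrable_fin_num (bmeas_integrable bh).
Qed.

Variables (T : W -> W) (mT : measurable_fun setT T).
Hypothesis mu_inv : forall A, measurable A -> mu (T @^-1` A) = mu A.

Lemma measurable_iter n : measurable_fun setT (iter n T).
Proof. by elim: n => [|n IH]; [exact: measurable_id | exact: (measurableT_comp mT IH)]. Qed.

Lemma measurable_preimage_iter n A : measurable A -> measurable (iter n T @^-1` A).
Proof. by move=> mA; rewrite -[X in measurable X]setTI; exact: measurable_iter. Qed.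

Lemma mu_iter n A : measurable A -> mu (iter n T @^-1` A) = mu A.
Proof.
move=> mA; elim: n => [//|n IH].
rewrite -IH -(mu_inv (measurable_preimage_iter n mA)); congr (mu _).
by apply/seteqP; split=> x /=; rewrite -iterSr.
Qed.

Lemma bmeas_iter n h : bmeas h -> bmeas (fun x => h (iter n T x)).
Proof.
move=> [mh [B hB]]; split; first exact: (measurableT_comp mh (measurable_iter n)).
by exists B.
Qed.

Lemma Ex_iter n h : bmeas h -> (forall x, 0 <= h x) -> Ex (fun x => h (iter n T x)) = Ex h.
Proof.
move=> bh h0; have [mh _] := bh; rewrite /Ex /Rintegral; congr fine.
pose m' := pushforward mu (iter n T) : {measure set W -> \bar R}.
pose m := m' (measurable_iter n).
have e : (\int[mu]_x (h x)%:E = \int[m]_x (h x)%:E)%E.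
  by apply: eq_measure_integral => A mA _; rewrite /m /= /pushforward mu_iter.
rewrite e ge0_integral_pushforward// ?preimage_setT//.
- exact: measurable_iter.
- exact/measurable_EFinP.
- by move=> x _; rewrite lee_fin.
Qed.

End BoundedMeasurable.
(** With truncated subtraction the argument of [r] is |n - m|, and in each row a given distance
    occurs at most twice, once on either side of the diagonal. *)
Lemma sum_dist_le {R : realType} (r : nat -> R) N : (forall k, 0 <= r k) ->
  \sum_(n < N) \sum_(m < N) r ((n - m) + (m - n))%N <= 2 * N%:R * \sum_(k < N) r k.
Proof.
move=> r0; have inner (n : nat) : (n < N)%N ->
    \sum_(m < N) r ((n - m) + (m - n))%N <= 2 * \sum_(k < N) r k.
  move=> nN; rewrite -(big_mkord xpredT (fun m => r ((n - m) + (m - n))%N)).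
  rewrite (@big_cat_nat _ _ _ n.+1)//= mulr_natl mulr2n; apply: lerD.
    rewrite big_nat_rev /= add0n -(big_mkord xpredT r).
    rewrite [leRHS](@big_cat_nat _ _ _ n.+1)//= -[leLHS]addr0; apply: lerD.
      rewrite le_eqVlt; apply/orP; left; apply/eqP; apply: eq_big_nat => m /andP[_ mn].
      by congr r; lia.
    by apply: sumr_ge0.
  rewrite -{1}(add0n n.+1) big_addn -(big_mkord xpredT r).
  apply: (@le_trans _ _ (\sum_(1 <= k < (N - n.+1).+1) r k)).
    rewrite big_add1 /= le_eqVlt; apply/orP; left; apply/eqP; apply: eq_big_nat => m _.
    by congr r; lia.
  apply: (@le_trans _ _ (\sum_(0 <= k < (N - n.+1).+1) r k)).
    by rewrite [leRHS]big_nat_recl// big_add1 /= lerDr.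
  rewrite [leRHS](@big_cat_nat _ _ _ (N - n.+1).+1)//=; last by lia.
  by rewrite lerDl sumr_ge0.
apply: (@le_trans _ _ (\sum_(n < N) (2 * \sum_(k < N) r k))).
  by apply: ler_sum => n _; exact: inner.
by rewrite sumr_const card_ord -[leLHS]mulr_natr le_eqVlt; apply/orP; left; apply/eqP; ring.
Qed.

Section SecondMoments.
Context d (W : measurableType d) {R : realType} (mu : probability W R).
Variables (T : W -> W) (mT : measurable_fun setT T).
Hypothesis mu_inv : forall A, measurable A -> mu (T @^-1` A) = mu A.
Local Notation E := (Ex mu).

Lemma Ex_pair h n m : bmeas h -> (forall x, 0 <= h x) ->
  E (fun x => h (iter n T x) * h (iter m T x)) =
  E (fun x => h x * h (iter ((n - m) + (m - n)) T x)).
Proof.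
move=> bh h0; wlog nm : n m / (n <= m)%N => [H|].
  have [nm|/ltnW mn] := leqP n m; first exact: H.
  under eq_fun do rewrite mulrC; rewrite H//; congr Ex; apply/funext => x.
  by rewrite addnC.
rewrite (_ : (n - m + (m - n) = m - n)%N); last lia.
have bp := bmeasM bh (bmeas_iter mT (m - n) bh).
rewrite -(@Ex_iter _ _ _ mu T mT mu_inv n _ bp); last by move=> x; exact: mulr_ge0.
by congr Ex; apply/funext => x; rewrite -iterD subnK.
Qed.

(** By stationarity the covariance of times n and k depends on |n - k| only, so the variance is a
    sum over gaps. *)
Lemma Ex_second_moment h N (r : nat -> R) : bmeas h -> (forall x, 0 <= h x) ->
  (forall k, 0 <= r k) ->
  (forall k, (k < N)%N -> E (fun x => h x * h (iter k T x)) - E h ^+ 2 <= r k) ->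
  E (fun x => (\sum_(n < N) h (iter n T x) - N%:R * E h) ^+ 2) <=
    2 * N%:R * \sum_(k < N) r k.
Proof.
move=> bh h0 r0 hr; set m := E h.
have bc n : bmeas (fun x => h (iter n T x) - m).
  by apply: bmeasD; [exact: bmeas_iter | exact: bmeas_cst].
have -> : (fun x => (\sum_(n < N) h (iter n T x) - N%:R * m) ^+ 2) =
    (fun x => \sum_(n < N) \sum_(k < N) (h (iter n T x) - m) * (h (iter k T x) - m)).
  apply/funext => x.
  have -> : \sum_(n < N) h (iter n T x) - N%:R * m = \sum_(n < N) (h (iter n T x) - m).
    by rewrite sumrB sumr_const card_ord mulr_natl.
  by rewrite expr2 mulr_suml; apply: eq_bigr => i _; rewrite mulr_sumr.
rewrite Ex_sum; last by move=> n; apply: bmeas_sum => k; exact: bmeasM.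
apply: le_trans (sum_dist_le N r0); apply: ler_sum => n _.
rewrite Ex_sum; last by move=> k; exact: bmeasM.
apply: ler_sum => k _.
have -> : (fun x => (h (iter n T x) - m) * (h (iter k T x) - m)) =
    (fun x => (h (iter n T x) * h (iter k T x) + (- m) * h (iter n T x)) +
              ((- m) * h (iter k T x) + m ^+ 2)).
  by apply/funext => x; ring.
have bi j := bmeas_iter mT j bh.
rewrite !ExD; rewrite ?Ex_cst ?ExZ ?Ex_iter ?Ex_pair//; try exact: bmeas_cst;
  try exact: bmeasZ; try exact: bmeasM; last 2 first.
- by apply: bmeasD; [exact: bmeasM | exact: bmeasZ].
- by apply: bmeasD; [exact: bmeasZ | exact: bmeas_cst].
rewrite -/m; have kN : ((n - k) + (k - n) < N)%N by have := ltn_ord n; have := ltn_ord k; lia.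
have := hr _ kN; rewrite -/m; lra.
Qed.

Definition pair_count (A : set W) N x : R :=
  \sum_(n < N) \sum_(m < N | (n < m)%N) \1_A (iter n T x) * \1_A (iter m T x).

Lemma bmeas_pair_count A N : measurable A -> bmeas (pair_count A N).
Proof.
move=> mA; apply: bmeas_sum => n; apply: bmeas_sum => m; apply: bmeasM;
  by apply: (bmeas_iter mT _ (bmeas_indic mA)).
Qed.

Lemma Ex_pair_count A N (r : nat -> R) : measurable A ->
  (forall k, 0 <= r k) ->
  (forall k, (0 < k < N)%N -> fine (mu (A `&` iter k T @^-1` A)) <= r k) ->
  E (pair_count A N) <= 2 * N%:R * \sum_(k < N) r k.
Proof.
move=> mA r0 hr; have bA := bmeas_indic (R := R) mA.
have bi j := bmeas_iter mT j bA.
rewrite /pair_count Ex_sum; last first.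
  by move=> n; apply: bmeas_sum => k; exact: bmeasM.
apply: le_trans (sum_dist_le N r0); apply: ler_sum => n _.
rewrite Ex_sum; last by move=> k; exact: bmeasM.
rewrite [leRHS](bigID (fun m : 'I_N => (n < m)%N)) /= -[leLHS]addr0; apply: lerD; last first.
  by apply: sumr_ge0.
apply: ler_sum => k nk; rewrite Ex_pair//.
have kN : (0 < (n - k) + (k - n) < N)%N by have := ltn_ord n; have := ltn_ord k; lia.
apply: le_trans (hr _ kN); rewrite -Ex_indic; last first.
  by apply: measurableI => //; exact: measurable_preimage_iter.
rewrite le_eqVlt; apply/orP; left; apply/eqP; congr Ex; apply/funext => x.
by rewrite indicI /=.
Qed.

Lemma pair_count_lt1 A N x : pair_count A N x < 1 ->
  exists n0 : nat, forall n, (n < N)%N -> n <> n0 -> ~ A (iter n T x).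
Proof.
move=> Zlt; have [[n0 [n0N An0]]|H] := pselect (exists n, (n < N)%N /\ A (iter n T x)); last first.
  by exists 0%N => n nN _ An; apply: H; exists n.
exists n0 => n nN nn0 An.
wlog : n n0 n0N An0 nN nn0 An / (n < n0)%N => [H|nlt].
  have [|] := ltnP n n0; first exact: (H n n0).
  by move=> n0n; apply: (H n0 n) => //; [exact/nesym | lia].
move: Zlt; rewrite ltNge => /negP; apply.
rewrite /pair_count (bigD1 (Ordinal nN))//= (bigD1 (Ordinal n0N))//=.
rewrite !indicE !mem_set// mulr1 -addrA lerDl addr_ge0//.
  by apply: sumr_ge0 => m _; rewrite mulr_ge0.
by apply: sumr_ge0 => i _; apply: sumr_ge0 => m _; rewrite mulr_ge0.
Qed.

(** Chebyshev and Borel-Cantelli in one step: the series of the [X j] has finite mean, so it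
    converges almost everywhere and its terms tend to 0. It serves for normalised squared deviations
    and for pair counts. *)
Lemma ae_cvg0_of_summable (X : nat -> W -> R) (u : nat -> R) (B : R) :
  (forall j, bmeas (X j)) -> (forall j x, 0 <= X j x) ->
  (forall j, E (X j) <= u j) -> (forall n, \sum_(0 <= j < n) u j <= B) ->
  {ae mu, forall x, X ^~ x @ \oo --> (0 : R)}.
Proof.
move=> bX X0 EX uB.
have mX j : measurable_fun setT (EFin \o X j) by apply/measurable_EFinP; have [] := bX j.
pose S x := (\sum_(0 <= j <oo) (X j x)%:E)%E.
have mS : measurable_fun setT S.
  by apply: ge0_emeasurable_sum => [j x _ _|j _]; [rewrite lee_fin | exact: mX].
have S0 x : (0 <= S x)%E by apply: nneseries_ge0 => j _ _; rewrite lee_fin.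
have iS : mu.-integrable setT S.
  apply/integrableP; split => //.
  under eq_integral do rewrite gee0_abs//.
  rewrite /S integral_nneseries//; last by move=> j x _; rewrite lee_fin.
  apply: (@le_lt_trans _ _ B%:E); last exact: ltry.
  apply: lime_le.
    by apply: is_cvg_nneseries => j _ _; apply: integral_ge0 => x _; rewrite lee_fin.
  near=> n; apply: (@le_trans _ _ (\sum_(0 <= j < n) u j)%:E); last by rewrite lee_fin.
  rewrite -sumEFin; apply: lee_sum => j _.
  by have := EX j; rewrite -lee_fin (EFin_Ex mu (bX j)).
have := integrable_ae measurableT iS; apply: filterS => x /(_ I) Sfin.
have cS : cvgn (series (X ^~ x)).
  apply: nondecreasing_is_cvgn.
    by apply/nondecreasing_seqP => n; rewrite /series /= big_nat_recr//= lerDl.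
  exists (fine (S x)) => _ [n _ <-].
  rewrite -lee_fin fineK// /series /= -sumEFin.
  by apply: nneseries_lim_ge => j _ _; rewrite lee_fin.
exact: cvg_series_cvg_0 cS.
Unshelve. all: by end_near. Qed.

End SecondMoments.

(** * Truncated moments *)
Lemma affine_double_le {R : realFieldType} (C L P : R) : 0 <= C -> 1 <= L ->
  P <= 2 * L -> 1 + 4 * C * P <= (1 + 8 * C) * L.
Proof. by move=> C0 L1 PL; have h := ler_wpM2l C0 PL; lra. Qed.

Section LogMeanAlgebra.
Context {R : realFieldType}.

Lemma log_mean_upper (c0 e e1 e2 t lam l K n : R) :
  0 <= c0 -> 0 < t -> 0 < e -> 1 <= lam -> 0 <= e2 -> 0 <= l ->
  lam - 1 <= t * lam -> lam <= e1 -> t * (4 * e1 * (c0 + 1)) <= e ->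
  e2 * (lam + 1) / t <= e / 4 -> n <= l / t -> K <= e / 4 * l ->
  K + (c0 * (lam - 1) + e2 * (lam + 1)) * n <= c0 * l + e * l.
Proof.
move=> c00 t0 e0 lam1 e20 l0 lam_le lam_e1 te e2t nl Kl.
have lam0 : 0 <= lam by exact: le_trans lam1.
have s1 : c0 * (lam - 1) / t <= c0 * lam.
  by rewrite ler_pdivrMr// -mulrA; apply: ler_wpM2l => //; rewrite [lam * t]mulrC.
have s2 : c0 * lam <= c0 + e / 4.
  have h3 := ler_wpM2l c00 lam_le.
  have h4 : c0 * (t * lam) <= (c0 + 1) * (t * e1).
    by apply: ler_pM => //; rewrite ?mulr_ge0 ?lerDl ?(ltW t0)// ler_pM2l.
  have {te} h5 : (c0 + 1) * (t * e1) <= e / 4.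
    by rewrite ler_pdivlMr//; apply: le_trans te; rewrite le_eqVlt; apply/orP; left; apply/eqP; ring.
  have h6 : c0 * (t * lam) <= e / 4 by exact: le_trans h5.
  by rewrite -lerBlDl; apply: le_trans h6; rewrite -[X in _ - X]mulr1 -mulrBr.
have s0 : 0 <= c0 * (lam - 1) + e2 * (lam + 1).
  by apply: addr_ge0; apply: mulr_ge0 => //; rewrite ?subr_ge0// addr_ge0.
have s3 : (c0 * (lam - 1) + e2 * (lam + 1)) * n <= (c0 + e / 4 + e / 4) * l.
  apply: le_trans (ler_wpM2l s0 nl) _.
  have -> : (c0 * (lam - 1) + e2 * (lam + 1)) * (l / t) =
     (c0 * (lam - 1) / t + e2 * (lam + 1) / t) * l by field; rewrite gt_eqF.
  by apply: ler_wpM2r => //; apply: lerD => //; exact: le_trans s2.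
have -> : c0 * l + e * l = e / 4 * l + (c0 + e / 4 + e / 4) * l + e / 4 * l by field.
by rewrite -[leLHS]addr0; apply: lerD; [exact: lerD | rewrite mulr_ge0 ?divr_ge0// ltW].
Qed.

Lemma log_mean_lower (c0 e e1 e2 e' t il l lh N k0 : R) :
  0 <= c0 -> 0 < t -> 0 < e -> 0 <= e2 -> 0 <= l -> 0 < e' < 1 -> 1 <= e1 ->
  0 < il <= 1 -> 0 <= k0 -> lh <= 0 -> t <= 1 ->
  t * il <= 1 - il -> 1 - t <= il -> t * (4 * e1 * (c0 + 1)) <= e ->
  e' * (4 * (c0 + 1)) <= e -> e2 * (4 * (e1 + 1)) = e * t ->
  0 <= N -> l + lh - (1 + k0) * t <= N * t -> N * t <= l ->
  c0 * ((1 + k0) * t - lh) <= e / 4 * l ->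
  c0 * l - e * l <= (1 - e') * (c0 * (1 - il) - e2 * (1 + il)) * N.
Proof.
move=> c00 t0 e0 e20 l0 /andP[e'0 e'1] e11 /andP[il0 il1] k00 lh0 t1 tl tl' te e'e e2E N0 Nt Ntl Kl.
have e'p : 0 <= 1 - e' by rewrite subr_ge0 ltW.
have e'l : 1 - e' <= 1 by rewrite lerBlDr lerDl ltW.
have r1 : c0 * (t * il) <= c0 * (1 - il) by exact: ler_wpM2l.
have e2il : e2 * (1 + il) <= 2 * e2.
  by rewrite [2 * e2]mulrC; apply: ler_wpM2l => //; rewrite -[2]/(1 + 1) lerD2l.
have e2p : 0 <= e2 * (1 + il) by rewrite mulr_ge0// addr_ge0// ltW.
have step1 : ((1 - e') * (c0 * (t * il)) - 2 * e2) * N <=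
    (1 - e') * (c0 * (1 - il) - e2 * (1 + il)) * N.
  apply: ler_wpM2r => //; rewrite mulrBr; apply: lerB; first exact: ler_wpM2l.
  by apply: le_trans e2il; rewrite -[leRHS]mul1r; exact: ler_wpM2r.
apply: le_trans step1.
have r2 : 2 * (e2 * N) <= e / 4 * l.
  have h : e2 * N * (4 * (e1 + 1)) <= e * l.
    by rewrite mulrAC e2E -mulrA; apply: ler_wpM2l; [exact: ltW | rewrite mulrC].
  have : e2 * N * 8 <= e * l.
    apply: le_trans h; apply: ler_wpM2l; first by rewrite mulr_ge0.
    by rewrite (_ : 8 = 4 * (1 + 1)); [rewrite ler_pM2l// lerD2r | ring].
  have -> : e2 * N * 8 = 4 * (2 * (e2 * N)) by ring.
  by rewrite -ler_pdivlMl// => /le_trans; apply; rewrite mulrA [4^-1 * e]mulrC.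
set Q := (1 - e') * (c0 * il).
have c1p : 0 < c0 + 1 by rewrite ltr_wpDl.
have r3 : c0 - e / 4 - e / 4 <= Q.
  have h4 : c0 * t <= e / 4.
    rewrite ler_pdivlMr//; apply: le_trans te.
    have -> : t * (4 * e1 * (c0 + 1)) = (c0 + 1) * (t * e1) * 4 by ring.
    rewrite ler_pM2r//; apply: ler_pM; rewrite ?lerDl ?(ltW t0)//.
    by rewrite ler_peMr// ltW.
  have h5 : e' * c0 <= e / 4.
    rewrite ler_pdivlMr//; apply: le_trans e'e.
    have -> : e' * (4 * (c0 + 1)) = e' * (c0 + 1) * 4 by ring.
    by rewrite ler_pM2r// ler_pM2l// lerDl.
  have h6 : 0 <= e' * (c0 * t) by rewrite mulr_ge0 ?mulr_ge0 ?(ltW e'0) ?(ltW t0).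
  apply: (@le_trans _ _ ((1 - e') * (c0 * (1 - t)))); last first.
    by apply: ler_wpM2l => //; exact: ler_wpM2l.
  have -> : (1 - e') * (c0 * (1 - t)) = c0 - c0 * t - e' * c0 + e' * (c0 * t) by ring.
  rewrite -[leLHS]addr0; apply: lerD => //; apply: lerB => //; exact: lerB.
have Q0 : 0 <= Q by rewrite mulr_ge0// mulr_ge0// ltW.
have Q1 : Q <= c0.
  by rewrite -[leRHS]mul1r; apply: ler_pM => //; [rewrite mulr_ge0// ltW | apply: ler_piMr].
have -> : ((1 - e') * (c0 * (t * il)) - 2 * e2) * N = Q * (N * t) - 2 * (e2 * N).
  by rewrite /Q; ring.
have kt0 : 0 <= (1 + k0) * t - lh.
  by rewrite subr_ge0 (le_trans lh0)// mulr_ge0 ?addr_ge0// ltW.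
have r5 := le_trans (ler_wpM2r kt0 Q1) Kl.
have r4 : Q * l - Q * ((1 + k0) * t - lh) <= Q * (N * t).
  by rewrite -mulrBr; apply: ler_wpM2l => //; apply: le_trans Nt; rewrite opprB addrA.
have r6 := ler_wpM2r l0 r3.
have -> : c0 * l - e * l = (c0 - e / 4 - e / 4) * l - e / 4 * l - e / 4 * l by field.
by apply: lerB => //; apply: le_trans r4; exact: lerB.
Qed.

End LogMeanAlgebra.

Section TruncatedMoments.
Context d (W : measurableType d) {R : realType} (mu : probability W R).
(** [g L] is the observable truncated at height [L], and [A y] plays the set where the untruncated
    observable exceeds [y]. Truncation distorts values well below [L] only slightly, which is
    [g_in]; [tail] is a weak L^1 tail with limit [c0]. *)
Variables (g : R -> W -> R) (A : R -> set W) (c0 : R).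
Local Notation E := (Ex mu).
Local Notation m A := (fine (mu A)).
Hypothesis mA : forall y, 1 <= y -> measurable (A y).
Hypothesis A_anti : forall y z, 1 <= y -> y <= z -> A z `<=` A y.
Hypothesis mg : forall L, 1 <= L -> measurable_fun setT (g L).
Hypothesis g_ge0 : forall L x, 1 <= L -> 0 <= g L x.
Hypothesis g_leL : forall L x, 1 <= L -> g L x <= L.
Hypothesis g_out : forall L y x, 1 <= L -> 1 <= y -> ~ A y x -> g L x <= y.
Hypothesis g_in : forall e, 0 < e -> exists2 h, 0 < h &
  forall L y x, 1 <= L -> 1 <= y -> y <= h * L -> A y x -> (1 - e) * y <= g L x.
Hypothesis tail : y * m (A y) @[y --> +oo] --> c0.

Lemma bmeas_g L : 1 <= L -> bmeas (g L).
Proof. by move=> L1; split; [exact: mg | exists L => x; rewrite ger0_norm ?g_leL ?g_ge0]. Qed.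

Let m_ge0 B : 0 <= m B. Proof. exact: fine_ge0. Qed.

Lemma tail_bound : exists2 C, 0 <= C & forall y, 1 <= y -> m (A y) <= C / y.
Proof.
have /cvgrPdist_le /(_ _ ltr01) [y0 [_ y0P]] := tail.
exists (`|c0| + 1 + `|y0|) => [|y y1]; first by rewrite !addr_ge0.
have y_gt0 : 0 < y by exact: lt_le_trans y1.
rewrite ler_pdivlMr//; have [yy0|y0y] := leP y y0.
  apply: (@le_trans _ _ (1 * y)).
    apply: ler_wpM2r; first exact: ltW.
    rewrite -lee_fin fineK ?probability_le1 ?fin_num_measure//; exact: mA.
  rewrite mul1r; apply: (le_trans yy0); apply: (le_trans (ler_norm y0)).
  by rewrite lerDr addr_ge0.
have H := y0P y y0y; have := ler_norm c0; have := ler_norm (c0 - y * m (A y)).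
have := ler_norm (- (c0 - y * m (A y))); rewrite normrN; have := normr_ge0 y0; lra.
Qed.

(** Dyadic layers: the layer at height 2^i contributes at most 4^(i+1) C / 2^i, and this geometric
    sum is dominated by its last term, of order [L]. *)
Lemma second_moment_le : exists2 C, 0 <= C & forall L, 1 <= L -> E (fun x => g L x * g L x) <= C * L.
Proof.
have [C C0 CP] := tail_bound; exists (1 + 8 * C); first by rewrite addr_ge0// mulr_ge0.
move=> L L1; have pow1 k : 1 <= (2 : R) ^+ k by apply: exprn_ege1; rewrite ler1n.
pose n := (Num.truncn (ln L / ln 2)).+1.
have ln20 : 0 < ln (2 : R) by apply: ln_gt0; rewrite ltr1n.
have L0 : 0 < L by exact: lt_le_trans L1.
have lnL0 : 0 <= ln L by exact: ln_ge0.
have Ln : L <= 2 ^+ n.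
  rewrite -ler_ln ?posrE ?exprn_gt0// lnXn// -(mulr_natl (ln 2)) -ler_pdivrMr// ltW//.
  exact: truncnS_gt.
have nL : 2 ^+ n <= 2 * L.
  rewrite /n exprS ler_pM2l// -ler_ln ?posrE ?exprn_gt0// lnXn// -(mulr_natl (ln 2)) -ler_pdivlMr//.
  by rewrite truncn_le// divr_ge0// ltW.
have four : (4 : R) = 2 ^+ 2 by rewrite expr2 -natrM.
(* The cap [2 ^+ k] lets the layers be added one at a time; at [k = n] it is at least [L] and
   disappears. *)
have pt x k : Num.min (g L x) (2 ^+ k) ^+ 2 <=
    1 + \sum_(i < k) 4 ^+ i.+1 * \1_(A (2 ^+ i)) x.
  have min0 j : 0 <= Num.min (g L x) (2 ^+ j) by rewrite le_min g_ge0// exprn_ge0.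
  elim: k => [|k IH].
    have := min0 0%N; rewrite big_ord0 addr0 expr0 => h.
    by apply: exprn_ile1 => //; rewrite ge_min lexx orbT.
  rewrite big_ord_recr /=; have [Ax|Ax] := pselect (A (2 ^+ k) x).
    rewrite indicE mem_set//= mulr1 addrA -[leLHS]add0r; apply: lerD.
      by rewrite addr_ge0// sumr_ge0// => i _; rewrite mulr_ge0// exprn_ge0.
    have -> : (4 : R) ^+ k.+1 = (2 ^+ k.+1) ^+ 2 by rewrite four -!exprM mulnC.
    apply: lerXn2r; rewrite ?nnegrE ?min0 ?exprn_ge0//.
    by rewrite ge_min lexx orbT.
  rewrite indicE memNset//= mulr0 addr0; apply: le_trans IH.
  apply: lerXn2r; rewrite ?nnegrE ?min0// le_min; apply/andP.
  split; first by rewrite ge_min lexx.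
  by rewrite ge_min (g_out L1 (pow1 k) Ax).
have bg := bmeas_g L1.
have bs : bmeas (fun x => 1 + \sum_(i < n) 4 ^+ i.+1 * \1_(A (2 ^+ i)) x : R).
  apply: bmeasD.
    exact: bmeas_cst.
  by apply: bmeas_sum => i; apply: bmeasZ; exact/bmeas_indic/mA.
apply: (@le_trans _ _ (E (fun x => 1 + \sum_(i < n) 4 ^+ i.+1 * \1_(A (2 ^+ i)) x))).
  apply: Ex_le => //; first exact: bmeasM.
  move=> x; apply: le_trans (pt x n); rewrite min_l ?expr2//.
  exact: le_trans (g_leL x L1) Ln.
rewrite ExD; [|exact: bmeas_cst|]; last first.
  by apply: bmeas_sum => i; apply: bmeasZ; exact/bmeas_indic/mA.
rewrite Ex_cst Ex_sum; last by move=> i; apply: bmeasZ; exact/bmeas_indic/mA.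
apply: (@le_trans _ _ (1 + 4 * C * 2 ^+ n)).
  rewrite lerD2l; elim: n {Ln nL bs} => [|n IH].
    by rewrite big_ord0 !mulr_ge0.
  rewrite big_ord_recr /= ExZ; last exact/bmeas_indic/mA.
  rewrite Ex_indic; last exact: mA.
  apply: (@le_trans _ _ (4 * C * 2 ^+ n + 4 ^+ n.+1 * (C / 2 ^+ n))).
    by apply: lerD => //; apply: ler_wpM2l; [rewrite exprn_ge0 | exact: CP].
  have -> : (4 : R) ^+ n.+1 = 4 * (2 ^+ n * 2 ^+ n).
    by rewrite exprS -exprD addnn -mul2n exprM -four.
  have p0 : (2 : R) ^+ n != 0 by rewrite expf_neq0.
  rewrite [2 ^+ n.+1]exprS le_eqVlt; apply/orP; left; apply/eqP; field.
  by [].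
exact: (@affine_double_le _ C L).
Qed.

Section Ladder.
Variables (t e : R) (k0 : nat).
Hypothesis t0 : 0 < t.
Hypothesis e0 : 0 <= e.
Let lam := expR t.
Hypothesis near_c0 : forall k, (k0 <= k)%N -> `|c0 - lam ^+ k * m (A (lam ^+ k))| <= e.

Let lam1 : 1 <= lam. Proof. by rewrite /lam -expR0 ler_expR ltW. Qed.
Let lam0 : 0 < lam. Proof. exact: expR_gt0. Qed.
Let lampow1 k : 1 <= lam ^+ k. Proof. exact: exprn_ege1. Qed.
Let lampow0 k : 0 < lam ^+ k. Proof. exact: exprn_gt0. Qed.
Let mAk k : measurable (A (lam ^+ k)). Proof. exact: mA. Qed.
Let bA k : bmeas (\1_(A (lam ^+ k)) : W -> R). Proof. exact: bmeas_indic. Qed.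

(** A step function on the shells between consecutive powers of [lam], above [g L] for [a = lam] up
    to end terms and below it for [a = 1 - e']. The k-th shell has measure about c0 (1 - 1/lam) /
    lam^k, so every shell adds about the same amount to the mean; about ln L / t shells produce the
    logarithm. *)
Let ladder (a : R) n x : R :=
  \sum_(k0 <= k < n) a * lam ^+ k * (\1_(A (lam ^+ k)) x - \1_(A (lam ^+ k.+1)) x).

Let bmeas_step a k : bmeas (fun x => a * lam ^+ k *
  (\1_(A (lam ^+ k)) x - \1_(A (lam ^+ k.+1)) x) : R).
Proof.
apply: bmeasZ; apply: bmeasD => //.
have -> : (fun x => - \1_(A (lam ^+ k.+1)) x : R) = fun x => (-1) * \1_(A (lam ^+ k.+1)) x.
  by apply/funext => x; rewrite mulN1r.
exact: bmeasZ.
Qed.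

Let Ex_ladder a n : E (ladder a n) =
  \sum_(k0 <= k < n) a * lam ^+ k * (m (A (lam ^+ k)) - m (A (lam ^+ k.+1))).
Proof.
rewrite /ladder Ex_sum//; apply: eq_bigr => k _.
rewrite ExZ; last first.
  have := bmeas_step 1 k; rewrite (_ : (fun x => _) = fun x => lam ^+ k * (\1_(A (lam ^+ k)) x - \1_(A (lam ^+ k.+1)) x : R)); last by apply/funext => x; rewrite mul1r.
  move=> /(bmeasZ (lam ^+ k)^-1); congr bmeas; apply/funext => x.
  by rewrite mulKf// gt_eqF.
congr (_ * _).
have -> : (fun x => \1_(A (lam ^+ k)) x - \1_(A (lam ^+ k.+1)) x : R) =
    fun x => \1_(A (lam ^+ k)) x + (-1) * \1_(A (lam ^+ k.+1)) x.
  by apply/funext => x; rewrite mulN1r.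
by rewrite ExD ?ExZ ?Ex_indic ?mulN1r//; exact: bmeasZ.
Qed.

Let bmeas_ladder a n : bmeas (ladder a n).
Proof. exact: bmeas_sum. Qed.

Let step_ge0 a k x : 0 <= a ->
  0 <= a * lam ^+ k * (\1_(A (lam ^+ k)) x - \1_(A (lam ^+ k.+1)) x).
Proof.
move=> a0; apply: mulr_ge0; first by rewrite mulr_ge0// ltW.
rewrite subr_ge0 !indicE ler_nat; case: (boolP (x \in A (lam ^+ k.+1))) => // /set_mem h.
by rewrite mem_set//; apply: A_anti h => //; rewrite ler_weXn2l.
Qed.

Lemma truncated_mean_upper L n : 1 <= L -> (k0 <= n)%N -> L <= lam ^+ n.+1 ->
  E (g L) <= lam ^+ k0 + lam * (c0 + e) + (c0 * (lam - 1) + e * (lam + 1)) * n%:R.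
Proof.
move=> L1 k0n Ln.
have pt x : g L x <= lam ^+ k0 + ladder lam n x + L * \1_(A (lam ^+ n)) x.
  have lad0 j : 0 <= ladder lam j x.
    by apply: sumr_ge0 => k _; apply: step_ge0; exact: ltW.
  have [Ax|Ax] := pselect (A (lam ^+ n) x).
    rewrite indicE mem_set// mulr1 -[leLHS]add0r; apply: lerD; last exact: g_leL.
    by rewrite addr_ge0// ltW.
  rewrite indicE memNset// mulr0 addr0.
  elim: n k0n Ax {Ln} => [|n IH] k0n Ax.
    move: k0n; rewrite leqn0 => /eqP k00; rewrite -[leLHS]addr0; apply: lerD => //.
    by apply: g_out => //; rewrite k00.
  move: k0n; rewrite leq_eqVlt => /predU1P[k00|]; last rewrite ltnS => k0n.
    rewrite -[leLHS]addr0; apply: lerD => //.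
    by apply: g_out => //; rewrite k00.
  rewrite /ladder big_nat_recr//= [\1_(A (lam ^+ n.+1)) x]indicE memNset// subr0.
  have [An|An] := pselect (A (lam ^+ n) x); last first.
    by rewrite [\1__ x]indicE memNset// mulr0 addr0; exact: IH.
  rewrite indicE mem_set// mulr1 -exprS addrA -[leLHS]add0r; apply: lerD.
    by apply: addr_ge0; [exact: ltW | exact: lad0].
  exact: g_out.
have bl : bmeas (fun x => lam ^+ k0 + ladder lam n x).
  by apply: bmeasD => //; exact: bmeas_cst.
apply: (@le_trans _ _ (E (fun x => lam ^+ k0 + ladder lam n x + L * \1_(A (lam ^+ n)) x))).
  apply: Ex_le => //; first exact: bmeas_g.
  by apply: bmeasD => //; exact: bmeasZ.
rewrite !ExD//; [|exact: bmeas_cst|exact: bmeasZ].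
rewrite Ex_cst ExZ// Ex_indic// Ex_ladder -!addrA lerD2l addrC; apply: lerD.
  have := near_c0 k0n; rewrite ler_norml => /andP[h _].
  apply: (@le_trans _ _ (lam ^+ n.+1 * m (A (lam ^+ n)))); first exact: ler_wpM2r.
  by rewrite exprS -mulrA ler_pM2l//; lra.
apply: (@le_trans _ _ (\sum_(k0 <= k < n) (c0 * (lam - 1) + e * (lam + 1)))).
  apply: ler_sum_nat => k /andP[k0k _].
  have := near_c0 k0k; have := near_c0 (leqW k0k); rewrite exprS !ler_norml.
  set a := m (A (lam ^+ k)); set b := m (A _); move=> /andP[_ h1] /andP[h2 _].
  have h3 := ler_wpM2l (ltW lam0) h2; lra.
have c00 : 0 <= c0 * (lam - 1) + e * (lam + 1).
  have := near_c0 (leqnn k0); rewrite ler_norml => /andP[h _].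
  have am : 0 <= lam ^+ k0 * m (A (lam ^+ k0)) by rewrite mulr_ge0// ltW.
  have H : 0 <= (c0 + e) * (lam - 1).
    by apply: mulr_ge0; [lra | rewrite subr_ge0].
  have -> : c0 * (lam - 1) + e * (lam + 1) = (c0 + e) * (lam - 1) + 2 * e by ring.
  by rewrite addr_ge0// mulr_ge0.
rewrite sumr_const_nat -[leLHS]mulr_natr; apply: ler_wpM2l => //.
by rewrite ler_nat leq_subr.
Qed.

(** The shells stop at height [h * L], up to which truncation hardly matters; on the logarithmic
    scale this loses only the constant [ln h]. *)
Lemma truncated_mean_lower L n h e' : 1 <= L -> 0 < h -> 0 < e' < 1 ->
  (forall y x, 1 <= y -> y <= h * L -> A y x -> (1 - e') * y <= g L x) ->
  (k0 <= n)%N -> lam ^+ n <= h * L ->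
  (1 - e') * (c0 * (1 - lam^-1) - e * (1 + lam^-1)) * (n - k0)%N%:R <= E (g L).
Proof.
move=> L1 h0 /andP[e'0 e'1] gin k0n nL.
have pt x : ladder (1 - e') n x <= g L x.
  suff : forall j, (j <= n)%N -> ladder (1 - e') j x <= g L x /\
      (A (lam ^+ j) x -> ladder (1 - e') j x = 0) by move=> /(_ n (leqnn n))[].
  elim=> [_|j IH jn].
    by rewrite /ladder big_geq//; split => //; exact: g_ge0.
  have [jk0|k0j] := ltnP j k0.
    by rewrite /ladder big_geq//; split => //; exact: g_ge0.
  have [IH1 IH2] := IH (ltnW jn).
  rewrite /ladder big_nat_recr//= -/(ladder (1 - e') j x).
  have [Aj1|Aj1] := pselect (A (lam ^+ j.+1) x).
    have Aj : A (lam ^+ j) x by apply: A_anti Aj1 => //; rewrite ler_weXn2l.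
    rewrite !indicE !mem_set// subrr mulr0 addr0 IH2//; split => //.
    exact: g_ge0.
  rewrite [\1_(A (lam ^+ j.+1)) x]indicE memNset// subr0; split => //.
  have [Aj|Aj] := pselect (A (lam ^+ j) x).
    rewrite IH2// add0r indicE mem_set// mulr1; apply: gin => //.
    by apply: le_trans nL; rewrite ler_weXn2l// ltnW.
  by rewrite indicE memNset// mulr0 addr0.
apply: (@le_trans _ _ (E (ladder (1 - e') n))); last first.
  by apply: Ex_le => //; exact: bmeas_g.
rewrite Ex_ladder mulr_natr -[X in _ *+ X]/(n - k0)%N -sumr_const_nat.
apply: ler_sum_nat => k /andP[k0k _]; rewrite -mulrA.
apply: ler_wpM2l; first by rewrite subr_ge0 ltW.
have := near_c0 k0k; have := near_c0 (leqW k0k); rewrite !ler_norml.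
set a := m (A (lam ^+ k)); set b := m (A _); rewrite exprS => /andP[h1 _] /andP[_ h2].
have li : 0 <= lam^-1 by rewrite invr_ge0 ltW.
have h3 := ler_wpM2l li h1; have E1 : lam^-1 * lam = 1 by rewrite mulVf// gt_eqF.
have E2 : lam^-1 * (c0 - lam * lam ^+ k * b) = lam^-1 * c0 - lam ^+ k * b.
  by rewrite mulrBr !mulrA E1 mul1r.
have {}h3 : - (lam^-1 * e) <= lam^-1 * c0 - lam ^+ k * b by rewrite -E2 -mulrN.
have -> : c0 * (1 - lam^-1) - e * (1 + lam^-1) =
  (c0 - e) - (lam^-1 * c0 + lam^-1 * e) by ring.
rewrite mulrBr; apply: lerB; first by rewrite lerBlDr -lerBlDl.
by move: h3; rewrite lerBrDr addrC -lerBrDr opprK.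
Qed.

End Ladder.

Lemma tail_limit_ge0 : 0 <= c0.
Proof.
rewrite leNgt; apply/negP => c0n.
have nc0 : 0 < - c0 by rewrite oppr_gt0.
have /cvgrPdist_lt /(_ _ nc0) [y0 [_ y0P]] := tail.
have y1 : y0 < `|y0| + 1 by rewrite (le_lt_trans (ler_norm _))// ltrDl.
have := y0P _ y1; rewrite /= ltr_norml => /andP[h _].
have : 0 <= (`|y0| + 1) * m (A (`|y0| + 1)) by rewrite mulr_ge0// addr_ge0.
by move: h; lra.
Qed.

Lemma truncated_mean_log : forall e, 0 < e -> exists2 L0, 1 <= L0 &
  forall L, L0 <= L -> `|E (g L) - c0 * ln L| <= e * ln L.
Proof.
move=> e e0; have c00 := tail_limit_ge0.
pose e1 := expR (1 : R); have e11 : 1 <= e1 by rewrite /e1 -expR0 ler_expR.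
(* As [t <= 1], [e1] bounds [lam]; the mesh [t] makes the rounding to powers of [lam] cost a
   fraction of [e]. *)
pose t := Num.min 1 (e / (4 * e1 * (c0 + 1))).
have c10 : 0 < c0 + 1 by rewrite ltr_wpDl.
have den : 0 < 4 * e1 * (c0 + 1) by rewrite !mulr_gt0// (lt_le_trans _ e11).
have t0 : 0 < t by rewrite lt_min ltr01 divr_gt0.
have t1 : t <= 1 by rewrite ge_min lexx.
have te : t * (4 * e1 * (c0 + 1)) <= e by rewrite -ler_pdivlMr// ge_min lexx orbT.
pose lam := expR t; have lam0 : 0 < lam by exact: expR_gt0.
have lam_e1 : lam <= e1 by rewrite ler_expR.
have lam_ge : 1 + t <= lam by exact: expR_ge1Dx.
have lam1 : 1 <= lam by apply: le_trans lam_ge; rewrite lerDl ltW.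
have lamV : lam^-1 = expR (- t) by rewrite expRN.
have lamV_ge : 1 - t <= lam^-1 by rewrite lamV; have := expR_ge1Dx (- t).
have lamVl : lam^-1 * lam = 1 by rewrite mulVf// gt_eqF.
have lamV0 : 0 < lam^-1 by rewrite invr_gt0.
have lam_le : lam - 1 <= t * lam.
  have := ler_wpM2r (ltW lam0) lamV_ge; rewrite lamVl; lra.
have lamV_le : t * lam^-1 <= 1 - lam^-1.
  have := ler_wpM2l (ltW lamV0) lam_ge; rewrite lamVl mulrDr mulr1; lra.
(* The tail error enters once per shell, and there are about [ln L / t] shells, so it has to be
   small against [t]. *)
pose e2 := e * t / (4 * (e1 + 1)).
have e1p : 0 < e1 + 1 by rewrite addr_gt0// (lt_le_trans _ e11).
have e20 : 0 < e2 by rewrite divr_gt0 ?mulr_gt0.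
have e2E : e2 * (4 * (e1 + 1)) = e * t by rewrite divfK// gt_eqF// mulr_gt0.
have [k0 k0P] : exists k0, forall k, (k0 <= k)%N -> `|c0 - lam ^+ k * m (A (lam ^+ k))| <= e2.
  have /cvgrPdist_le /(_ _ e20) [y0 [_ y0P]] := tail.
  exists (Num.truncn (`|y0| / t)).+1 => k kk; apply: y0P.
  have : `|y0| / t < k%:R.
    by apply: lt_le_trans (truncnS_gt _) _; rewrite ler_nat.
  rewrite ltr_pdivrMr// => h; apply: le_lt_trans (ler_norm _) _; apply: (lt_trans h).
  rewrite /lam -expRM_natl; apply: lt_le_trans (expR_ge1Dx _).
  by rewrite mulr_natl ltr_pwDl.
pose e' := Num.min (1 / 2) (e / (4 * (c0 + 1))).
have e'0 : 0 < e' by rewrite lt_min !divr_gt0 ?mulr_gt0.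
have e'1 : e' < 1 by rewrite gt_min; apply/orP; left; lra.
have e'e : e' * (4 * (c0 + 1)) <= e by rewrite -ler_pdivlMr ?mulr_gt0// ge_min lexx orbT.
have [h' h'0 gin'] := g_in e'0.
pose h := Num.min 1 h'; have h0 : 0 < h by rewrite lt_min ltr01.
have h1 : h <= 1 by rewrite ge_min lexx.
have lnh : ln h <= 0 by exact: ln_le0.
have gin L : 1 <= L -> forall y x, 1 <= y -> y <= h * L -> A y x -> (1 - e') * y <= g L x.
  move=> L1 y x y1 yh; apply: gin' => //; apply: (le_trans yh).
  by rewrite ler_wpM2r ?(le_trans _ L1)// ge_min lexx orbT.
pose K1 := lam ^+ k0 + lam * (c0 + e2).
pose K2 := c0 * ((1 + k0%:R) * t - ln h).
pose K3 := k0%:R * t - ln h.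
have K10 : 0 <= K1.
  by rewrite addr_ge0 ?mulr_ge0 ?addr_ge0 ?exprn_ge0 ?(ltW lam0) ?(ltW e20).
have K20 : 0 <= K2.
  by rewrite mulr_ge0// subr_ge0 (le_trans lnh)// mulr_ge0 ?(ltW t0)// addr_ge0.
have K30 : 0 <= K3.
  by rewrite subr_ge0 (le_trans lnh)// mulr_ge0 ?(ltW t0).
(* Beyond [expR l0] the additive constants [K1] and [K2] are at most [e / 4 * ln L], and
   [K3 <= ln L] places both ladders beyond the level [k0]. *)
pose l0 := 4 * (K1 + K2) / e + K3.
have l00 : 0 <= l0.
  by rewrite addr_ge0// divr_ge0 ?(ltW e0)// mulr_ge0// addr_ge0.
exists (expR l0); first by rewrite -expR0 ler_expR.
move=> L LL; have L0 : 0 < L by apply: lt_le_trans LL; exact: expR_gt0.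
have L1 : 1 <= L by apply: le_trans LL; rewrite -expR0 ler_expR.
have lL : l0 <= ln L by rewrite -(expRK l0) ler_ln ?posrE ?expR_gt0.
have K12 : K1 + K2 <= e / 4 * ln L.
  have : 4 * (K1 + K2) / e <= ln L by apply: le_trans lL; rewrite lerDl.
  rewrite ler_pdivrMr//; lra.
have K3L : K3 <= ln L.
  by apply: le_trans lL; rewrite lerDr divr_ge0 ?(ltW e0)// mulr_ge0// addr_ge0.
have lnL0 : 0 <= ln L by exact: ln_ge0.
have powE n : lam ^+ n = expR (n%:R * t) by rewrite /lam -expRM_natl mulr_natl.
have e2t : e2 * (lam + 1) / t <= e / 4.
  rewrite ler_pdivrMr// (_ : e / 4 * t = e2 * (e1 + 1)); last by move: e2E; lra.
  by rewrite ler_pM2l// lerD2r.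
have upper : E (g L) <= c0 * ln L + e * ln L.
  pose n := Num.truncn (ln L / t).
  have nle : n%:R <= ln L / t by rewrite truncn_le// divr_ge0// ltW.
  have ngt : ln L / t < n.+1%:R by exact: truncnS_gt.
  have k0n : (k0 <= n)%N.
    rewrite -ltnS -(ltr_nat R); apply: le_lt_trans ngt; rewrite ler_pdivlMr//.
    by apply: le_trans K3L; rewrite lerBrDr -lerBrDl subrr.
  have Ln : L <= lam ^+ n.+1.
    by rewrite powE -{1}(lnK (L0 : L \is Num.pos)) ler_expR -ler_pdivrMr// ltW.
  apply: le_trans (truncated_mean_upper t0 (ltW e20) k0P L1 k0n Ln) _.
  rewrite -/lam -/K1; apply: (@log_mean_upper _ c0 e e1 e2 t lam) => //.
    exact: ltW.
  by apply: le_trans K12; rewrite lerDl.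
have lower : c0 * ln L - e * ln L <= E (g L).
  pose l := ln L + ln h.
  have lE : ln (h * L) = l by rewrite lnM ?posrE// addrC.
  have k0l : k0%:R * t <= l by move: K3L; rewrite /K3 /l; lra.
  have l0' : 0 <= l by apply: le_trans k0l; rewrite mulr_ge0// ltW.
  pose n := Num.truncn (l / t).
  have nle : n%:R <= l / t by rewrite truncn_le// divr_ge0// ltW.
  have ngt : l / t < n.+1%:R by exact: truncnS_gt.
  have k0n : (k0 <= n)%N.
    by rewrite -ltnS -(ltr_nat R); apply: le_lt_trans ngt; rewrite ler_pdivlMr.
  have nh : lam ^+ n <= h * L.
    have hL0 : 0 < h * L by rewrite mulr_gt0.
    by rewrite powE -(lnK (hL0 : h * L \is Num.pos)) ler_expR lE -ler_pdivlMr.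
  have e'01 : 0 < e' < 1 by rewrite e'0.
  apply: le_trans (truncated_mean_lower t0 k0P L1 h0 e'01 (gin L L1) k0n nh).
  rewrite natrB// -/lam.
  have N0 : 0 <= (n%:R - k0%:R : R) by rewrite subr_ge0 ler_nat.
  have Nt : l - (1 + k0%:R) * t <= (n%:R - k0%:R) * t.
    rewrite ltr_pdivrMr// -natr1 in ngt.
    have -> : (n%:R - k0%:R) * t = (n%:R + 1) * t - (1 + k0%:R) * t by ring.
    by rewrite lerD2r ltW.
  have NlL : (n%:R - k0%:R) * t <= ln L.
    rewrite mulrBl lerBlDr; apply: (@le_trans _ _ l); first by rewrite -ler_pdivlMr.
    apply: (@le_trans _ _ (ln L)); first by rewrite /l gerDl.
    by rewrite lerDl mulr_ge0// ltW.
  have lamV1 : lam^-1 <= 1 by rewrite invf_le1.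
  have Kl : c0 * ((1 + k0%:R) * t - ln h) <= e / 4 * ln L.
    by apply: le_trans K12; rewrite lerDr.
  apply: (@log_mean_lower _ c0 e e1 e2 e' t lam^-1 (ln L) (ln h) _ k0%:R) => //.
    exact: ltW.
  by rewrite lamV0.
rewrite ler_norml; apply/andP; split; last by rewrite lerBlDr addrC.
by rewrite lerBrDr addrC.
Qed.

End TruncatedMoments.

(** * Almost sure estimates on blocks *)
Section RealAux.
Context {R : realType}.

Lemma powR_sixth_exp6 (j : nat) : ((j%:R : R) `^ 6^-1) ^+ 6 = j%:R.
Proof. by rewrite -powR_mulrn ?powR_ge0// -powRrM mulVf ?powRr1// pnatr_eq0. Qed.

Lemma exp_dominates (a : R) (k : nat) : 1 < a ->
  exists j0, forall j, (j0 <= j)%N -> (j%:R : R) ^+ k <= a ^+ j.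
Proof.
move=> a1; have a0 : 0 < a by exact: lt_trans a1.
have la : 0 < ln a by exact: ln_gt0.
pose K := (ln a / k.+1%:R) ^+ k.+1; have K0 : 0 < K by rewrite exprn_gt0// divr_gt0.
exists (Num.truncn K^-1).+1 => j jj.
have Kj : 1 <= j%:R * K.
  rewrite -ler_pdivrMr// div1r; apply: ltW; apply: lt_le_trans (truncnS_gt _) _.
  by rewrite ler_nat.
have -> : a ^+ j = expR (ln a * j%:R / k.+1%:R) ^+ k.+1.
  by rewrite -expRM_natr divfK// expRM_natr lnK.
have h : ln a * j%:R / k.+1%:R <= expR (ln a * j%:R / k.+1%:R).
  by apply: le_trans (expR_ge1Dx _); rewrite lerDr.
have h0 : 0 <= ln a * j%:R / k.+1%:R by rewrite divr_ge0// mulr_ge0// ltW.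
apply: (@le_trans _ _ ((ln a * j%:R / k.+1%:R) ^+ k.+1)); last first.
  by apply: lerXn2r => //; rewrite nnegrE// expR_ge0.
have -> : (ln a * j%:R / k.+1%:R) ^+ k.+1 = j%:R ^+ k * (j%:R * K).
  by rewrite mulrAC exprMn -/K mulrA -exprSr mulrC.
by rewrite ler_peMr// exprn_ge0.
Qed.

Lemma sum_window_le (X S : R) N : 0 <= X -> 0 <= S ->
  \sum_(k < N) (if (0 < k)%N && (k%:R <= X) then S else 0) <= X * S.
Proof.
move=> X0 S0; suff : \sum_(k < N) (if (0 < k)%N && (k%:R <= X) then S else 0) <= (Num.truncn X)%:R * S.
  by move=> /le_trans; apply; apply: ler_wpM2r => //; rewrite truncn_le.
apply: (@le_trans _ _ (\sum_(k < N) (if (k.-1 < Num.truncn X)%N && (0 < k)%N then S else 0))).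
  apply: ler_sum => k _; case: ifP => [/andP[k0 kX]|_]; last by case: ifP.
  have kt : (k <= Num.truncn X)%N by rewrite truncn_ge_nat.
  by rewrite k0 andbT (leq_trans _ kt)// prednK.
rewrite -(big_mkord xpredT (fun k => if (k.-1 < Num.truncn X)%N && (0 < k)%N then S else 0)).
case: N => [|N]; first by rewrite big_geq// mulr_ge0.
rewrite big_nat_recl//= andbF add0r; under eq_bigr do rewrite andbT.
elim: N => [|N IH]; first by rewrite big_geq// mulr_ge0.
suff : forall n, \sum_(0 <= i < n) (if (i < Num.truncn X)%N then S else 0) = (minn n (Num.truncn X))%:R * S.
  by move=> ->; apply: ler_wpM2r => //; rewrite ler_nat geq_minr.
elim=> [|n IHn]; first by rewrite big_geq// min0n mul0r.
rewrite big_nat_recr//= IHn; case: ltnP => h.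
  by rewrite !(minn_idPl _) ?(ltnW h)// -natr1 mulrDl mul1r.
by rewrite addr0 !(minn_idPr _)// leqW.
Qed.

End RealAux.

Section BlockEstimates.
Context d (W : measurableType d) {R : realType} (mu : probability W R).
Variables (T : W -> W) (mT : measurable_fun setT T).
Hypothesis mu_inv : forall A, measurable A -> mu (T @^-1` A) = mu A.
Variables (g : R -> W -> R) (A : R -> set W) (c0 : R).
Local Notation E := (Ex mu).
Local Notation m A := (fine (mu A)).
Hypothesis mA : forall y, 1 <= y -> measurable (A y).
Hypothesis A_anti : forall y z, 1 <= y -> y <= z -> A z `<=` A y.
Hypothesis mg : forall L, 1 <= L -> measurable_fun setT (g L).
Hypothesis g_ge0 : forall L x, 1 <= L -> 0 <= g L x.
Hypothesis g_leL : forall L x, 1 <= L -> g L x <= L.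
Hypothesis g_out : forall L y x, 1 <= L -> 1 <= y -> ~ A y x -> g L x <= y.
Hypothesis g_in : forall e, 0 < e -> exists2 h, 0 < h &
  forall L y x, 1 <= L -> 1 <= y -> y <= h * L -> A y x -> (1 - e) * y <= g L x.
Hypothesis tail : y * m (A y) @[y --> +oo] --> c0.
Variables (Cm gam : R) (mm : nat).
Hypothesis Cm0 : 0 <= Cm.
Hypothesis gam0 : 0 < gam.
Hypothesis mix1 : forall L n, 1 <= L ->
  E (fun x => g L x * g L (iter n T x)) - E (g L) ^+ 2 <= Cm * L ^+ mm * expR (- gam * n%:R).
Hypothesis mix2 : forall L n, 1 <= L ->
  E (fun x => g L x ^+ 2 * g L (iter n T x) ^+ 2) - E (fun x => g L x ^+ 2) ^+ 2
    <= Cm * L ^+ mm * expR (- gam * n%:R).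
Variable (CA : R).
Hypothesis CA0 : 0 <= CA.
(** Dominates the indicator of [A L] by a multiple of [g L x ^+ 2 / L ^+ 2], so that [mix2] controls
    joint visits to [A L]. *)
Hypothesis A_maj : forall L x, 1 <= L -> A L x -> L ^+ 2 <= CA * g L x ^+ 2.
Hypothesis slow : forall D, 0 < D -> exists C L0, 0 <= C /\
  forall L n, 1 <= L -> L0 <= L -> (0 < n)%N -> n%:R <= D * ln L ->
    m (A L `&` iter n T @^-1` A L) <= C / (L * ln L ^+ 5).

Let bg := @bmeas_g _ W R g mg g_ge0 g_leL.

(** If one of the two points lies outside [A L'], the product is at most [L'] times the other
    factor; only a joint visit to [A L'] costs [L ^+ 2]. Slow recurrence is thus invoked at a level
    [L'] that can be optimised independently of [L]. *)
Lemma short_cov_le L L' k : 1 <= L -> 1 <= L' ->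
  E (fun x => g L x * g L (iter k T x)) <=
  2 * L' * E (g L) + L ^+ 2 * m (A L' `&` iter k T @^-1` A L').
Proof.
move=> L1 L1'; have b := bg L1; have bk := bmeas_iter mT k b.
have mAA : measurable (A L' `&` iter k T @^-1` A L').
  by apply: measurableI; [exact: mA | apply: measurable_preimage_iter => //; exact: mA].
have bi : bmeas (\1_(A L' `&` iter k T @^-1` A L') : W -> R) by exact: bmeas_indic.
apply: (@le_trans _ _ (E (fun x => (L' * g L x + L' * g L (iter k T x)) +
    L ^+ 2 * \1_(A L' `&` iter k T @^-1` A L') x))); last first.
  rewrite !ExD ?ExZ ?Ex_iter ?Ex_indic//; try exact: bmeasZ.
  - by rewrite le_eqVlt; apply/orP; left; apply/eqP; ring.
  - by move=> x; exact: g_ge0.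
  - by apply: bmeasD; exact: bmeasZ.
apply: Ex_le; first exact: bmeasM.
  by apply: bmeasD; [apply: bmeasD; exact: bmeasZ | exact: bmeasZ].
move=> x; set u := g L x; set v := g L _.
have u0 : 0 <= u by exact: g_ge0.
have v0 : 0 <= v by exact: g_ge0.
have L'0 : 0 <= L' by exact: le_trans L1'.
have ind0 : 0 <= L ^+ 2 * \1_(A L' `&` iter k T @^-1` A L') x.
  by rewrite mulr_ge0// sqr_ge0.
have [Ax|Ax] := pselect (A L' x); last first.
  have uL : u <= L' by exact: g_out.
  apply: le_trans (ler_wpM2r v0 uL) _; rewrite -[leLHS]addr0; apply: lerD => //.
  by rewrite lerDr mulr_ge0.
have [Ay|Ay] := pselect (A L' (iter k T x)); last first.
  have vL : v <= L' by exact: g_out.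
  apply: le_trans (ler_wpM2l u0 vL) _; rewrite -[leLHS]addr0; apply: lerD => //.
  by rewrite mulrC lerDl mulr_ge0.
rewrite indicE mem_set//= mulr1 -[leLHS]add0r; apply: lerD.
  by rewrite addr_ge0// mulr_ge0.
by rewrite expr2; apply: ler_pM => //; exact: g_leL.
Qed.

Variables (a B : R).
Hypothesis a1 : 1 < a.
Hypothesis B0 : 0 <= B.
Let w (j : nat) : R := j%:R `^ 6^-1.
Let b (j : nat) : R := a ^+ j.

Let la0 : 0 < ln a. Proof. exact: ln_gt0. Qed.
Let a0 : 0 < a. Proof. exact: lt_trans a1. Qed.
(** Beyond a gap of [D * j] the mixing rate is below [b j] to the power -(2 mm + 4). It absorbs the
    factor [L ^+ mm], at most [b j] to the power 2 mm, and leaves [b j] to the power -4. *)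
Let D : R := (2 * mm%:R + 4) * ln a / gam.
Let D0 : 0 < D. Proof. by rewrite divr_gt0// mulr_gt0// ltr_wpDl// mulr_ge0. Qed.

Let long_gap j k L : 1 <= L -> L <= b j ^+ 2 -> D * j%:R < k%:R ->
  Cm * L ^+ mm * expR (- gam * k%:R) <= Cm / b j ^+ 4.
Proof.
move=> L1 Lb jk; have b0 : 0 < b j by exact: exprn_gt0.
rewrite -mulrA; apply: ler_wpM2l => //.
apply: (@le_trans _ _ (b j ^+ 2 ^+ mm * (b j ^+ (2 * mm + 4))^-1)).
  apply: ler_pM; rewrite ?exprn_ge0 ?expR_ge0 ?(le_trans _ L1)//.
    by apply: lerXn2r => //; rewrite nnegrE ?exprn_ge0 ?(le_trans _ L1)// ltW.
  have -> : b j ^+ (2 * mm + 4) = expR (gam * (D * j%:R)).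
    have -> : gam * (D * j%:R) = ln a * (j * (2 * mm + 4))%:R.
      by rewrite natrM natrD natrM /D; field; rewrite gt_eqF.
    by rewrite expRM_natr lnK// exprM.
  by rewrite -expRN ler_expR mulNr lerN2 ler_wpM2l// ltW.
rewrite -exprM exprD invfM mulrA mulfV ?mul1r// gt_eqF//.
by rewrite exprn_gt0.
Qed.

(** The power 24 guarantees that the auxiliary level [b j / w j ^+ 12] is at least [w j ^+ 12],
    hence large. *)
Let block_facts : exists j0, forall j, (j0 <= j)%N ->
  [/\ 1 <= w j, w j ^+ 6 = j%:R & w j ^+ 24 <= b j].
Proof.
have [j0 j0P] := exp_dominates 4 a1; exists (maxn 1 j0) => j.
rewrite geq_max => /andP[j1 jj]; have w6 := powR_sixth_exp6 (R := R) j.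
split => //; last by rewrite (_ : 24 = 6 * 4)%N// exprM w6; exact: j0P.
rewrite -(powRr0 (j%:R : R)); apply: ler_powR; last by rewrite invr_ge0.
by rewrite ler1n.
Qed.

(** The diagonal dominates: it contributes [O(L)], with L = b w^5, whereas the O(w^6) short gaps
    together contribute O(b). Divided by (b w^6)^2 the bound becomes w^(-7) = j^(-7/6). *)
Lemma variance_block : exists C j0, 0 <= C /\ forall j N, (j0 <= j)%N -> N%:R <= B * b j ->
  E (fun x => (\sum_(n < N) g (b j * w j ^+ 5) (iter n T x)
               - N%:R * E (g (b j * w j ^+ 5))) ^+ 2) <= C * (b j ^+ 2 * w j ^+ 5).
Proof.
have [C2 C20 C2P] := second_moment_le mA mg g_ge0 g_leL g_out tail.
have [L1 L11 L1P] := truncated_mean_log mA A_anti mg g_ge0 g_leL g_out g_in tail ltr01.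
have c00 := tail_limit_ge0 tail.
have D'0 : 0 < 2 * D / ln a by rewrite divr_gt0// mulr_gt0.
have [Cs [L0 [Cs0 CsP]]] := slow D'0.
have [j0 j0P] := block_facts.
pose Cg := (c0 + 1) * (2 * ln a).
have Cg0 : 0 <= Cg by rewrite mulr_ge0 ?addr_ge0// mulr_ge0// ltW.
pose Cs' := Cs * (2 / ln a) ^+ 5.
have Cs'0 : 0 <= Cs' by rewrite mulr_ge0// exprn_ge0// divr_ge0// ltW.
pose C := 2 * B * (C2 + D * (2 * Cg + Cs') + B * Cm).
have D0' : 0 <= D by exact: ltW.
have E0 : 0 <= 2 * Cg + Cs' by rewrite addr_ge0// mulr_ge0.
have C0 : 0 <= C.
  apply: mulr_ge0; first exact: mulr_ge0.
  by apply: addr_ge0; [apply: addr_ge0 => //; exact: mulr_ge0 | exact: mulr_ge0].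
exists C, (maxn j0 (maxn (Num.truncn L0).+1 (Num.truncn L1).+1)); split => // j N.
rewrite !geq_max => /and3P[jj jL0 jL1] NB.
have [w1 w6 w24] := j0P j jj.
have jL0' : L0 <= j%:R by rewrite ltW// (lt_le_trans (truncnS_gt _))// ler_nat.
have jL1' : L1 <= j%:R by rewrite ltW// (lt_le_trans (truncnS_gt _))// ler_nat.
move: w1 w6 w24 NB; set V := w j; set bb := b j => w1 w6 w24 NB.
have W0 : 0 < V by exact: lt_le_trans w1.
have wle k k' : (k <= k')%N -> V ^+ k <= V ^+ k' by move=> kk; exact: ler_weXn2l.
have wk0 k : 0 < V ^+ k by exact: exprn_gt0.
have wk1 k : 1 <= V ^+ k by exact: exprn_ege1.
have wb k : (k <= 24)%N -> V ^+ k <= bb by move=> /wle /le_trans; apply.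
have bb1 : 1 <= bb by exact: le_trans (wb 0%N isT).
have bb0 : 0 < bb by exact: lt_le_trans bb1.
have lnb : ln bb = j%:R * ln a by rewrite /bb /b lnXn// mulr_natl.
(* With this [L'] both terms of [short_cov_le] are O(bb / V^6): the first because the mean of [g L]
   is O(V^6), the second because the fifth power of the logarithm is of order V^30, which gives bb /
   V^8. *)
pose L := bb * V ^+ 5; pose L' := bb / V ^+ 12.
have bL : bb <= L by rewrite ler_peMr// ltW.
have L_ge1 : 1 <= L by exact: le_trans bL.
have L0p : 0 < L by exact: lt_le_trans L_ge1.
have LL2 : L <= bb ^+ 2 by rewrite expr2 ler_pM2l// wb.
have wL' : V ^+ 12 <= L' by rewrite ler_pdivlMr// -exprD.
have L'1 : 1 <= L' by exact: le_trans (wk1 _) wL'.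
have L'0 : 0 < L' by exact: lt_le_trans L'1.
have lnL : ln L <= 2 * (j%:R * ln a).
  by rewrite -lnb mulr_natl -lnXn// ler_ln ?posrE// exprn_gt0.
have lnL' : j%:R * ln a <= 2 * ln L'.
  rewrite -lnb mulr_natl -lnXn// ler_ln ?posrE ?exprn_gt0//.
  have -> : L' ^+ 2 = bb * (bb / V ^+ 24) by rewrite /L'; field; rewrite gt_eqF.
  by rewrite ler_peMr ?(ltW bb0)// ler_pdivlMr ?mul1r.
have L0L' : L0 <= L'.
  by apply: (le_trans jL0'); rewrite -w6; apply: le_trans wL'; exact: wle.
have L1L : L1 <= L.
  apply: (le_trans jL1'); rewrite -w6; apply: le_trans bL; exact: wb.
have Eg0 : 0 <= E (g L) by apply: Ex_ge0 => x; exact: g_ge0.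
have EgL : E (g L) <= Cg * V ^+ 6.
  have := L1P L L1L; rewrite ler_norml mul1r lerBlDr => /andP[_ h].
  apply: (@le_trans _ _ ((c0 + 1) * ln L)); first by rewrite mulrDl mul1r addrC.
  rewrite /Cg -mulrA; apply: ler_wpM2l; first by rewrite addr_ge0.
  by apply: le_trans lnL _; rewrite w6 -mulrA [ln a * _]mulrC.
pose S := (2 * Cg + Cs') * (bb / V ^+ 6).
have S0 : 0 <= S by apply: mulr_ge0 => //; apply: divr_ge0; exact: ltW.
have shortP k : (0 < k)%N -> k%:R <= D * j%:R ->
    E (fun x => g L x * g L (iter k T x)) <= S.
  move=> k0 kD; apply: le_trans (short_cov_le k L_ge1 L'1) _.
  have kD' : k%:R <= 2 * D / ln a * ln L'.
    apply: (le_trans kD); rewrite (_ : 2 * D / ln a * ln L' = D / ln a * (2 * ln L')); last by ring.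
    have -> : D * j%:R = D / ln a * (j%:R * ln a) by field; rewrite gt_eqF.
    by apply: ler_wpM2l => //; rewrite divr_ge0// ltW.
  have mle : m (A L' `&` iter k T @^-1` A L') <= Cs' / (bb * V ^+ 18).
    apply: le_trans (CsP L' k L'1 L0L' k0 kD') _.
    have lnL'5 : (V ^+ 6 * (ln a / 2)) ^+ 5 <= ln L' ^+ 5.
      apply: lerXn2r; rewrite ?nnegrE; last first.
        by rewrite w6 mulrA ler_pdivrMr// mulrC [ln L' * 2]mulrC [ln a * _]mulrC.
        exact: ln_ge0.
      by rewrite mulr_ge0 ?divr_ge0// ltW.
    have pw : 0 < V ^+ 6 * (ln a / 2) by rewrite mulr_gt0// divr_gt0.
    apply: (@le_trans _ _ (Cs / (L' * (V ^+ 6 * (ln a / 2)) ^+ 5))).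
      have lnp : 0 < ln L' ^+ 5 by apply: lt_le_trans lnL'5; rewrite exprn_gt0.
      apply: ler_wpM2l => //; rewrite lef_pV2 ?posrE; first by rewrite ler_pM2l.
        exact: mulr_gt0.
      by rewrite mulr_gt0// exprn_gt0.
    rewrite le_eqVlt; apply/orP; left; apply/eqP; rewrite /Cs' /L'.
    by field; rewrite !gt_eqF.
  apply: (@le_trans _ _ (2 * L' * (Cg * V ^+ 6) + L ^+ 2 * (Cs' / (bb * V ^+ 18)))).
    apply: lerD; first by apply: ler_wpM2l => //; rewrite mulr_ge0// ltW.
    by apply: ler_wpM2l => //; exact: sqr_ge0.
  have -> : L ^+ 2 * (Cs' / (bb * V ^+ 18)) = Cs' * bb / V ^+ 8.
    by rewrite /L; field; rewrite !gt_eqF.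
  have -> : 2 * L' * (Cg * V ^+ 6) = 2 * Cg * (bb / V ^+ 6).
    by rewrite /L'; field; rewrite !gt_eqF.
  rewrite /S [(2 * Cg + Cs') * _]mulrDl lerD2l -mulrA.
  apply: ler_wpM2l => //; apply: ler_wpM2l; first exact: ltW.
  by rewrite lef_pV2 ?posrE// wle.
(* Second moment for [k = 0], slow recurrence for short gaps, mixing for the others. All terms are
   non-negative, so they are added rather than distinguished by cases. *)
pose r k : R := (if k == 0%N then C2 * L else 0) +
  (if (0 < k)%N && (k%:R <= D * j%:R) then S else 0) + Cm / bb ^+ 4.
have Cb0 : 0 <= Cm / bb ^+ 4 by rewrite divr_ge0// exprn_ge0// ltW.
have CL0 : 0 <= C2 * L by rewrite mulr_ge0// ltW.
have r0 k : 0 <= r k.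
  by rewrite /r addr_ge0// addr_ge0//; case: ifP.
have hr k : E (fun x => g L x * g L (iter k T x)) - E (g L) ^+ 2 <= r k.
  rewrite /r; case: k => [|k] /=.
    rewrite addr0; apply: (@le_trans _ _ (C2 * L)); last by rewrite lerDl.
    by apply: le_trans (C2P L L_ge1); rewrite lerBlDr lerDl sqr_ge0.
  rewrite add0r; case: ifPn => [kD|].
    apply: (@le_trans _ _ S); last by rewrite lerDl.
    by apply: le_trans (shortP k.+1 isT kD); rewrite lerBlDr lerDl sqr_ge0.
  rewrite -ltNge add0r => kD.
  by apply: le_trans (mix1 k.+1 L_ge1) _; exact: long_gap.
apply: le_trans (Ex_second_moment mT mu_inv (bg L_ge1) _ r0 (fun k _ => hr k)) _.
  by move=> x; exact: g_ge0.
have sumr : \sum_(k < N) r k <= C2 * L + D * j%:R * S + B * Cm.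
  rewrite /r !big_split /= lerD//; first rewrite lerD//.
  - rewrite -(big_mkord xpredT (fun k => if k == 0%N then C2 * L else 0)).
    case: (N) => [|n]; first by rewrite big_geq.
    by rewrite big_nat_recl//= big1 ?addr0.
  - by apply: sum_window_le => //; rewrite mulr_ge0// ltW.
  - rewrite sumr_const card_ord -[leLHS]mulr_natl.
    apply: (@le_trans _ _ (B * bb * (Cm / bb ^+ 4))); first exact: ler_wpM2r.
    rewrite (_ : B * bb * (Cm / bb ^+ 4) = B * Cm / bb ^+ 3); last by field; rewrite gt_eqF.
    by rewrite ler_pdivrMr ?exprn_gt0// ler_peMr ?mulr_ge0// exprn_ege1.
have sumr' : \sum_(k < N) r k <= (C2 + D * (2 * Cg + Cs') + B * Cm) * (bb * V ^+ 5).
  apply: (le_trans sumr); rewrite 2!mulrDl -/L lerD//; first rewrite lerD//.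
    rewrite /S -w6 (_ : D * V ^+ 6 * _ = D * (2 * Cg + Cs') * bb); last first.
      by field; rewrite gt_eqF.
    by apply: ler_wpM2l => //; exact: mulr_ge0.
  by rewrite ler_peMr// mulr_ge0.
have sum0 : 0 <= \sum_(k < N) r k by apply: sumr_ge0.
apply: (@le_trans _ _ (2 * (B * bb) * ((C2 + D * (2 * Cg + Cs') + B * Cm) * (bb * V ^+ 5)))).
  by apply: ler_pM => //; rewrite ?mulr_ge0// ler_pM2l.
by rewrite /C le_eqVlt; apply/orP; left; apply/eqP; ring.
Qed.

(** Long gaps dominate: a joint visit has measure O(L^(-2)) with L = b w^4, and the O(b^2) pairs
    together give w^(-8). Short gaps contribute only w^(-28). *)
Lemma pair_block : exists C j0, 0 <= C /\ forall j N, (j0 <= j)%N -> N%:R <= B * b j ->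
  E (pair_count T (A (b j * w j ^+ 4)) N) <= C / w j ^+ 7.
Proof.
have [C2 C20 C2P] := second_moment_le mA mg g_ge0 g_leL g_out tail.
have D'0 : 0 < D / ln a by rewrite divr_gt0.
have [Cs [L0 [Cs0 CsP]]] := slow D'0.
have [j0 j0P] := block_facts.
pose Cs' := Cs / ln a ^+ 5.
have Cs'0 : 0 <= Cs' by rewrite divr_ge0// exprn_ge0// ltW.
pose C3 := CA ^+ 2 * C2 ^+ 2; have C30 : 0 <= C3 by rewrite mulr_ge0 ?sqr_ge0.
pose C4 := CA ^+ 2 * Cm; have C40 : 0 <= C4 by rewrite mulr_ge0 ?sqr_ge0.
have D0' : 0 <= D by exact: ltW.
pose C := 2 * B * (D * Cs' + B * (C3 + C4)).
have C0 : 0 <= C.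
  apply: mulr_ge0; first exact: mulr_ge0.
  by apply: addr_ge0; apply: mulr_ge0 => //; exact: addr_ge0.
exists C, (maxn j0 (Num.truncn L0).+1); split => // j N.
rewrite !geq_max => /andP[jj jL0] NB.
have [w1 w6 w24] := j0P j jj.
have jL0' : L0 <= j%:R by rewrite ltW// (lt_le_trans (truncnS_gt _))// ler_nat.
move: w1 w6 w24 NB; set V := w j; set bb := b j => w1 w6 w24 NB.
have V0 : 0 < V by exact: lt_le_trans w1.
have wle k k' : (k <= k')%N -> V ^+ k <= V ^+ k' by move=> kk; exact: ler_weXn2l.
have wk0 k : 0 < V ^+ k by exact: exprn_gt0.
have wk1 k : 1 <= V ^+ k by exact: exprn_ege1.
have wb k : (k <= 24)%N -> V ^+ k <= bb by move=> /wle /le_trans; apply.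
have bb1 : 1 <= bb by exact: le_trans (wb 0%N isT).
have bb0 : 0 < bb by exact: lt_le_trans bb1.
have lnb : ln bb = j%:R * ln a by rewrite /bb /b lnXn// mulr_natl.
pose L := bb * V ^+ 4.
have bL : bb <= L by rewrite ler_peMr// ltW.
have L_ge1 : 1 <= L by exact: le_trans bL.
have L0p : 0 < L by exact: lt_le_trans L_ge1.
have LL2 : L <= bb ^+ 2 by rewrite expr2 ler_pM2l// wb.
have lnL : j%:R * ln a <= ln L by rewrite -lnb ler_ln ?posrE.
have L0L : L0 <= L.
  by apply: (le_trans jL0'); rewrite -w6; apply: le_trans bL; exact: wb.
have mAL := mA L_ge1.
have mAA k : measurable (A L `&` iter k T @^-1` A L).
  by apply: measurableI => //; exact: measurable_preimage_iter.
pose S := Cs' / (bb * V ^+ 34).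
have S0 : 0 <= S by rewrite divr_ge0// mulr_ge0// ltW.
have shortP k : (0 < k)%N -> k%:R <= D * j%:R -> m (A L `&` iter k T @^-1` A L) <= S.
  move=> k0 kD; have kD' : k%:R <= D / ln a * ln L.
    apply: (le_trans kD); have -> : D * j%:R = D / ln a * (j%:R * ln a).
      by field; rewrite gt_eqF.
    by apply: ler_wpM2l => //; rewrite divr_ge0// ltW.
  apply: le_trans (CsP L k L_ge1 L0L k0 kD') _.
  have lnL5 : (V ^+ 6 * ln a) ^+ 5 <= ln L ^+ 5.
    apply: lerXn2r; rewrite ?nnegrE; last by rewrite w6.
      by rewrite mulr_ge0// ltW.
    exact: ln_ge0.
  have pw : 0 < (V ^+ 6 * ln a) ^+ 5 by rewrite exprn_gt0// mulr_gt0.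
  have lnp : 0 < ln L ^+ 5 by exact: lt_le_trans lnL5.
  have -> : S = Cs / (L * (V ^+ 6 * ln a) ^+ 5).
    by rewrite /S /Cs' /L; field; rewrite !gt_eqF.
  apply: ler_wpM2l => //; rewrite lef_pV2 ?posrE; first by rewrite ler_pM2l.
    exact: mulr_gt0.
  exact: mulr_gt0.
pose l := C3 / (bb ^+ 2 * V ^+ 8) + C4 / bb ^+ 4.
have bk0 k : 0 < bb ^+ k by exact: exprn_gt0.
have l0 : 0 <= l by rewrite addr_ge0// divr_ge0 ?mulr_ge0// ltW.
have bgL := bg L_ge1.
have bgL2 : bmeas (fun x => g L x ^+ 2).
  by under eq_fun do rewrite expr2; exact: bmeasM.
(* L^4 times the indicator of a joint visit is dominated by the product of the two squared
   observables. Mixing factorises its mean into the square of a second moment, which is O(L^2). *)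
have longP k : D * j%:R < k%:R -> m (A L `&` iter k T @^-1` A L) <= l.
  move=> kD; have h : L ^+ 4 * m (A L `&` iter k T @^-1` A L) <=
      CA ^+ 2 * (C2 ^+ 2 * L ^+ 2 + Cm / bb ^+ 4).
    have -> : L ^+ 4 * m (A L `&` iter k T @^-1` A L) =
        E (fun x => L ^+ 4 * \1_(A L `&` iter k T @^-1` A L) x).
      by rewrite ExZ ?Ex_indic//; exact: bmeas_indic.
    apply: (@le_trans _ _ (E (fun x => CA ^+ 2 * (g L x ^+ 2 * g L (iter k T x) ^+ 2)))).
      have bgk := bmeas_iter mT k bgL2.
      apply: Ex_le; [exact/bmeasZ/bmeas_indic | exact/bmeasZ/bmeasM|move=> x].
      have [[Ax Ay]|nA] := pselect ((A L `&` iter k T @^-1` A L) x); last first.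
        by rewrite indicE memNset// mulr0 mulr_ge0 ?sqr_ge0// mulr_ge0 ?sqr_ge0.
      rewrite indicE mem_set// mulr1 (_ : L ^+ 4 = L ^+ 2 * L ^+ 2); last by rewrite -exprD.
      rewrite (_ : CA ^+ 2 * _ = (CA * g L x ^+ 2) * (CA * g L (iter k T x) ^+ 2)); last by ring.
      by apply: ler_pM; rewrite ?sqr_ge0//; exact: A_maj.
    rewrite ExZ; last by apply: bmeasM => //; exact: (bmeas_iter mT k bgL2).
    apply: ler_wpM2l; first exact: sqr_ge0.
    have := mix2 k L_ge1; rewrite lerBlDr => /le_trans; apply.
    rewrite addrC; apply: lerD; last exact: long_gap.
    have := C2P L L_ge1; have -> : (fun x => g L x * g L x) = (fun x => g L x ^+ 2).
      by apply/funext => x; rewrite expr2.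
    move=> h; rewrite -exprMn; apply: lerXn2r => //; rewrite nnegrE.
      by apply: Ex_ge0 => x; exact: sqr_ge0.
    by apply: mulr_ge0 => //; exact: ltW.
  have L4 : 0 < L ^+ 4 by exact: exprn_gt0.
  suff : L ^+ 4 * m (A L `&` iter k T @^-1` A L) <= L ^+ 4 * l by rewrite ler_pM2l.
  apply: (le_trans h); rewrite mulrDr [leRHS]mulrDr; apply: lerD.
    rewrite le_eqVlt; apply/orP; left; apply/eqP; rewrite /C3 /L.
    by field; rewrite !gt_eqF.
  rewrite mulrA -/C4; apply: ler_peMl; first by rewrite divr_ge0// ltW.
  exact: exprn_ege1.
pose r k : R := (if (0 < k)%N && (k%:R <= D * j%:R) then S else 0) + l.
have r0 k : 0 <= r k by rewrite /r addr_ge0//; case: ifP.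
have hr k : (0 < k < N)%N -> m (A L `&` iter k T @^-1` A L) <= r k.
  move=> /andP[k0 _]; rewrite /r k0 /=; case: ifPn => [kD|].
    by apply: le_trans (shortP k k0 kD) _; rewrite lerDl.
  by rewrite -ltNge add0r; exact: longP.
apply: le_trans (Ex_pair_count mT mu_inv mAL r0 hr) _.
have sumr : \sum_(k < N) r k <= D * j%:R * S + B * bb * l.
  rewrite /r big_split /= lerD//.
    by apply: sum_window_le => //; rewrite mulr_ge0.
  by rewrite sumr_const card_ord -[leLHS]mulr_natl; exact: ler_wpM2r.
have sum0 : 0 <= \sum_(k < N) r k by apply: sumr_ge0.
apply: (@le_trans _ _ (2 * (B * bb) * (D * j%:R * S + B * bb * l))).
  by apply: ler_pM => //; rewrite ?mulr_ge0// ler_pM2l.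
have -> : 2 * (B * bb) * (D * j%:R * S + B * bb * l) =
    2 * B * (D * Cs' / V ^+ 28 + B * (C3 / V ^+ 8 + C4 / bb ^+ 2)).
  by rewrite -w6 /S /l; field; rewrite !gt_eqF.
rewrite /C -[leRHS](mulrA (2 * B)); apply: ler_wpM2l; first exact: mulr_ge0.
rewrite mulrDl; apply: lerD.
  apply: ler_wpM2l; first exact: mulr_ge0.
  by rewrite lef_pV2 ?posrE// wle.
rewrite -[leRHS](mulrA B); apply: ler_wpM2l => //; rewrite mulrDl; apply: lerD; apply: ler_wpM2l => //.
  by rewrite lef_pV2 ?posrE// wle.
rewrite lef_pV2 ?posrE//; apply: (@le_trans _ _ bb); first exact: wb.
by rewrite expr2 ler_peMr// ltW.
Qed.

(** An integral test by telescoping: j^(-7/6) is compared with the increments of -6 j^(-1/6), via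
    y^6 - x^6 = 1 for consecutive sixth roots x < y. *)
Lemma sum_sixth_root_inv7 n : \sum_(0 <= j < n) (w j.+1 ^+ 7)^-1 <= 7.
Proof.
have w_ge1 j : 1 <= w j.+1.
  rewrite -(powRr0 (j.+1%:R : R)); apply: ler_powR; last by rewrite invr_ge0.
  by rewrite ler1n.
have wp j : 0 < w j.+1 by exact: lt_le_trans (w_ge1 j).
have w6 j : w j ^+ 6 = j%:R by exact: powR_sixth_exp6.
have step j : (w j.+2 ^+ 7)^-1 <= 6 * ((w j.+1)^-1 - (w j.+2)^-1).
  set x := w j.+1; set y := w j.+2.
  have x0 : 0 < x by exact: wp.
  have y0 : 0 < y by exact: wp.
  have xy : x <= y by rewrite /x /y /w; apply: ge0_ler_powR; rewrite ?nnegrE ?invr_ge0 ?ler_nat.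
  have y6 : y ^+ 6 = x ^+ 6 + 1 by rewrite /x /y !w6 -natr1.
  have d6 : 1 <= 6 * (y - x) * y ^+ 5.
    apply: (@le_trans _ _ (y ^+ 6 - x ^+ 6)); first by rewrite y6 addrAC subrr add0r.
    rewrite subrXX -[leRHS]mulrA [leRHS]mulrCA; apply: ler_wpM2l; first by rewrite subr_ge0.
    apply: (@le_trans _ _ (\sum_(i < 6) y ^+ 5)); last first.
      by rewrite sumr_const card_ord -[leLHS]mulr_natl.
    apply: ler_sum => i _; rewrite -[leRHS](_ : y ^+ (6.-1 - i) * y ^+ i = _); last first.
      by rewrite -exprD subnK// -ltnS.
    apply: ler_wpM2l; first by rewrite exprn_ge0// ltW.
    by apply: lerXn2r => //; rewrite nnegrE ltW.
  have -> : 6 * (x^-1 - y^-1) = 6 * (y - x) / (x * y) by field; rewrite !gt_eqF.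
  rewrite -div1r ler_pdivrMr ?exprn_gt0// mulrAC ler_pdivlMr ?mulr_gt0// mul1r.
  apply: (@le_trans _ _ (y * y)); first by rewrite ler_wpM2r// ltW.
  have -> : 6 * (y - x) * y ^+ 7 = (6 * (y - x) * y ^+ 5) * (y * y) by ring.
  by rewrite ler_peMl// mulr_ge0// ltW.
have tele k : \sum_(0 <= j < k) (w j.+2 ^+ 7)^-1 <= 6 * ((w 1)^-1 - (w k.+1)^-1).
  elim: k => [|k IH]; first by rewrite big_geq// subrr mulr0.
  rewrite big_nat_recr//=; apply: le_trans (lerD IH (step k)) _.
  by rewrite -mulrDr addrA subrK.
have w11 : w 1 = 1 by rewrite /w powR1.
case: n => [|n]; first by rewrite big_geq.
rewrite big_nat_recl// w11 expr1n invr1 (_ : 7 = 1 + 6); last by ring.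
rewrite lerD2l; apply: le_trans (tele n) _; rewrite w11 invr1.
by rewrite ler_piMr// lerBlDr lerDl invr_ge0 ltW.
Qed.

End BlockEstimates.
Lemma shift_index (i0 J j : nat) : ((i0 + J).+1 <= j)%N ->
  exists2 i, (i0 <= i)%N & j = (i + J).+1.
Proof. by move=> h; exists (j - J.+1)%N; lia. Qed.

Section BlockAlgebra.
Context {R : realFieldType}.

Lemma mean_block_algebra (c0 e X w l m : R) : 0 <= c0 -> 0 < e -> 0 <= l -> l <= w ->
  5 * w * (1 + 2 * c0 / e) <= X ->
  `|m - c0 * (X + 5 * l)| <= e / 4 * (X + 5 * l) -> `|m - c0 * X| <= e * X.
Proof.
move=> c00 e0 l0 lw YX h; have w0 : 0 <= w by exact: le_trans lw.
have q0 : 0 <= 2 * c0 / e by rewrite divr_ge0 ?mulr_ge0// ltW.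
have Y1 : 5 * l <= X.
  apply: le_trans YX; apply: (@le_trans _ _ (5 * w)); first by rewrite ler_pM2l.
  by rewrite ler_peMr ?mulr_ge0// lerDl.
have Y2 : c0 * (5 * l) <= e / 2 * X.
  have h1 : 5 * w * (2 * c0 / e) <= X.
    by apply: le_trans YX; apply: ler_wpM2l; rewrite ?mulr_ge0// lerDr.
  apply: (@le_trans _ _ (c0 * (5 * w))).
    by apply: ler_wpM2l => //; rewrite ler_pM2l.
  have -> : c0 * (5 * w) = e / 2 * (5 * w * (2 * c0 / e)) by field; rewrite gt_eqF.
  by apply: ler_wpM2l => //; rewrite divr_ge0// ltW.
have -> : m - c0 * X = (m - c0 * (X + 5 * l)) + c0 * (5 * l) by ring.
apply: le_trans (ler_normD _ _) _; have -> : e * X = e / 4 * (X + X) + e / 2 * X by field.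
apply: lerD; last by rewrite ger0_norm// mulr_ge0// mulr_ge0.
apply: le_trans h _; apply: ler_wpM2l; last by rewrite lerD2l.
by rewrite divr_ge0// ltW.
Qed.

Lemma block_sum_algebra (S N m c0 la e B b X : R) :
  0 < e -> 0 <= B -> 0 <= N -> N <= B * b -> 0 < b -> 0 <= X * la ->
  `|S - N * m| <= e / 2 * la * (b * X) ->
  `|m - c0 * (X * la)| <= e / (2 * (B + 1)) * (X * la) ->
  `|S - N * (c0 * (X * la))| <= e * (b * (X * la)).
Proof.
move=> e0 B0 N0 NB b0 Xl0 h1 h2.
have -> : S - N * (c0 * (X * la)) = (S - N * m) + N * (m - c0 * (X * la)) by ring.
apply: le_trans (ler_normD _ _) _.
have -> : e * (b * (X * la)) = e / 2 * la * (b * X) + e / 2 * (b * (X * la)) by field.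
apply: lerD => //; rewrite normrM (ger0_norm N0).
apply: (@le_trans _ _ (B * b * (e / (2 * (B + 1)) * (X * la)))).
  by apply: ler_pM.
have B1 : 0 < B + 1 by rewrite ltr_wpDl.
have -> : B * b * (e / (2 * (B + 1)) * (X * la)) = (e / 2 * (b * (X * la))) * (B / (B + 1)).
  by field; rewrite gt_eqF.
rewrite ler_piMr//; last by rewrite ler_pdivrMr// mul1r lerDl.
apply: mulr_ge0; first by rewrite divr_ge0// ltW.
by apply: mulr_ge0 => //; exact: ltW.
Qed.

End BlockAlgebra.

Section AlmostSureBlocks.
Context d (W : measurableType d) {R : realType} (mu : probability W R).
Variables (T : W -> W) (mT : measurable_fun setT T).
Hypothesis mu_inv : forall A, measurable A -> mu (T @^-1` A) = mu A.
Variables (g : R -> W -> R) (A : R -> set W) (c0 : R).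
Local Notation E := (Ex mu).
Local Notation m A := (fine (mu A)).
Hypothesis mA : forall y, 1 <= y -> measurable (A y).
Hypothesis A_anti : forall y z, 1 <= y -> y <= z -> A z `<=` A y.
Hypothesis mg : forall L, 1 <= L -> measurable_fun setT (g L).
Hypothesis g_ge0 : forall L x, 1 <= L -> 0 <= g L x.
Hypothesis g_leL : forall L x, 1 <= L -> g L x <= L.
Hypothesis g_out : forall L y x, 1 <= L -> 1 <= y -> ~ A y x -> g L x <= y.
Hypothesis g_in : forall e, 0 < e -> exists2 h, 0 < h &
  forall L y x, 1 <= L -> 1 <= y -> y <= h * L -> A y x -> (1 - e) * y <= g L x.
Hypothesis tail : y * m (A y) @[y --> +oo] --> c0.
Variables (Cm gam : R) (mm : nat).
Hypothesis Cm0 : 0 <= Cm.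
Hypothesis gam0 : 0 < gam.
Hypothesis mix1 : forall L n, 1 <= L ->
  E (fun x => g L x * g L (iter n T x)) - E (g L) ^+ 2 <= Cm * L ^+ mm * expR (- gam * n%:R).
Hypothesis mix2 : forall L n, 1 <= L ->
  E (fun x => g L x ^+ 2 * g L (iter n T x) ^+ 2) - E (fun x => g L x ^+ 2) ^+ 2
    <= Cm * L ^+ mm * expR (- gam * n%:R).
Variable (CA : R).
Hypothesis CA0 : 0 <= CA.
Hypothesis A_maj : forall L x, 1 <= L -> A L x -> L ^+ 2 <= CA * g L x ^+ 2.
Hypothesis slow : forall D, 0 < D -> exists C L0, 0 <= C /\
  forall L n, 1 <= L -> L0 <= L -> (0 < n)%N -> n%:R <= D * ln L ->
    m (A L `&` iter n T @^-1` A L) <= C / (L * ln L ^+ 5).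

Variables (a B : R).
Hypothesis a1 : 1 < a.
Hypothesis B0 : 0 <= B.

(* For [N] of order [a^j], both levels are o(N ln N), and their ratio [blk_w j]
   tends to infinity: truncating at [blk_L j] hardly affects the values below
   [blk_Lam j].  The powers of [j] make variances and pair counts summable. *)
Definition blk_w (j : nat) : R := j%:R `^ 6^-1.
Definition blk_L (j : nat) : R := a ^+ j * blk_w j ^+ 5.
Definition blk_Lam (j : nat) : R := a ^+ j * blk_w j ^+ 4.

Lemma blk_w_ge1 j : 1 <= blk_w j.+1.
Proof.
rewrite -(powRr0 (j.+1%:R : R)); apply: ler_powR; last by rewrite invr_ge0.
by rewrite ler1n.
Qed.

Lemma blk_w6 j : blk_w j ^+ 6 = j%:R.
Proof. exact: powR_sixth_exp6. Qed.

Lemma blk_w_large (M : R) : exists j0, forall j, (j0 <= j)%N -> M <= blk_w j.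
Proof.
exists (Num.truncn (Num.max 1 M ^+ 6)).+1 => j jj.
have M0 : 0 <= Num.max 1 M by rewrite le_max ler01.
apply: (@le_trans _ _ (Num.max 1 M)); first by rewrite le_max lexx orbT.
rewrite -(@ler_pXn2r _ 6)// ?nnegrE ?powR_ge0// blk_w6 ltW//.
by apply: lt_le_trans (truncnS_gt _) _; rewrite ler_nat.
Qed.

Let la0 : 0 < ln a. Proof. exact: ln_gt0. Qed.
Let a0 : 0 < a. Proof. exact: lt_trans a1. Qed.
Let b_ge1 j : 1 <= a ^+ j. Proof. by apply: exprn_ege1; exact: ltW. Qed.
Let b_gt0 j : 0 < a ^+ j. Proof. exact: exprn_gt0. Qed.
Let bg := @bmeas_g _ W R g mg g_ge0 g_leL.

Lemma blk_L_ge1 j : 1 <= blk_L j.+1.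
Proof.
apply: mulr_ege1; first exact: b_ge1.
by apply: exprn_ege1; exact: blk_w_ge1.
Qed.

Lemma blk_Lam_ge1 j : 1 <= blk_Lam j.+1.
Proof.
apply: mulr_ege1; first exact: b_ge1.
by apply: exprn_ege1; exact: blk_w_ge1.
Qed.

(** The logarithm of [blk_L j] is [j * ln a] plus 5 ln w, and ln w <= w is negligible against j =
    w^6. *)
Lemma mean_block (e : R) : 0 < e -> exists j0, forall j, (j0 <= j)%N ->
  `|E (g (blk_L j)) - c0 * (j%:R * ln a)| <= e * (j%:R * ln a).
Proof.
move=> e0; have c00 := tail_limit_ge0 tail.
have e40 : 0 < e / 4 by rewrite divr_gt0.
have [L0 L01 L0P] := truncated_mean_log mA A_anti mg g_ge0 g_leL g_out g_in tail e40.
pose M := 1 + 5 * (1 + 2 * c0 / e) / ln a.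
have [j1 j1P] := blk_w_large M.
exists (maxn (maxn 1 j1) (Num.truncn (L0 / ln a)).+1) => j.
rewrite !geq_max => /andP[/andP[jgt0 jj1] jL0].
case: j jgt0 jj1 jL0 => // j _ jj1 jL0.
have wM := j1P _ jj1; have w1 := blk_w_ge1 j; set w := blk_w j.+1 in wM w1.
have w0 : 0 < w by exact: lt_le_trans w1.
set X := j.+1%:R * ln a; have X0 : 0 < X by rewrite mulr_gt0// ltr0n.
have bL : a ^+ j.+1 <= blk_L j.+1.
  by rewrite /blk_L ler_peMr ?(ltW (b_gt0 _))// exprn_ege1.
have L0L : L0 <= blk_L j.+1.
  apply: le_trans bL; have -> : a ^+ j.+1 = expR X.
    by rewrite /X mulrC expRM_natr lnK.
  apply: le_trans (expR_ge1Dx _); rewrite -[L0]add0r; apply: lerD => //.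
  rewrite -ler_pdivrMr// ltW//; apply: lt_le_trans (truncnS_gt _) _.
  by rewrite ler_nat.
have lnL : ln (blk_L j.+1) = X + 5 * ln w.
  by rewrite lnM ?posrE ?exprn_gt0// !lnXn// /X !mulr_natl.
have lnw0 : 0 <= ln w by exact: ln_ge0.
have lnw1 : ln w <= w by rewrite ltW// ln_sublinear.
have YX : 5 * w * (1 + 2 * c0 / e) <= X.
  rewrite /X -(blk_w6 j.+1) -/w; apply: (@le_trans _ _ (w * M * ln a)).
    have -> : w * M * ln a = w * ln a + 5 * w * (1 + 2 * c0 / e).
      by rewrite /M; field; rewrite !gt_eqF.
    by rewrite lerDr mulr_ge0// ltW.
  rewrite ler_pM2r//; apply: (@le_trans _ _ (w * w)); first by rewrite ler_pM2l.
  by rewrite -expr2 ler_weXn2l.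
have h := L0P _ L0L; rewrite lnL in h.
exact: (mean_block_algebra c00 e0 lnw0 lnw1 YX h).
Qed.

(** One series of normalised squared deviations is summed, so a single null set serves all [e]. *)
Lemma ae_block_sums (Nf : nat -> nat) : (forall j, (Nf j)%:R <= B * a ^+ j) ->
  {ae mu, forall x, forall e, 0 < e -> exists j0, forall j, (j0 <= j)%N ->
    `|\sum_(n < Nf j) g (blk_L j) (iter n T x) - (Nf j)%:R * (c0 * (j%:R * ln a))|
      <= e * (a ^+ j * (j%:R * ln a))}.
Proof.
move=> NfB.
have [C [J [C0 CP]]] := variance_block mT mu_inv mA A_anti mg g_ge0 g_leL g_out g_in tail
  Cm0 gam0 mix1 slow a1 B0.
(* [variance_block] holds from [J] on; the successor avoids index 0, where [blk_w] vanishes. *)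
pose k j := (j + J).+1.
have Jk j : (J <= k j)%N by rewrite /k leqW// leq_addl.
pose X j x := ((\sum_(n < Nf (k j)) g (blk_L (k j)) (iter n T x) -
    (Nf (k j))%:R * E (g (blk_L (k j)))) / (a ^+ k j * blk_w (k j) ^+ 6)) ^+ 2.
have bS j : bmeas (fun x => (\sum_(n < Nf (k j)) g (blk_L (k j)) (iter n T x) -
    (Nf (k j))%:R * E (g (blk_L (k j)))) ^+ 2).
  under eq_fun do rewrite expr2.
  have b1 : bmeas (fun x => \sum_(n < Nf (k j)) g (blk_L (k j)) (iter n T x) -
    (Nf (k j))%:R * E (g (blk_L (k j)))).
    apply: bmeasD; last exact: bmeas_cst.
    by apply: bmeas_sum => n; apply: bmeas_iter => //; apply: bg; exact: blk_L_ge1.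
  exact: bmeasM.
have XE j : X j = fun x => ((a ^+ k j * blk_w (k j) ^+ 6) ^+ 2)^-1 *
   (\sum_(n < Nf (k j)) g (blk_L (k j)) (iter n T x) -
    (Nf (k j))%:R * E (g (blk_L (k j)))) ^+ 2.
  by apply/funext => x; rewrite /X exprMn exprVn mulrC.
have wp j : 0 < blk_w (k j) by exact: lt_le_trans (blk_w_ge1 _).
have := @ae_cvg0_of_summable _ W R mu X (fun j => C * (blk_w (k j) ^+ 7)^-1) (C * 7).
have h1 j : bmeas (X j) by rewrite XE; exact: bmeasZ.
have h2 j x : 0 <= X j x by exact: sqr_ge0.
have h3 j : E (X j) <= C * (blk_w (k j) ^+ 7)^-1.
  rewrite XE ExZ//; have := CP (k j) (Nf (k j)) (Jk j) (NfB _).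
  rewrite -/(blk_w (k j)) -/(blk_L (k j)) => h.
  rewrite ler_pdivrMl ?exprn_gt0 ?mulr_gt0 ?exprn_gt0//; apply: le_trans h _.
  rewrite le_eqVlt; apply/orP; left; apply/eqP; field; exact: lt0r_neq0.
have h4 n : \sum_(0 <= j < n) C * (blk_w (k j) ^+ 7)^-1 <= C * 7.
  rewrite -mulr_sumr; apply: ler_wpM2l => //.
  apply: le_trans (sum_sixth_root_inv7 (J + n)).
  rewrite [leRHS](@big_cat_nat _ _ _ J)//= ?leq_addr// -[leLHS]add0r; apply: lerD.
    by apply: sumr_ge0 => j _; rewrite invr_ge0 exprn_ge0// powR_ge0.
  rewrite -{1}[J]add0n big_addn addKn; apply: ler_sum => j _.
  by rewrite /k.
move=> /(_ h1 h2 h3 h4); apply: filterS => x Xcvg e e0.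
have B1 : 0 < B + 1 by rewrite ltr_wpDl.
have e1 : 0 < e / 2 * ln a by rewrite mulr_gt0// divr_gt0.
have e2 : 0 < e / (2 * (B + 1)) by rewrite divr_gt0// mulr_gt0.
have /cvgrPdist_le /(_ _ (exprn_gt0 2 e1)) [j1 _ j1P] := Xcvg.
have [j2 j2P] := mean_block e2.
exists (maxn (j1 + J).+1 j2) => j; rewrite geq_max => /andP[j1j j2j].
have [i ij ji] := shift_index j1j.
have := j1P i ij; rewrite sub0r normrN ger0_norm// /X => h.
have := j2P j j2j; rewrite ji -/(k i); set b := a ^+ k i; set w := blk_w (k i).
have b0 : 0 < b by exact: b_gt0.
have w0 : 0 < w by exact: wp.
rewrite -(blk_w6 (k i)) -/w => hE; set N := (Nf (k i))%:R.
have NB : N <= B * b by exact: NfB.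
have fluct : `|\sum_(n < Nf (k i)) g (blk_L (k i)) (iter n T x) - N * E (g (blk_L (k i)))|
    <= e / 2 * ln a * (b * w ^+ 6).
  have bw0 : 0 < b * w ^+ 6 by rewrite mulr_gt0// exprn_gt0.
  rewrite -ler_pdivrMr// -[X in _ / X]ger0_norm ?(ltW bw0)// -normf_div.
  by rewrite -(@ler_pXn2r _ 2)// ?nnegrE ?(ltW e1)// real_normK ?num_real.
have X0 : 0 <= w ^+ 6 * ln a by rewrite mulr_ge0 ?exprn_ge0 ?(ltW w0)// ltW.
exact: (block_sum_algebra e0 B0 (ler0n _ _) NB b0 X0 fluct hE).
Qed.

(** Pair counts tend to 0 almost surely, so they are eventually below 1, which leaves at most one
    visit. *)
Lemma ae_block_pairs (Nf : nat -> nat) : (forall j, (Nf j)%:R <= B * a ^+ j) ->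
  {ae mu, forall x, exists j0, forall j, (j0 <= j)%N ->
    exists n0 : nat, forall n, (n < Nf j)%N -> n <> n0 -> ~ A (blk_Lam j) (iter n T x)}.
Proof.
move=> NfB.
have [C [J [C0 CP]]] := pair_block mT mu_inv mA mg g_ge0 g_leL g_out tail
  Cm0 gam0 mix2 CA0 A_maj slow a1 B0.
pose k j := (j + J).+1.
have Jk j : (J <= k j)%N by rewrite /k leqW// leq_addl.
pose X j x := pair_count T (A (blk_Lam (k j))) (Nf (k j)) x : R.
have := @ae_cvg0_of_summable _ W R mu X (fun j => C * (blk_w (k j) ^+ 7)^-1) (C * 7).
have h1 j : bmeas (X j) by apply: bmeas_pair_count => //; apply: mA; exact: blk_Lam_ge1.
have h2 j x : 0 <= X j x.
  by apply: sumr_ge0 => i _; apply: sumr_ge0 => l _; rewrite mulr_ge0.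
have h3 j : E (X j) <= C * (blk_w (k j) ^+ 7)^-1 by exact: CP.
have h4 n : \sum_(0 <= j < n) C * (blk_w (k j) ^+ 7)^-1 <= C * 7.
  rewrite -mulr_sumr; apply: ler_wpM2l => //.
  apply: le_trans (sum_sixth_root_inv7 (J + n)).
  rewrite [leRHS](@big_cat_nat _ _ _ J)//= ?leq_addr// -[leLHS]add0r; apply: lerD.
    by apply: sumr_ge0 => j _; rewrite invr_ge0 exprn_ge0// powR_ge0.
  rewrite -{1}[J]add0n big_addn addKn; apply: ler_sum => j _.
  by rewrite /k.
move=> /(_ h1 h2 h3 h4); apply: filterS => x Xcvg.
have /cvgrPdist_lt /(_ _ ltr01) [j1 _ j1P] := Xcvg.
exists (j1 + J).+1 => j jj.
have [i ij ji] := shift_index jj.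
have := j1P i ij; rewrite sub0r normrN ger0_norm// ji -/(k i).
exact: pair_count_lt1.
Qed.

End AlmostSureBlocks.

(** * Trimmed sums *)
Section TrimmedSums.
Context {R : realType} {M : Type}.
Variables (T : M -> M) (f : M -> R) (x : M).
Hypothesis f_ge0 : forall n, 0 <= f (iter n T x).

Let vals N := [seq f (iter n T x) | n <- iota 0 N].
Let srt N := sort (fun a b : R => b <= a) (vals N).

Let sum_vals N : \sum_(v <- vals N) v = \sum_(n < N) f (iter n T x).
Proof. by rewrite /vals big_map -{1}[N]subn0 -/(index_iota 0 N) big_mkord. Qed.

Let geT : total (fun a b : R => b <= a). Proof. by move=> a b; exact: le_total. Qed.

Let srt_ge0 N v : v \in srt N -> 0 <= v.
Proof. by rewrite mem_sort => /mapP[n _ ->]. Qed.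

(** The largest value, which trimming removes, is at least the value at any chosen time [n0]. *)
Lemma trimmed_sum_upper K N n0 : (0 < K)%N ->
  trimmed_sum T f K N x <= \sum_(n < N | n != n0 :> nat) f (iter n T x).
Proof.
move=> K0; rewrite /trimmed_sum -/(vals N) -/(srt N) sum_vals.
have take_ge0 : 0 <= \sum_(v <- take K (srt N)) v.
  by rewrite big_seq; apply: sumr_ge0 => v /mem_take; exact: srt_ge0.
have [n0N|Nn0] := ltnP n0 N; last first.
  rewrite [leRHS](_ : _ = \sum_(n < N) f (iter n T x)); first by rewrite gerBl.
  by apply: eq_bigl => n; rewrite ltn_eqF// (leq_trans _ Nn0).
rewrite (bigD1 (Ordinal n0N))//= addrC -addrA gerDl subr_le0.
have : f (iter n0 T x) \in srt N.
  by rewrite mem_sort; apply/mapP; exists n0 => //; rewrite mem_iota.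
have := sort_sorted geT (vals N); rewrite -/(srt N).
have := @srt_ge0 N; case: (srt N) take_ge0 => // v s + s0 /= vs.
move: K K0 => [|K]// _ _.
rewrite in_cons /= big_cons.
have le_head : {in s, forall u, u <= v}.
  by apply/allP; apply: order_path_min vs => a b c /= ab bc; exact: le_trans bc ab.
have rest : 0 <= \sum_(j <- take K s) j.
  by rewrite big_seq; apply: sumr_ge0 => u /mem_take us; apply: s0; rewrite in_cons us orbT.
move=> /predU1P[->|/le_head uv]; first by rewrite lerDl.
by apply: (le_trans uv); rewrite lerDl.
Qed.

(** Each removed value is at most [B] plus its excess over [B], and only time [n0] has an excess.
    Working with excesses avoids following positions through the sort. *)
Lemma trimmed_sum_lower K N n0 (B : R) : 0 <= B ->
  (forall n, (n < N)%N -> n <> n0 -> f (iter n T x) <= B) ->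
  \sum_(n < N | n != n0 :> nat) f (iter n T x) - K%:R * B <= trimmed_sum T f K N x.
Proof.
move=> B0 fB; rewrite /trimmed_sum -/(vals N) -/(srt N) sum_vals.
pose h v : R := Num.max 0 (v - B).
have h0 v : 0 <= h v by rewrite le_max lexx.
have vh v : v <= B + h v by rewrite -lerBlDl le_max lexx orbT.
have s1 : \sum_(v <- take K (srt N)) v <= K%:R * B + \sum_(v <- srt N) h v.
  apply: (@le_trans _ _ (\sum_(v <- take K (srt N)) (B + h v))); first exact: ler_sum.
  rewrite big_split /= lerD//.
    rewrite big_const_seq count_predT iter_addr_0 -[leLHS]mulr_natl.
    by apply: ler_wpM2r => //; rewrite ler_nat size_take_min geq_minl.
  by rewrite -[in leRHS](cat_take_drop K (srt N)) big_cat /= lerDl sumr_ge0.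
have s2 : \sum_(v <- srt N) h v = \sum_(n < N) h (f (iter n T x)).
  rewrite (perm_big (vals N)) ?perm_sort//= /vals big_map.
  by rewrite -{1}[N]subn0 -/(index_iota 0 N) big_mkord.
have s3 : \sum_(n < N) h (f (iter n T x)) + \sum_(n < N | n != n0 :> nat) f (iter n T x)
    <= \sum_(n < N) f (iter n T x).
  have hz (n : nat) : (n < N)%N -> n <> n0 -> h (f (iter n T x)) = 0.
    by move=> nN nn; apply: max_l; rewrite subr_le0 fB.
  have [n0N|Nn0] := ltnP n0 N; last first.
    rewrite big1 ?add0r; last first.
      by move=> n _; apply: hz => // nE; move: (ltn_ord n); rewrite nE ltnNge Nn0.
    rewrite [leRHS](bigID (fun n : 'I_N => n != n0 :> nat)) /= lerDl.
    by apply: sumr_ge0.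
  rewrite (bigD1 (Ordinal n0N))//= [\sum_(i < N | i != Ordinal n0N) _]big1; last first.
    move=> n nn; apply: hz => // nE; move: nn; apply/negP; rewrite negbK.
    exact/eqP/val_inj.
  rewrite addr0 [leRHS](bigD1 (Ordinal n0N))//= lerD//.
  by rewrite ge_max f_ge0 gerBl.
by rewrite lerBlDr addrAC -lerBlDr opprK addrC; move: s1 s3; rewrite s2; lra.
Qed.

End TrimmedSums.

Section BlockDeterministic.

Lemma block_upper_algebra {R : realFieldType} (S CN Y X re q e1 d : R) :
  S <= re * ((q + e1) * X) + CN -> X <= Y -> CN <= e1 * Y -> 0 <= re ->
  0 <= q + e1 -> (re + 1) * e1 <= d -> 0 < Y -> S / Y <= re * q + d.
Proof.
move=> h XY CY re0 q0 hd Y0; rewrite ler_pdivrMr//; apply: (le_trans h).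
have -> : (re * q + d) * Y = re * ((q + e1) * Y) + e1 * Y + (d - (re + 1) * e1) * Y.
  by ring.
rewrite -[leLHS]addr0; apply: lerD; last by rewrite mulr_ge0 ?subr_ge0// ltW.
apply: lerD => //; apply: ler_wpM2l => //; exact: ler_wpM2l.
Qed.

Lemma block_lower_algebra {R : realFieldType} (S CN Y X re re' c0 ia t e1 k d : R) :
  0 <= re -> 0 <= re' -> 0 <= k -> 0 <= e1 -> X <= Y -> 0 < Y -> 0 <= ia <= 1 ->
  re * ((c0 - 3 * e1) * X) - CN - k * (re' * (e1 * X) + CN) <= S ->
  CN <= e1 * Y -> ia * Y - t * Y <= X -> re * c0 * t <= e1 -> 0 <= c0 ->
  e1 * (3 * re + 2 + k * (re' + 1)) <= d ->
  re * (c0 * ia) - d <= S / Y.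
Proof.
move=> re0 re'0 k0 e10 XY Y0 /andP[ia0 ia1] h CY Xl ret c00 hd.
rewrite ler_pdivlMr//; apply: le_trans h.
have h1 : re * c0 * (ia * Y - t * Y) <= re * c0 * X by apply: ler_wpM2l => //; exact: mulr_ge0.
have h2 : re * c0 * t * Y <= e1 * Y by rewrite ler_pM2r.
have h3 : k * (re' * (e1 * X) + CN) <= k * (re' * (e1 * Y) + e1 * Y).
  by apply: ler_wpM2l => //; apply: lerD => //; apply: ler_wpM2l => //; exact: ler_wpM2l.
have h4 : re * (3 * e1 * X) <= re * (3 * e1 * Y).
  by apply: ler_wpM2l => //; apply: ler_wpM2l => //; exact: mulr_ge0.
have h5 : e1 * (3 * re + 2 + k * (re' + 1)) * Y <= d * Y by rewrite ler_pM2r.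
have -> : re * ((c0 - 3 * e1) * X) - CN - k * (re' * (e1 * X) + CN) =
  re * c0 * X - re * (3 * e1 * X) - CN - k * (re' * (e1 * X) + CN) by ring.
have h6 : re * c0 * X - re * (3 * e1 * X) - CN - k * (re' * (e1 * X) + CN) >=
   re * c0 * (ia * Y - t * Y) - re * (3 * e1 * Y) - e1 * Y - k * (re' * (e1 * Y) + e1 * Y).
  by do 3 (apply: lerB => //).
apply: le_trans h6.
have -> : re * c0 * (ia * Y - t * Y) - re * (3 * e1 * Y) - e1 * Y - k * (re' * (e1 * Y) + e1 * Y)
  = re * (c0 * ia) * Y - e1 * (3 * re + 2 + k * (re' + 1)) * Y + (e1 * Y - re * c0 * t * Y).
  by ring.
rewrite mulrBl -[leLHS]addr0; apply: lerD; last by rewrite subr_ge0.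
exact: lerB.
Qed.

Context {R : realType} {M : Type}.
Variables (T : M -> M) (f : M -> R) (x : M).
Hypothesis f_ge0 : forall n, 0 <= f (iter n T x).
(** A single orbit is fixed: [G j n] stands for the observable truncated at [blk_L a j], evaluated
    at time [n]. The exceptional time [n0] in [f_G] may change with the block. *)
Variables (a c0 res eps : R) (G : nat -> nat -> R).
Hypothesis a1 : 1 < a.
Hypothesis c00 : 0 <= c0.
Hypothesis eps0 : 0 < eps.
Hypothesis eps_res : eps < res.
Hypothesis G_ge0 : forall j n, 0 <= G j.+1 n.
Hypothesis G_le : forall j n, G j.+1 n <= blk_L a j.+1.
Let N1 j := Num.truncn (a ^+ j).
Let N2 j := Num.truncn (a ^+ j.+1).
Let sums_ok (Nf : nat -> nat) := forall e, 0 < e -> exists j0, forall j, (j0 <= j)%N ->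
    `|\sum_(n < Nf j) G j n - (Nf j)%:R * (c0 * (j%:R * ln a))|
      <= e * (a ^+ j * (j%:R * ln a)).
Hypothesis sums1 : sums_ok N1.
Hypothesis sums2 : sums_ok N2.
Variable C : R.
Hypothesis C0 : 0 <= C.
Hypothesis f_G : exists j0, forall j, (j0 <= j)%N -> exists n0 : nat,
  forall n, (n < N2 j)%N -> n <> n0 ->
    `|f (iter n T x) - res * G j n| <= eps * G j n + C /\ G j n <= blk_Lam a j.

Let la0 : 0 < ln a. Proof. exact: ln_gt0. Qed.
Let a0 : 0 < a. Proof. exact: lt_trans a1. Qed.
Let re : R := res + eps.
Let rl : R := res - eps.
Let re0 : 0 <= re. Proof. by rewrite addr_ge0// ltW// (lt_trans eps0). Qed.
Let rl0 : 0 <= rl. Proof. by rewrite subr_ge0 ltW. Qed.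

Lemma block_index (j0 : nat) : exists N0, forall N, (N0 <= N)%N -> exists j,
  [/\ (j0 <= j)%N, (N1 j <= N)%N, (N <= N2 j)%N, (0 < N)%N &
      j%:R * ln a <= ln N%:R < j.+1%:R * ln a].
Proof.
exists (Num.truncn (a ^+ j0)).+1 => N NN; have N0 : (0 < N)%N by exact: leq_trans NN.
have Np : 0 < N%:R :> R by rewrite ltr0n.
pose j := Num.truncn (ln N%:R / ln a : R).
have N1' : 1 <= N%:R :> R by rewrite ler1n.
have jl : j%:R <= ln N%:R / ln a :> R by rewrite truncn_le// divr_ge0 ?ln_ge0// ltW.
have jg : ln N%:R / ln a < j.+1%:R :> R by exact: truncnS_gt.
rewrite ler_pdivlMr// in jl; rewrite ltr_pdivrMr// in jg.
have ajN : a ^+ j <= N%:R.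
  by rewrite -ler_ln ?posrE ?exprn_gt0// lnXn// -(mulr_natl (ln a)).
have Naj : N%:R < a ^+ j.+1.
  by rewrite -ltr_ln ?posrE ?exprn_gt0// lnXn// -(mulr_natl (ln a)).
exists j; split => //; last by rewrite jl.
- have : a ^+ j0 < a ^+ j.+1.
    apply: lt_trans Naj; apply: lt_le_trans (truncnS_gt _) _; by rewrite ler_nat.
  by rewrite ltr_eXn2l.
- rewrite -(ler_nat R); apply: le_trans ajN; rewrite truncn_le.
  by apply: exprn_ge0; exact: ltW.
- by rewrite truncn_ge_nat ?exprn_ge0 ?(ltW a0)// ltW.
Qed.

(** Sums of non-negative terms are monotone in [N], so the end points of a block control everything
    between them, at the price of the factors [a] and [a^-1]. *)
Lemma trimmed_block_limits K d : (0 < K)%N -> 0 < d ->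
  exists N0, forall N, (N0 <= N)%N ->
    rl * (c0 * a^-1) - d <= trimmed_sum T f K N x / (N%:R * ln N%:R) <= re * (a * c0) + d.
Proof.
move=> K0 d0.
(* [Q] collects the coefficients of [e1] in [block_upper_algebra] and [block_lower_algebra]; then
   [e1 * Q = d]. *)
pose Q := Num.max (re + 1) (3 * rl + 2 + K%:R * (re + 1)).
have Q0 : 0 < Q by rewrite lt_max ltr_wpDl.
pose e1 := d / Q; have e10 : 0 < e1 by rewrite divr_gt0.
have e1Q : e1 * Q = d by rewrite divfK// gt_eqF.
have e1u : (re + 1) * e1 <= d.
  by rewrite -e1Q mulrC; apply: ler_wpM2l; [exact: ltW | rewrite le_max lexx].
have e1l : e1 * (3 * rl + 2 + K%:R * (re + 1)) <= d.
  by rewrite -e1Q; apply: ler_wpM2l; [exact: ltW | rewrite le_max lexx orbT].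
have [j1 j1P] := sums1 e10; have [j2 j2P] := sums2 e10; have [j3 j3P] := f_G.
(* From [j4] on a single truncated value, at most [blk_L a j], is below [e1 * X]; so the term at
   time [n0] is negligible. *)
have [j4 j4P] := blk_w_large ((ln a * e1)^-1 : R).
(* [j <= a ^+ j] absorbs the rounding of [a ^+ j] to the integer [N1 j]. *)
have [j5 j5P] := exp_dominates 1 a1.
pose J := maxn (maxn (maxn j1 j2) (maxn j3 j4)) (maxn (maxn j5 1)
  (maxn (Num.truncn (C / (e1 * ln a))).+1 (maxn (Num.truncn (c0 / e1)).+1 (Num.truncn (rl * c0 / e1)).+1))).
have [N0 N0P] := block_index J; exists N0 => N NN.
have [j [Jj N1N NN2 Ngt0 /andP[lnNl lnNg]]] := N0P N NN.
move: Jj; rewrite !geq_max => /andP[/andP[/andP[jj1 jj2] /andP[jj3 jj4]] /andP[/andP[jj5 jgt0]]].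
move=> /andP[jC /andP[jc0 jrc]].
have h1 := j1P j jj1; have h2 := j2P j jj2; have [n0 n0P] := j3P j jj3.
have wj := j4P j jj4; have jaj := j5P j jj5; rewrite expr1 in jaj.
set X := a ^+ j * (j%:R * ln a) in h1 h2; set Y := N%:R * ln N%:R.
have natlt (z : R) : ((Num.truncn z).+1 <= j)%N -> z <= j%:R.
  by move=> zj; rewrite ltW// (lt_le_trans (truncnS_gt _))// ler_nat.
have jp : 0 < j%:R :> R by rewrite ltr0n.
have b0 : 0 < a ^+ j by exact: exprn_gt0.
have jla : 0 < j%:R * ln a by exact: mulr_gt0.
have X0 : 0 < X by exact: mulr_gt0.
have Np : 0 < N%:R :> R by rewrite ltr0n.
have lnN0 : 0 < ln N%:R :> R by exact: lt_le_trans lnNl.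
have Y0 : 0 < Y by exact: mulr_gt0.
have ajN : a ^+ j <= N%:R.
  by rewrite -ler_ln ?posrE// lnXn// -(mulr_natl (ln a)).
have XY : X <= Y by apply: ler_pM => //; exact: ltW.
have CN : C * N%:R <= e1 * Y.
  rewrite /Y [N%:R * _]mulrC mulrA; apply: ler_wpM2r; first exact: ltW.
  apply: (@le_trans _ _ (e1 * (j%:R * ln a))); last by rewrite ler_pM2l.
  have jC' := natlt _ jC; rewrite ler_pdivrMr in jC'; last exact: mulr_gt0.
  by apply: (le_trans jC'); rewrite [leRHS]mulrCA.
have CN1 : C <= C * N%:R by rewrite ler_peMr// ler1n.
have Gp n : 0 <= G j n by case: (j) jgt0 => // i _; exact: G_ge0.
have GL n : G j n <= blk_L a j by case: (j) jgt0 => // i _; exact: G_le.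
have w1 : 1 <= blk_w j :> R by case: (j) jgt0 => // i _; exact: blk_w_ge1.
have w0 : 0 < blk_w j :> R by exact: lt_le_trans w1.
have LX : blk_L a j <= e1 * X.
  have -> : e1 * X = a ^+ j * (blk_w j ^+ 5 * (blk_w j * (ln a * e1))).
    by rewrite /X -(blk_w6 j); ring.
  rewrite /blk_L ler_pM2l// ler_peMr ?exprn_ge0 ?(ltW w0)//.
  have l0 : 0 < ln a * e1 by exact: mulr_gt0.
  by rewrite -(@ler_pdivrMr _ (ln a * e1))// div1r.
have LamL : blk_Lam a j <= e1 * X.
  apply: le_trans LX; rewrite /blk_Lam /blk_L ler_pM2l//; exact: ler_weXn2l.
have up : trimmed_sum T f K N x / Y <= re * (a * c0) + d.
  apply: (@block_upper_algebra _ _ (C * N%:R) Y X re (a * c0) e1 d) => //; last first.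
    by rewrite addr_ge0 ?(ltW e10)// mulr_ge0// ltW.
  apply: le_trans (trimmed_sum_upper f_ge0 N n0 K0) _.
  apply: (@le_trans _ _ (\sum_(n < N) (re * G j n + C))).
    rewrite [leRHS](bigID (fun n : 'I_N => n != n0 :> nat)) /= -[leLHS]addr0; apply: lerD.
      apply: ler_sum => n /eqP nn.
      have [] := n0P n (leq_trans (ltn_ord n) NN2) nn.
      rewrite ler_norml => /andP[_]; rewrite lerBlDr => h _; apply: (le_trans h).
      by rewrite /re mulrDl [leLHS]addrC addrA.
    by apply: sumr_ge0 => n _; apply: (addr_ge0 _ C0); exact: (mulr_ge0 re0 (Gp _)).
  rewrite big_split /= -mulr_sumr sumr_const card_ord -(mulr_natr C) lerD2r.
  apply: ler_wpM2l => //; apply: (@le_trans _ _ (\sum_(n < N2 j) G j n)).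
    rewrite -(big_mkord xpredT (G j)) -(big_mkord xpredT (G j)).
    rewrite [leRHS](@big_cat_nat _ _ _ N)//= lerDl; exact: sumr_ge0.
  move: h2; rewrite ler_norml => /andP[_]; rewrite lerBlDr => h2; apply: (le_trans h2).
  rewrite mulrDl [leLHS]addrC lerD2r.
  have -> : a * c0 * X = a ^+ j.+1 * (c0 * (j%:R * ln a)) by rewrite exprS /X; ring.
  apply: ler_wpM2r; first by apply: (mulr_ge0 c00); exact: ltW.
  by rewrite truncn_le// exprn_ge0// ltW.
rewrite up andbT.
(* The relative loss from replacing [ln N] by [j * ln a] within a block. *)
pose t : R := j.+1%:R^-1.
have a11 : 0 <= a^-1 <= 1 by rewrite invr_ge0 (ltW a0) invf_le1// ltW.
apply: (@block_lower_algebra _ _ (C * N%:R) Y X rl re c0 a^-1 t e1 K%:R d) => //; first exact: ltW; last 2 first.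
- have Yle : Y <= a * a ^+ j * (j.+1%:R * ln a).
    rewrite /Y; apply: ler_pM; rewrite ?(ltW lnN0) ?(ltW lnNg)//.
    rewrite -exprS; apply: (@le_trans _ _ (N2 j)%:R); first by rewrite ler_nat.
    by rewrite truncn_le// exprn_ge0// ltW.
  have XE : X = (a^-1 * (1 - t)) * (a * a ^+ j * (j.+1%:R * ln a)).
    rewrite /X /t -natr1; field; by rewrite natr1 pnatr_eq0 /= (gt_eqF a0).
  have t1 : 0 <= t <= 1 by rewrite invr_ge0 ler0n invf_le1 ?ltr0n// ler1n.
  rewrite XE; apply: (@le_trans _ _ (a^-1 * (1 - t) * Y)); last first.
    by apply: ler_wpM2l => //; rewrite mulr_ge0 ?invr_ge0 ?(ltW a0) ?subr_ge0//; case/andP: t1.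
  rewrite -mulrBl; apply: ler_wpM2r; first exact: ltW.
  rewrite mulrBr mulr1 lerD2l lerN2 ler_piMl//; by [case/andP: t1 | case/andP: a11].
- rewrite /t ler_pdivrMr ?ltr0n// [leRHS]mulrC -ler_pdivrMr//; apply: le_trans (natlt _ jrc) _.
  by rewrite ler_nat.
have B0 : 0 <= re * blk_Lam a j + C.
  apply: (addr_ge0 _ C0); apply: (mulr_ge0 re0); apply: mulr_ge0; [exact: ltW | ].
  exact: exprn_ge0 (ltW w0).
have fB n : (n < N)%N -> n <> n0 -> f (iter n T x) <= re * blk_Lam a j + C.
  move=> nN nn; have [] := n0P n (leq_trans nN NN2) nn.
  rewrite ler_norml => /andP[_]; rewrite lerBlDr => h hL; apply: (le_trans h).
  rewrite addrAC lerD2r -mulrDl addrC; exact: ler_wpM2l.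
apply: le_trans (trimmed_sum_lower f_ge0 K B0 fB).
apply: lerB; last first.
  apply: ler_wpM2l => //; apply: lerD => //; exact: ler_wpM2l.
have sumN : rl * (\sum_(n < N1 j) G j n - blk_L a j) - C * N%:R <=
    \sum_(n < N | n != n0 :> nat) f (iter n T x).
  apply: (@le_trans _ _ (\sum_(n < N1 j | n != n0 :> nat) (rl * G j n - C))).
    rewrite big_split /= -mulr_sumr; apply: lerD.
      apply: ler_wpM2l => //; rewrite lerBlDr.
      rewrite (bigID (fun n : 'I_(N1 j) => n != n0 :> nat)) /= lerD2l.
      have [n0N|Nn0] := ltnP n0 (N1 j).
        rewrite (big_pred1 (Ordinal n0N))//= => n; rewrite negbK.
        by apply/eqP/eqP => [h|->//]; exact: val_inj.
      rewrite big1; first exact: mulr_ge0 (ltW b0) (exprn_ge0 _ (ltW w0)).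
      move=> n; rewrite negbK => /eqP nE.
      by move: (ltn_ord n); rewrite nE ltnNge Nn0.
    rewrite sumrN lerN2; apply: (@le_trans _ _ (\sum_(n < N1 j) C)).
      rewrite [leRHS](bigID (fun n : 'I_(N1 j) => n != n0 :> nat)) /= lerDl.
      exact: sumr_ge0.
    rewrite sumr_const card_ord -[leLHS]mulr_natr; apply: ler_wpM2l => //.
    by rewrite ler_nat.
  rewrite -(big_mkord (fun n => n != n0) (fun n => f (iter n T x))).
  rewrite [leRHS](@big_cat_nat _ _ _ (N1 j))//= -[leLHS]addr0; apply: lerD; last first.
    by apply: sumr_ge0.
  rewrite -(big_mkord (fun n => n != n0) (fun n => rl * G j n - C)).
  rewrite [leLHS]big_nat_cond [leRHS]big_nat_cond; apply: ler_sum => n /andP[/andP[_ nN1] /eqP nn].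
  have [] := n0P n (leq_trans nN1 (leq_trans N1N NN2)) nn.
  rewrite ler_norml => /andP[h _] _; move: h; rewrite lerBrDr => h; apply: le_trans h.
  by rewrite /rl opprD mulrBl addrAC addrC addrA addrAC.
apply: le_trans sumN; rewrite lerD2r; apply: ler_wpM2l => //.
have -> : (c0 - 3 * e1) * X = (c0 - e1) * X - e1 * X - e1 * X by ring.
apply: lerB => //.
move: h1; rewrite ler_norml => /andP[+ _]; rewrite lerBrDr => h1; apply: le_trans h1.
rewrite [leRHS]addrC; apply: lerB => //.
have bN : a ^+ j - 1 <= (N1 j)%:R.
  by rewrite lerBlDr natr1 ltW// truncnS_gt.
apply: (@le_trans _ _ ((a ^+ j - 1) * (c0 * (j%:R * ln a)))); last first.
  by apply: ler_wpM2r => //; rewrite mulr_ge0// ltW.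
have -> : (c0 - e1) * X = a ^+ j * (c0 * (j%:R * ln a)) - e1 * a ^+ j * (j%:R * ln a).
  by rewrite /X; ring.
rewrite mulrBl mul1r lerD2l lerN2; apply: ler_wpM2r; first exact: ltW.
rewrite mulrC -ler_pdivrMr//; apply: le_trans jaj; exact: natlt.
Qed.

End BlockDeterministic.
Lemma sandwich_algebra {R : realFieldType} (v t s e : R) : 0 <= v -> 0 < t <= 1 -> 0 < e ->
  3 * t * v <= e / 2 ->
  v * ((1 - t) / (1 + t)) - e / 2 <= s <= v * ((1 + t) * (1 + t)) + e / 2 ->
  `|v - s| <= e.
Proof.
move=> v0 /andP[t0 t1] e0 te /andP[sl su].
have u : v * ((1 + t) * (1 + t)) <= v + 3 * t * v.
  have -> : v + 3 * t * v = v * (1 + 3 * t) by ring.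
  apply: ler_wpM2l => //; have -> : (1 + t) * (1 + t) = 1 + 2 * t + t * t by ring.
  have : t * t <= t by rewrite ler_piMr// ltW.
  lra.
have l : v - 3 * t * v <= v * ((1 - t) / (1 + t)).
  have -> : v - 3 * t * v = v * (1 - 3 * t) by ring.
  apply: ler_wpM2l => //; rewrite ler_pdivlMr; last by lra.
  have : 0 <= t * t by rewrite mulr_ge0// ltW.
  have -> : (1 - 3 * t) * (1 + t) = 1 - 2 * t - 3 * (t * t) by ring.
  lra.
rewrite ler_norml; lra.
Qed.

(** * The strong law for trimmed sums, in abstract form *)

Section TrimmedStrongLaw.
Context d (W : measurableType d) {R : realType} (mu : probability W R).
Variables (T : W -> W) (mT : measurable_fun setT T).
Hypothesis mu_inv : forall A, measurable A -> mu (T @^-1` A) = mu A.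
Variables (g : R -> W -> R) (A : R -> set W) (c0 : R).
Local Notation E := (Ex mu).
Local Notation m A := (fine (mu A)).
Hypothesis mA : forall y, 1 <= y -> measurable (A y).
Hypothesis A_anti : forall y z, 1 <= y -> y <= z -> A z `<=` A y.
Hypothesis mg : forall L, 1 <= L -> measurable_fun setT (g L).
Hypothesis g_ge0 : forall L x, 1 <= L -> 0 <= g L x.
Hypothesis g_leL : forall L x, 1 <= L -> g L x <= L.
Hypothesis g_out : forall L y x, 1 <= L -> 1 <= y -> ~ A y x -> g L x <= y.
Hypothesis g_in : forall e, 0 < e -> exists2 h, 0 < h &
  forall L y x, 1 <= L -> 1 <= y -> y <= h * L -> A y x -> (1 - e) * y <= g L x.
Hypothesis tail : y * m (A y) @[y --> +oo] --> c0.
Variables (Cm gam : R) (mm : nat).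
Hypothesis Cm0 : 0 <= Cm.
Hypothesis gam0 : 0 < gam.
Hypothesis mix1 : forall L n, 1 <= L ->
  E (fun x => g L x * g L (iter n T x)) - E (g L) ^+ 2 <= Cm * L ^+ mm * expR (- gam * n%:R).
Hypothesis mix2 : forall L n, 1 <= L ->
  E (fun x => g L x ^+ 2 * g L (iter n T x) ^+ 2) - E (fun x => g L x ^+ 2) ^+ 2
    <= Cm * L ^+ mm * expR (- gam * n%:R).
Variable (CA : R).
Hypothesis CA0 : 0 <= CA.
Hypothesis A_maj : forall L x, 1 <= L -> A L x -> L ^+ 2 <= CA * g L x ^+ 2.
Hypothesis slow : forall D, 0 < D -> exists C L0, 0 <= C /\
  forall L n, 1 <= L -> L0 <= L -> (0 < n)%N -> n%:R <= D * ln L ->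
    m (A L `&` iter n T @^-1` A L) <= C / (L * ln L ^+ 5).
Variables (f : W -> R) (res : R).
Hypothesis res0 : 0 < res.
Hypothesis f_ge0 : {ae mu, forall x, forall n, 0 <= f (iter n T x)}.
Hypothesis f_g : forall e, 0 < e -> exists C h, [/\ 0 <= C, 0 < h &
  forall L y x, 1 <= L -> 1 <= y -> y <= h * L -> ~ A y x ->
    `|f x - res * g L x| <= e * g L x + C].

Lemma trimmed_strong_law K : (0 < K)%N ->
  {ae mu, forall x, trimmed_sum T f K N x / (N%:R * ln N%:R) @[N --> \oo] --> res * c0}.
Proof.
move=> K0; have c00 := tail_limit_ge0 tail.
(* Only a sequence of ratios [a i] tending to 1 is used, so countably many null sets are discarded.
   The same [t i] later serves as relative error between [f] and [res * g]; [i.+2] keeps it below 1,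
   hence [eps < res]. *)
pose t (i : nat) : R := i.+2%:R^-1; pose a i := 1 + t i.
have t01 i : 0 < t i < 1 by rewrite invr_gt0 ltr0n invf_lt1 ?ltr0n// ltr1n.
have a1 i : 1 < a i by rewrite ltrDl; case/andP: (t01 i).
have a0 i : 0 <= a i by apply: ltW; exact: lt_trans (a1 i).
pose N1 i j := Num.truncn (a i ^+ j); pose N2 i j := Num.truncn (a i ^+ j.+1).
have N1B i j : (N1 i j)%:R <= a i * a i ^+ j.
  apply: (@le_trans _ _ (a i ^+ j)); first by rewrite truncn_le// exprn_ge0.
  by rewrite ler_peMl ?exprn_ge0// ltW.
have N2B i j : (N2 i j)%:R <= a i * a i ^+ j.
  by rewrite -exprS truncn_le// exprn_ge0.
have sums i Nf NfB := ae_block_sums mT mu_inv mA A_anti mg g_ge0 g_leL g_out g_in tail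
  Cm0 gam0 mix1 slow (a1 i) (a0 i) (Nf := Nf) NfB.
have pairs i := ae_block_pairs mT mu_inv mA mg g_ge0 g_leL g_out tail
  Cm0 gam0 mix2 CA0 A_maj slow (a1 i) (a0 i) (N2B i).
pose sums_ok (Nf : nat -> nat -> nat) x := forall i e, 0 < e -> exists j0, forall j, (j0 <= j)%N ->
    `|\sum_(n < Nf i j) g (blk_L (a i) j) (iter n T x) - (Nf i j)%:R * (c0 * (j%:R * ln (a i)))|
      <= e * (a i ^+ j * (j%:R * ln (a i))).
pose pairs_ok x := forall i, exists j0, forall j, (j0 <= j)%N ->
    exists n0 : nat, forall n, (n < N2 i j)%N -> n <> n0 -> ~ A (blk_Lam (a i) j) (iter n T x).
have S1 : {ae mu, forall x, sums_ok N1 x} := ae_foralln (fun i => sums i _ (N1B i)).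
have S2 : {ae mu, forall x, sums_ok N2 x} := ae_foralln (fun i => sums i _ (N2B i)).
have S3 : {ae mu, forall x, pairs_ok x} := ae_foralln pairs.
near=> x.
have f0x : forall n, 0 <= f (iter n T x) by near: x.
have s1 : sums_ok N1 x by near: x.
have s2 : sums_ok N2 x by near: x.
have s3 : pairs_ok x by near: x.
apply/cvgrPdist_le => e e0.
have v0 : 0 <= res * c0 by rewrite mulr_ge0// ltW.
pose i := Num.truncn (3 * (res * c0) / (e / 2)).
have ti : 3 * t i * (res * c0) <= e / 2.
  rewrite mulrAC /t ler_pdivrMr ?ltr0n// [leRHS]mulrC -ler_pdivrMr ?divr_gt0//.
  by apply: ltW; apply: lt_le_trans (truncnS_gt _) _; rewrite ler_nat.
have /andP[ti0 ti1] := t01 i.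
pose eps := t i * res; have eps0 : 0 < eps by exact: mulr_gt0.
have epsr : eps < res by rewrite gtr_pMl.
have [C [h [C0 h0 FG]]] := f_g eps0.
have e20 : 0 < e / 2 by exact: divr_gt0.
have fG : exists j0, forall j, (j0 <= j)%N -> exists n0 : nat,
    forall n, (n < N2 i j)%N -> n <> n0 ->
    `|f (iter n T x) - res * g (blk_L (a i) j) (iter n T x)|
      <= eps * g (blk_L (a i) j) (iter n T x) + C /\
    g (blk_L (a i) j) (iter n T x) <= blk_Lam (a i) j.
  (* [blk_w j >= h^-1] puts [blk_Lam] below [h * blk_L], the range in which [FG] compares [f] with
     [res * g]. *)
  have [j1 j1P] := s3 i; have [j2 j2P] := blk_w_large (h^-1 : R).
  exists (maxn (maxn j1 j2) 1) => -[|j]; rewrite !geq_max ?andbF// => /andP[/andP[/j1P[n0 n0P] /j2P wj] _].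
  exists n0 => n nN nn; have nA := n0P n nN nn.
  have L1 := blk_L_ge1 (a1 i) j; have Lam1 := blk_Lam_ge1 (a1 i) j.
  split; last exact: g_out.
  have w0 : 0 <= blk_w j.+1 :> R by exact: le_trans (blk_w_ge1 _).
  apply: FG nA => //; rewrite /blk_Lam /blk_L [leRHS]mulrCA.
  apply: ler_wpM2l; first exact: exprn_ge0.
  rewrite [blk_w j.+1 ^+ 5]exprS mulrA; apply: ler_peMl; first exact: exprn_ge0.
  by rewrite mulrC -ler_pdivrMr// div1r.
have [N0 N0P] := @trimmed_block_limits R W T f x f0x (a i) c0 res eps
  (fun j n => g (blk_L (a i) j) (iter n T x)) (a1 i) c00 eps0 epsr
  (fun j n => g_ge0 _ (blk_L_ge1 (a1 i) j)) (fun j n => g_leL _ (blk_L_ge1 (a1 i) j))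
  (s1 i) (s2 i) C C0 fG K (e / 2) K0 e20.
exists N0 => // N /= NN; apply: (@sandwich_algebra _ _ (t i)) => //.
  by rewrite ti0 ltW.
move: (N0P N NN); rewrite /a /eps.
have -> : (res - t i * res) * (c0 * (1 + t i)^-1) = res * c0 * ((1 - t i) / (1 + t i)) by ring.
by have -> : (res + t i * res) * ((1 + t i) * c0) = res * c0 * ((1 + t i) * (1 + t i)) by ring.
Unshelve. all: by end_near. Qed.

End TrimmedStrongLaw.

(** * The strong law for a singularity given by a negative power of a function [q] *)

Section PowerLawObservable.
Context d (W : measurableType d) {R : realType} (mu : probability W R).
Variables (T : W -> W) (mT : measurable_fun setT T).
Hypothesis mu_inv : forall A, measurable A -> mu (T @^-1` A) = mu A.
Local Notation E := (Ex mu).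
Local Notation m A := (fine (mu A)).
Variables (q : W -> R) (p c0 : R).
Hypothesis p0 : 0 < p.
Hypothesis mq : measurable_fun setT q.
Hypothesis q0 : forall x, 0 <= q x.
Hypothesis tail_q : forall e : R, 0 < e -> exists2 s0, 0 < s0 & forall s : R, 0 < s < s0 ->
  `|c0 - m [set x | q x < s] / s `^ p| <= e.
Variable gam : R.
Hypothesis gam0 : 0 < gam.
Hypothesis mix_q : forall r : R, 0 < r -> exists C k, 0 <= C /\ forall (t : R) n, 0 < t <= 1 ->
  E (fun x => (q x + t) `^ (- r) * (q (iter n T x) + t) `^ (- r)) - E (fun x => (q x + t) `^ (- r)) ^+ 2
    <= C * t^-1 ^+ k * expR (- gam * n%:R).
Hypothesis slow_q : forall D : R, 0 < D -> exists C s0, [/\ 0 <= C, 0 < s0 &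
  forall (s : R) n, 0 < s < s0 -> (0 < n)%N -> n%:R <= D * `|ln s| ->
    m ([set x | q x < s] `&` iter n T @^-1` [set x | q x < s]) <= C * s `^ p / `|ln s| ^+ 5].
Variables (f : W -> R) (res : R).
Hypothesis res0 : 0 < res.
Hypothesis f_ge0 : {ae mu, forall x, forall n, 0 <= f (iter n T x)}.
Hypothesis f_near : forall e : R, 0 < e -> exists2 s, 0 < s &
  forall x, 0 < q x < s -> `|f x * q x `^ p - res| <= e.
Hypothesis f_far : forall s : R, 0 < s -> exists2 C, 0 <= C & forall x, s <= q x -> `|f x| <= C.

(** The value of [q] at which its power of exponent [- p] equals [y]. *)
Let sg (y : R) : R := y `^ (- p^-1).
Let g (L : R) (x : W) : R := (q x + sg L) `^ (- p).
Let A (y : R) : set W := [set x | q x < sg y].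

Let sg0 (y : R) : 1 <= y -> 0 < sg y.
Proof. by move=> y1; rewrite powR_gt0// (lt_le_trans _ y1). Qed.

Let sgp (y : R) : 1 <= y -> sg y `^ (- p) = y.
Proof. by move=> y1; rewrite -powRrM mulrNN mulVf ?gt_eqF// powRr1// (le_trans _ y1). Qed.

Let sgpV (y : R) : 1 <= y -> sg y `^ p = y^-1.
Proof. by move=> y1; rewrite -powRrM mulNr mulVf ?gt_eqF// powR_inv1// (le_trans _ y1). Qed.

Let powRN_le (r a b : R) : 0 <= r -> 0 < a -> a <= b -> b `^ (- r) <= a `^ (- r).
Proof.
move=> r0 a0 ab; have b0 : 0 < b by exact: lt_le_trans ab.
rewrite !powRN lef_pV2 ?posrE ?powR_gt0//.
by apply: ge0_ler_powR => //; rewrite nnegrE ltW.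
Qed.

Let sg_anti y z : 1 <= y -> y <= z -> sg z <= sg y.
Proof.
by move=> y1 yz; apply: powRN_le => //; [rewrite invr_ge0 ltW | exact: lt_le_trans y1].
Qed.

Let sg_le1 y : 1 <= y -> sg y <= 1.
Proof. by move=> y1; have := sg_anti (lexx 1) y1; rewrite /sg powR1. Qed.

Let mA y : 1 <= y -> measurable (A y).
Proof.
move=> _; rewrite (_ : A y = q @^-1` `]-oo, sg y[%classic); last first.
  by apply/seteqP; split => x; rewrite /A /= in_itv.
by rewrite -[_ @^-1` _]setTI; exact: mq.
Qed.

Let A_anti y z : 1 <= y -> y <= z -> A z `<=` A y.
Proof. by move=> y1 yz x /= qx; exact: lt_le_trans (sg_anti y1 yz). Qed.

Let mg L : 1 <= L -> measurable_fun setT (g L).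
Proof.
move=> L1; apply: (measurableT_comp (measurable_powR _)).
exact: measurable_funD.
Qed.

Let g_ge0 L x : 1 <= L -> 0 <= g L x. Proof. by move=> _; exact: powR_ge0. Qed.

Let g_leL L x : 1 <= L -> g L x <= L.
Proof.
move=> L1; rewrite -[leRHS]sgp//; apply: powRN_le; [exact: ltW|exact: sg0|].
by rewrite lerDr.
Qed.

Let g_out L y x : 1 <= L -> 1 <= y -> ~ A y x -> g L x <= y.
Proof.
move=> L1 y1 /negP; rewrite -leNgt => qx.
rewrite -[leRHS]sgp//; apply: powRN_le; [exact: ltW|exact: sg0|].
by rewrite -[leLHS]addr0 lerD// ltW// sg0.
Qed.

(** When [y] is small against [L], the shift [sg L] is negligible against [sg y] and hardly changes
    the power. *)
Let sg_ratio (e : R) : 0 < e -> exists2 h, 0 < h & forall L y, 1 <= L -> 1 <= y -> y <= h * L ->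
  (1 + sg L / sg y) `^ p <= 1 + e.
Proof.
move=> e0; pose v := (1 + e) `^ p^-1 - 1.
have pV : 0 < p^-1 by rewrite invr_gt0.
have e1 : 0 < 1 + e by rewrite ltr_wpDl.
have v0 : 0 < v.
  have : 1 `^ p^-1 < (1 + e) `^ p^-1.
    by apply: gt0_ltr_powR; rewrite ?nnegrE ?ler01 ?(ltW e1)// ltrDl.
  by rewrite powR1 subr_gt0.
exists (v `^ p); first exact: powR_gt0.
move=> L y L1 y1 yL.
have L0 : 0 < L by exact: lt_le_trans L1.
have y0 : 0 < y by exact: lt_le_trans y1.
have -> : sg L / sg y = (y / L) `^ p^-1.
  rewrite powRM ?invr_ge0 ?(ltW L0) ?(ltW y0)// -(powR_inv1 (ltW L0)) -powRrM mulN1r.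
  by rewrite /sg [y `^ (- _)]powRN invrK mulrC.
have h : (y / L) `^ p^-1 <= v.
  rewrite -[leRHS](powRr1 (ltW v0)) -(divff (lt0r_neq0 p0)) powRrM.
  apply: ge0_ler_powR; rewrite ?nnegrE ?powR_ge0 ?(ltW pV)//.
    by rewrite divr_ge0// ltW.
  by rewrite ler_pdivrMr.
have eE : 1 + e = ((1 + e) `^ p^-1) `^ p by rewrite -powRrM mulVf ?gt_eqF// powRr1// ltW.
rewrite [leRHS]eE; apply: ge0_ler_powR; rewrite ?nnegrE ?powR_ge0 ?(ltW p0)//.
  by rewrite addr_ge0// powR_ge0.
by rewrite addrC -lerBrDr.
Qed.

Let g_lower L y x r : 1 <= L -> 1 <= y -> (1 + sg L / sg y) `^ p <= r -> q x <= sg y -> y <= r * g L x.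
Proof.
move=> L1 y1 hr qx; have sy := sg0 y1; have sL := sg0 L1.
have s0 : 0 < 1 + sg L / sg y by rewrite ltr_wpDr// divr_ge0// ltW.
have h1 : (sg y * (1 + sg L / sg y)) `^ (- p) <= g L x.
  apply: powRN_le; [exact: ltW| by rewrite ltr_wpDl|].
  by rewrite mulrDr mulr1 mulrCA divff ?gt_eqF// mulr1 lerD2r.
rewrite powRM ?(ltW sy) ?(ltW s0)// sgp// powRN in h1.
rewrite -ler_pdivrMl; last by apply: lt_le_trans hr; exact: powR_gt0.
apply: le_trans h1; rewrite mulrC ler_wpM2l ?(le_trans _ y1)//.
by rewrite lef_pV2 ?posrE ?powR_gt0// (lt_le_trans _ hr)// powR_gt0.
Qed.

Let g_in (e : R) : 0 < e -> exists2 h, 0 < h &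
  forall L y x, 1 <= L -> 1 <= y -> y <= h * L -> A y x -> (1 - e) * y <= g L x.
Proof.
move=> e0; have [h h0 hP] := sg_ratio e0; exists h => // L y x L1 y1 yL Ax.
have gl := g_lower L1 y1 (hP L y L1 y1 yL) (ltW Ax).
have e1 : 0 < 1 + e by rewrite ltr_wpDl.
apply: (@le_trans _ _ ((1 + e)^-1 * y)); last by rewrite ler_pdivrMl.
apply: ler_wpM2r; first exact: le_trans y1.
by rewrite -[leRHS]mul1r ler_pdivlMr//; have : 0 <= e * e by [exact: mulr_ge0 (ltW e0) (ltW e0)]; lra.
Qed.

Let tail : y * m (A y) @[y --> +oo] --> c0.
Proof.
apply/cvgrPdist_le => e e0; have [s0 s00 s0P] := tail_q e0.
exists (Num.max 1 (s0 `^ (- p))); split; first exact: num_real.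
move=> y; rewrite gt_max => /andP[y1 ys]; have y1' := ltW y1.
have -> : y * m (A y) = m [set x | q x < sg y] / sg y `^ p.
  by rewrite sgpV// invrK mulrC.
apply: s0P; rewrite sg0//=.
have : (sg y) `^ (- p) > s0 `^ (- p) by rewrite sgp.
by apply: contraTT; rewrite -!leNgt => h; exact: powRN_le (ltW p0) s00 h.
Qed.

(** On [A L] the shifted base [q x + sg L] is below [2 * sg L], which gives the constant. *)
Let A_maj L x : 1 <= L -> A L x -> L ^+ 2 <= (2 `^ p) ^+ 2 * g L x ^+ 2.
Proof.
move=> L1 Ax; rewrite -exprMn ler_pXn2r// ?nnegrE ?mulr_ge0 ?powR_ge0 ?(le_trans _ L1)//.
apply: g_lower (ltW Ax) => //; rewrite divff ?gt_eqF ?sg0//.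
Qed.

Let slow (D : R) : 0 < D -> exists C L0, 0 <= C /\
  forall L n, 1 <= L -> L0 <= L -> (0 < n)%N -> n%:R <= D * ln L ->
    m (A L `&` iter n T @^-1` A L) <= C / (L * ln L ^+ 5).
Proof.
move=> D0; have [|C [s0 [C0 s00 CP]]] := @slow_q (D * p); first exact: mulr_gt0.
(* The bound 2 keeps [ln L] positive, the summand 1 makes [sg L < s0] strict, and [p ^+ 5] comes
   from [ln (sg L)] being [- ln L / p]. *)
exists (C * p ^+ 5), (Num.max 2 (s0 `^ (- p) + 1)); split.
  by rewrite mulr_ge0// exprn_ge0// ltW.
move=> L n L1; rewrite ge_max => /andP[L2 Ls] n0 nD.
have L0 : 0 < L by exact: lt_le_trans L1.
have lnE : `|ln (sg L)| = p^-1 * ln L.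
  by rewrite /sg ln_powR mulNr normrN ger0_norm// mulr_ge0 ?ln_ge0// invr_ge0 ltW.
have lnL : 0 < ln L by rewrite ln_gt0// (lt_le_trans _ L2)// ltr1n.
have sL : 0 < sg L < s0.
  rewrite sg0//=; have : (sg L) `^ (- p) > s0 `^ (- p).
    by rewrite sgp// (lt_le_trans _ Ls)// ltrDl.
  by apply: contraTT; rewrite -!leNgt => h; exact: powRN_le (ltW p0) s00 h.
have := CP (sg L) n sL n0; rewrite lnE => /(_ _)/le_trans; apply.
  by rewrite -mulrA [p * _]mulrA divff ?gt_eqF// mul1r.
rewrite sgpV// exprMn exprVn.
rewrite le_eqVlt; apply/orP; left; apply/eqP; field.
by rewrite !gt_eqF// exprn_gt0.
Qed.

Let mix (r : R) : 0 < r -> exists C k, 0 <= C /\ forall L n, 1 <= L ->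
  E (fun x => (q x + sg L) `^ (- r) * (q (iter n T x) + sg L) `^ (- r))
    - E (fun x => (q x + sg L) `^ (- r)) ^+ 2 <= C * L ^+ k * expR (- gam * n%:R).
Proof.
move=> r0; have [C [k [C0 CP]]] := mix_q r0.
pose k' := (Num.truncn (k%:R * p^-1)).+1; exists C, k'; split => // L n L1.
have := CP (sg L) n; rewrite sg0// sg_le1// => /(_ isT)/le_trans; apply.
apply: ler_wpM2r; first exact: expR_ge0.
apply: ler_wpM2l => //.
rewrite /sg powRN invrK -powR_mulrn ?powR_ge0// -powRrM -powR_mulrn ?(le_trans _ L1)//.
by rewrite ler_powR// mulrC ltW// truncnS_gt.
Qed.

(** Close to the singularity [f] is [res] times the unshifted power, and outside [A y] the shift
    costs only a factor near 1 by [sg_ratio]. Farther away both functions are bounded, which gives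
    the additive [C]. *)
Let f_g (e : R) : 0 < e -> exists C h, [/\ 0 <= C, 0 < h &
  forall L y x, 1 <= L -> 1 <= y -> y <= h * L -> ~ A y x ->
    `|f x - res * g L x| <= e * g L x + C].
Proof.
move=> e0; have [|s s0 sP] := @f_near (e / 4); first exact: divr_gt0.
have [C C0 CP] := f_far s0.
pose e1 := Num.min 1 (e / (2 * res)).
have e10 : 0 < e1 by rewrite lt_min ltr01 divr_gt0// mulr_gt0.
have [h h0 hP] := sg_ratio e10.
exists (C + res * s `^ (- p)), h; split => //.
  by rewrite addr_ge0// mulr_ge0 ?powR_ge0// ltW.
move=> L y x L1 y1 yL /negP; rewrite -leNgt => qy.
have sy := sg0 y1; have sL := sg0 L1.
have qx0 : 0 < q x by exact: lt_le_trans qy.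
have gx0 : 0 <= g L x by exact: g_ge0.
have [qs|sq] := ltP (q x) s; last first.
  apply: le_trans (ler_normB _ _) _; rewrite -[leLHS]add0r lerD ?mulr_ge0 ?(ltW e0)//.
  apply: lerD; first exact: CP.
  rewrite ger0_norm ?mulr_ge0 ?(ltW res0)// ler_wpM2l ?(ltW res0)//.
  by apply: powRN_le; rewrite ?(ltW p0)// -[leLHS]addr0 lerD// ltW.
have := sP x; rewrite qx0 qs => /(_ isT) h1.
pose u := q x `^ (- p).
have u0 : 0 < u by exact: powR_gt0.
have uq : u * q x `^ p = 1 by rewrite /u powRN mulVf// gt_eqF// powR_gt0.
have gu : g L x <= u by apply: powRN_le; rewrite ?(ltW p0)// lerDl ltW.
have ug : u <= (1 + e1) * g L x.
  have r1 : (1 + sg L / q x) `^ p <= 1 + e1.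
    apply: le_trans (hP L y L1 y1 yL); apply: ge0_ler_powR; rewrite ?nnegrE ?(ltW p0)//.
    - by rewrite addr_ge0// divr_ge0// ltW.
    - by rewrite addr_ge0// divr_ge0// ltW.
    - by rewrite lerD2l ler_pM2l// lef_pV2.
  have -> : g L x = u * ((1 + sg L / q x) `^ p)^-1.
    rewrite -powRN /u -powRM ?(ltW qx0)//; last by rewrite addr_ge0// divr_ge0// ltW.
    by rewrite mulrDr mulr1 mulrCA divff ?gt_eqF// mulr1.
  rewrite mulrCA ler_peMr ?(ltW u0)// ler_pdivlMr ?mul1r//.
  by rewrite powR_gt0// ltr_wpDr// divr_ge0// ltW.
rewrite -[leLHS]addr0; apply: lerD; last by rewrite addr_ge0// mulr_ge0 ?powR_ge0// ltW.
have h2 : `|f x - res * u| <= e / 4 * u.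
  have -> : f x - res * u = (f x * q x `^ p - res) * u by rewrite mulrBl -mulrA [q x `^ p * u]mulrC uq mulr1.
  by rewrite normrM (gtr0_norm u0) ler_pM2r.
have e11 : e1 <= 1 by rewrite ge_min lexx.
have e12 : res * e1 <= e / 2.
  have -> : e / 2 = res * (e / (2 * res)) by field; rewrite gt_eqF.
  by rewrite ler_pM2l// ge_min lexx orbT.
have h3 : `|res * u - res * g L x| <= e / 2 * g L x.
  rewrite -mulrBr ger0_norm ?mulr_ge0 ?(ltW res0) ?subr_ge0//.
  apply: (@le_trans _ _ (res * (e1 * g L x))); last by rewrite mulrA ler_wpM2r.
  by rewrite ler_pM2l// lerBlDr; move: ug; rewrite mulrDl mul1r addrC.
have h4 : e / 4 * u <= e / 2 * g L x.
  have : u <= 2 * g L x.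
    by apply: (le_trans ug); rewrite ler_wpM2r// -[2]/(1 + 1) lerD2l.
  by rewrite -(ler_pM2l (_ : 0 < e / 4)) ?divr_gt0//; move=> hh; apply: (le_trans hh); rewrite mulrA; apply: ler_wpM2r => //; lra.
have -> : f x - res * g L x = (f x - res * u) + (res * u - res * g L x) by rewrite addrA subrK.
apply: le_trans (ler_normD _ _) _.
have -> : e * g L x = e / 2 * g L x + e / 2 * g L x by field.
by apply: lerD => //; exact: le_trans h4.
Qed.

(** The square of a shifted power is the shifted power of doubled exponent, so [mix_q] at [p] and at
    [p + p] supplies both mixing hypotheses. *)
Lemma trimmed_strong_law_power K : (0 < K)%N ->
  {ae mu, forall x, trimmed_sum T f K N x / (N%:R * ln N%:R) @[N --> \oo] --> res * c0}.
Proof.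
have [C1 [k1 [C10 C1P]]] := mix p0.
have [|C2 [k2 [C20 C2P]]] := @mix (p + p); first exact: addr_gt0.
have gsq L x : 1 <= L -> g L x ^+ 2 = (q x + sg L) `^ (- (p + p)).
  move=> L1; rewrite opprD powRD; last first.
    by have h : 0 < q x + sg L; [rewrite ltr_wpDl// sg0 | rewrite (gt_eqF h) implybT].
  by rewrite -expr2.
have up (C : R) k L n : 0 <= C -> (C <= C1 + C2) -> (k <= maxn k1 k2)%N -> 1 <= L ->
    C * L ^+ k * expR (- gam * n%:R) <= (C1 + C2) * L ^+ maxn k1 k2 * expR (- gam * n%:R).
  move=> C0 CC kk L1; apply: ler_wpM2r; first exact: expR_ge0.
  by apply: ler_pM => //; [rewrite exprn_ge0// (le_trans _ L1) | exact: ler_weXn2l].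
apply: (@trimmed_strong_law _ W R mu T mT mu_inv g A c0 mA A_anti mg g_ge0 g_leL g_out g_in
  tail (C1 + C2) gam (maxn k1 k2) _ gam0 _ _ ((2 `^ p) ^+ 2) _ A_maj slow f res res0 f_ge0 f_g).
- exact: addr_ge0.
- move=> L n L1; apply: le_trans (C1P L n L1) _; apply: up => //; first by rewrite lerDl.
  exact: leq_maxl.
- move=> L n L1; have := C2P L n L1.
  have -> : (fun x => (q x + sg L) `^ (- (p + p)) * (q (iter n T x) + sg L) `^ (- (p + p)))
      = (fun x => g L x ^+ 2 * g L (iter n T x) ^+ 2) by apply/funext => x; rewrite !gsq.
  have -> : (fun x => (q x + sg L) `^ (- (p + p))) = (fun x => g L x ^+ 2).
    by apply/funext => x; rewrite !gsq.
  move=> h; apply: (le_trans h); apply: up => //; first by rewrite lerDr.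
  exact: leq_maxr.
- by rewrite exprn_ge0// powR_ge0.
Qed.

End PowerLawObservable.

(** * Quadratic forms and Riemannian distance *)
Lemma cvg_prodr {K : numFieldType} {T I : Type} (F : set_system T) (FF : Filter F)
    (r : seq I) (P : pred I) (f : I -> T -> K) (a : I -> K) :
  (forall i, P i -> f i x @[x --> F] --> a i) ->
  \prod_(i <- r | P i) f i x @[x --> F] --> \prod_(i <- r | P i) a i.
Proof.
move=> fa; elim: r => [|i r IH].
  by rewrite big_nil; under eq_cvg do rewrite big_nil; exact: cvg_cst.
rewrite big_cons; under eq_cvg do rewrite big_cons.
by case: ifP => // Pi; apply: cvgM => //; exact: fa.
Qed.

Section QuadraticForms.
Context {R : realType} {d : nat}.
Implicit Types (G H : 'M[R]_d) (v w : 'rV[R]_d).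

Lemma qformE G v : qform G v = \sum_i \sum_j v 0 i * v 0 j * G i j.
Proof.
rewrite /qform !mxE exchange_big /=; apply: eq_bigr => j _.
rewrite !mxE mulr_suml; apply: eq_bigr => i _; by rewrite mulrAC.
Qed.

Lemma qform_le_norm G v : `|qform G v| <= (\sum_i \sum_j `|G i j|) * `|v| ^+ 2.
Proof.
rewrite qformE mulr_suml; apply: le_trans (ler_norm_sum _ _ _) _.
apply: ler_sum => i _; rewrite mulr_suml; apply: le_trans (ler_norm_sum _ _ _) _.
apply: ler_sum => j _; rewrite !normrM mulrC ler_wpM2l// expr2.
by apply: ler_pM => //; exact: rV_coord_le.
Qed.

Lemma qformB G H v : qform (G - H) v = qform G v - qform H v.
Proof. by rewrite /qform mulmxBr mulmxBl !mxE. Qed.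

Lemma qformZ G (t : R) v : qform G (t *: v) = t ^+ 2 * qform G v.
Proof.
by rewrite /qform linearZ /= -!scalemxAl -scalemxAr scalerA mxE expr2.
Qed.

Lemma qform0 G : qform G 0 = 0.
Proof. by rewrite /qform !mul0mx mxE. Qed.

Lemma qformN G v : qform G (- v) = qform G v.
Proof. by rewrite -scaleN1r qformZ sqrrN expr1n mul1r. Qed.

Lemma posdef_ge0 G v : posdef G -> 0 <= qform G v.
Proof.
move=> [_ Gp]; have [->|v0] := eqVneq v 0; first by rewrite qform0.
exact/ltW/Gp.
Qed.

Lemma qform_continuous G : continuous (qform G).
Proof.
move=> v; rewrite (_ : qform G = fun v => \sum_i \sum_j v 0 i * v 0 j * G i j); last first.
  by apply/funext => w; rewrite qformE.
have FF := nbhs_filter v.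
apply: (@cvg_sumr _ _ _ _ _ FF) => i _; apply: (@cvg_sumr _ _ _ _ _ FF) => j _.
apply: cvgM; last exact: cvg_cst.
by apply: cvgM; exact: coord_continuous.
Qed.

(** The constant is the minimum of the form over the unit sphere. In dimension 0 the sphere is
    empty, hence the case distinction. *)
Lemma posdef_lower G : posdef G -> exists2 l, 0 < l & forall v, l * `|v| ^+ 2 <= qform G v.
Proof.
move=> Gp.
have [[w w0]|none] := pselect (exists w : 'rV[R]_d, w != 0); last first.
  exists 1 => // v; have -> : v = 0.
    by apply/eqP; apply: contrapT => /negP v0; apply: none; exists v.
  by rewrite normr0 expr0n mulr0 qform0.
pose S : set 'rV[R]_d := [set v | `|v| = 1].
have nS v : v != 0 -> S (`|v|^-1 *: v).
  move=> v0; rewrite /S /= normrZ ger0_norm ?invr_ge0// mulVf// normr_eq0 //.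
have cS : compact S.
  apply: bounded_closed_compact.
    by exists 1; split => // r r1 v /= ->; exact: ltW.
  rewrite (_ : S = (fun v : 'rV[R]_d => `|v|) @^-1` [set 1])//.
  apply: preimage_closed => [? _|]; [exact: norm_continuous|exact: closed_eq].
have [||c cS' cP] := @EVT_min_rV R d (qform G) S _ cS.
- by exists (`|w|^-1 *: w); exact: nS.
- by apply: continuous_subspaceT => v; exact: qform_continuous.
rewrite inE in cS'.
have c0 : c != 0 by rewrite -normr_eq0 cS' oner_eq0.
exists (qform G c); first exact: Gp.2.
move=> v; have [->|v0] := eqVneq v 0; first by rewrite normr0 expr0n mulr0 qform0.
have := cP (`|v|^-1 *: v); rewrite inE => /(_ (nS v v0)).
by rewrite qformZ exprVn ler_pdivlMl ?exprn_gt0 ?normr_gt0// mulrC.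
Qed.

Lemma posdef_cauchy_schwarz G v w : posdef G ->
  `|(w *m G *m v^T) 0 0| <= Num.sqrt (qform G v) * Num.sqrt (qform G w).
Proof.
move=> Gp; set b := (w *m G *m v^T) 0 0.
have v0 := posdef_ge0 v Gp; have w0 := posdef_ge0 w Gp.
rewrite -sqrtrM// -sqrtr_sqr ler_wsqrtr//.
have [w00|wn0] := eqVneq w 0.
  by rewrite /b w00 !mul0mx mxE expr0n qform0 mulr0.
have wp := Gp.2 _ wn0.
have := posdef_ge0 (v + (- (b / qform G w)) *: w) Gp.
rewrite qformD_scale ?Gp.1// -/b.
have -> : qform G v + 2 * - (b / qform G w) * b + (- (b / qform G w)) ^+ 2 * qform G w =
  (qform G v * qform G w - b ^+ 2) / qform G w by field; rewrite gt_eqF.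
by rewrite pmulr_lge0 ?invr_gt0// subr_ge0.
Qed.

(** The error is relative and uniform in [w], because |w|^2 is dominated by the form at [v0] through
    [posdef_lower]. *)
Lemma near_qform_compare (Mx : 'rV[R]_d -> 'M[R]_d) v0 (e : R) : posdef (Mx v0) ->
  (forall i j, {for v0, continuous (fun v => Mx v i j)}) -> 0 < e ->
  \forall v \near v0, forall w,
    (1 - e) * qform (Mx v0) w <= qform (Mx v) w <= (1 + e) * qform (Mx v0) w.
Proof.
move=> Gp Mc e0; have [l l0 lP] := posdef_lower Gp.
pose N (v : 'rV[R]_d) := \sum_i \sum_j `|(Mx v - Mx v0) i j|.
have Nc : N v @[v --> v0] --> (0 : R).
  have -> : (0 : R) = \sum_(i < d) \sum_(j < d) `|(0 : R)|.
    by rewrite big1// => i _; rewrite big1// => j _; rewrite normr0.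
  have FF := nbhs_filter v0.
  apply: (@cvg_sumr _ _ _ _ _ FF) => i _; apply: (@cvg_sumr _ _ _ _ _ FF) => j _; apply: cvg_norm.
  rewrite (_ : (fun _ => _) = (fun v => Mx v i j - Mx v0 i j)); last first.
    by apply/funext => v; rewrite !mxE.
  rewrite -(subrr (Mx v0 i j)); apply: cvgB; [exact: Mc | exact: cvg_cst].
have el : 0 < e * l by exact: mulr_gt0.
move/cvgrPdist_le : Nc => /(_ _ el); apply: filterS => v; rewrite sub0r normrN => Nv w.
have h : `|qform (Mx v) w - qform (Mx v0) w| <= e * qform (Mx v0) w.
  rewrite -qformB; apply: le_trans (qform_le_norm _ _) _.
  apply: (@le_trans _ _ (e * l * `|w| ^+ 2)).
    by apply: ler_wpM2r; [exact: exprn_ge0 | exact: le_trans (ler_norm _) Nv].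
  by rewrite -mulrA ler_pM2l.
move: h; rewrite ler_norml mulrBl mulrDl mul1r; lra.
Qed.

Lemma det_continuous_at {Z : topologicalType} (Mx : Z -> 'M[R]_d) z :
  (forall i j, {for z, continuous (fun y => Mx y i j)}) ->
  {for z, continuous (fun y => \det (Mx y))}.
Proof.
move=> Mc; have FF := nbhs_filter z.
rewrite /determinant; apply: (@cvg_sumr _ _ _ _ _ FF) => s _.
apply: cvgM; first exact: cvg_cst.
apply: (@cvg_prodr _ _ _ _ FF) => i _; exact: Mc.
Qed.

End QuadraticForms.
Section RealCalculus.
Context {R : realType}.
Local Notation lambda := (@lebesgue_measure R).

Lemma ge0_le_integral_on d (T : measurableType d) (m : {measure set T -> \bar R})
    (D : set T) (f g : T -> \bar R) :
  (forall x, D x -> 0 <= f x)%E -> (forall x, D x -> f x <= g x)%E ->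
  (\int[m]_(x in D) f x <= \int[m]_(x in D) g x)%E.
Proof.
move=> f0 fg; rewrite integral_mkcond [leRHS]integral_mkcond.
apply: ge0_le_integralT => x; rewrite /patch; case: ifPn => //; rewrite inE => Dx.
  exact: f0.
exact: fg.
Qed.

Lemma continuous_primitive (h : R -> R) : continuous h ->
  exists G : R -> R, forall t : R, 0 <= t <= 1 -> is_derive t 1 G (h t).
Proof.
move=> ch; exists (fun x => \int[lambda]_(t in `[(-1)%R, x]) h t)%R.
move=> t /andP[t0 t1].
have ih : lambda.-integrable `[(-1)%R, 2%R] (EFin \o h).
  apply: continuous_compact_integrable; first exact: segment_compact.
  exact: continuous_subspaceT.
have t2 : t < 2 by rewrite (le_lt_trans t1)// ltr1n.
have [|dG GE] := continuous_FTC1_closed t2 ih _ (ch t).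
  by rewrite (lt_le_trans _ t0)// ltrN10.
by apply: DeriveDef; [exact: dG | rewrite -derive1E; exact: GE].
Qed.

(** [F] is merely derivable, so its derivative is not integrated. With [G] a primitive of [h], the
    functions [G + F] and [G - F] are non-decreasing by the mean value theorem. *)
Lemma increment_le_integral (h F : R -> R) : continuous h -> (forall t, 0 <= h t) ->
  (forall t : R, 0 <= t <= 1 -> exists2 l, is_derive t 1 F l & `|l| <= h t) ->
  ((`|F 1%R - F 0%R|)%:E <= \int[lambda]_(t in `[0%R, 1%R]) (h t)%:E)%E.
Proof.
move=> ch h0 dF; have [G dG] := continuous_primitive ch.
have cG (t : R) : 0 <= t <= 1 -> {for t, continuous G}.
  move=> t01; apply: differentiable_continuous; apply/derivable1_diffP.
  by have [] := dG t t01.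
have cF (t : R) : 0 <= t <= 1 -> {for t, continuous F}.
  move=> t01; apply: differentiable_continuous; apply/derivable1_diffP.
  by have [l []] := dF t t01.
have IG : (\int[lambda]_(t in `[0%R, 1%R]) (h t)%:E = (G 1%R)%:E - (G 0%R)%:E)%E.
  apply: continuous_FTC2 => //; first exact: continuous_subspaceT.
    split.
    - move=> x; rewrite in_itv/= => /andP[x0 x1].
      by have [] := dG x; first by rewrite !ltW.
    - by apply: cvg_at_right_filter; apply: cG; rewrite lexx ler01.
    - by apply: cvg_at_left_filter; apply: cG; rewrite lexx ler01.
  move=> x; rewrite in_itv/= => /andP[x0 x1].
  by have [|? E] := dG x; [rewrite !ltW | rewrite derive1E].
have mono (s : R) : `|s| = 1 -> G 0 + s * F 0 <= G 1 + s * F 1.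
  move=> s1; pose H t := G t + s * F t.
  have dH (t : R) : 0 <= t <= 1 -> exists2 l, is_derive t 1 H l & 0 <= l.
    move=> t01; have [l dl ll] := dF t t01; have dg := dG t t01.
    exists (h t + s * l); first exact: is_deriveD.
    rewrite -lerBlDr sub0r (le_trans _ ll)// -[leRHS]mul1r -s1 -normrM.
    by rewrite -normrN ler_norm.
  have [||x x01 E] := @MVT_segment R H (fun t => 'D_1 H t) 0 1 ler01.
  - move=> x; rewrite in_itv/= => /andP[x0 x1].
    by have [|l [dl _] _] := dH x; [rewrite !ltW | split].
  - apply/continuous_within_itvP => //; split.
    + move=> x; rewrite in_itv/= => /andP[x0 x1].
      apply: cvgD; first by apply: cG; rewrite !ltW.
      by apply: cvgM; [exact: cvg_cst | apply: cF; rewrite !ltW].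
    + apply: cvg_at_right_filter; apply: cvgD; first by apply: cG; rewrite lexx ler01.
      by apply: cvgM; [exact: cvg_cst | apply: cF; rewrite lexx ler01].
    + apply: cvg_at_left_filter; apply: cvgD; first by apply: cG; rewrite lexx ler01.
      by apply: cvgM; [exact: cvg_cst | apply: cF; rewrite lexx ler01].
  - move: E; rewrite subr0 mulr1 -/(H 0) -/(H 1) => E.
    have [|l [_ lE] l0] := dH x; first by move: x01; rewrite in_itv.
    by rewrite -subr_ge0 -/(H 0) -/(H 1) E lE.
rewrite IG -EFinB lee_fin ler_norml.
have := mono 1 (normr1 _); have := mono (-1) (normrN1 _); rewrite !mul1r !mulN1r.
by move=> h1 h2; apply/andP; split; move: h1 h2; lra.
Qed.

End RealCalculus.

Section Paths.
Context {R : realType} {d : nat} {M : ptopologicalType}.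
Variable X : riemannianManifold R d M.
Local Notation lambda := (@lebesgue_measure R).

Lemma arc_length_ge0 (i : idx X) c : (0 <= arc_length i c)%E.
Proof. by apply: integral_ge0 => t _; rewrite lee_fin sqrtr_ge0. Qed.

Lemma path_length_ge0 x y l : path_length X x y l -> (0 <= l)%E.
Proof. by elim=> // i c z l' _ _ _ _ IH; rewrite adde_ge0// arc_length_ge0. Qed.

Lemma path_length_cat x y z l l' : path_length X x y l -> path_length X y z l' ->
  path_length X x z (l + l')%E.
Proof.
move=> H; elim: H z l' => [a z l' p|i c b l1 dc cc ic _ IH z l' p]; first by rewrite add0e.
by rewrite -addeA; apply: path_cons => //; exact: IH.
Qed.

Lemma dist_le_length x y l : path_length X x y l -> (dist X x y <= l)%E.
Proof. by move=> p; exact: ereal_inf_lbound. Qed.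

Lemma dist_ge0 x y : (0 <= dist X x y)%E.
Proof. by apply: le_ereal_inf_tmp => l /path_length_ge0. Qed.

Lemma metric_posdef (i : idx X) v : img i v -> posdef (metric i v).
Proof.
by move=> iv; split; [exact: Defs.metric_sym | exact: metric_pos].
Qed.

Lemma metric_continuous (i : idx X) v l m : img i v ->
  {for v, continuous (fun w => metric i w l m)}.
Proof.
move=> iv; have [h _ _] := @metric_smooth R d M X i l m 0 [::] isT; exact: h.
Qed.

Lemma segment_length (i : idx X) (v w : 'rV[R]_d) (B : R) :
  (forall t : R, 0 <= t <= 1 -> img i (v + t *: w)) ->
  (forall t : R, 0 <= t <= 1 -> qform (metric i (v + t *: w)) w <= B) ->
  exists2 l, path_length X (psi i v) (psi i (v + w)) l & (l <= (Num.sqrt B)%:E)%E.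
Proof.
move=> iw Bw; pose c (t : R) := v + t *: w.
have dc (t : R) : is_derive t 1 c w.
  have E : \forall h \near 0^', h^-1 *: ((c \o shift t) (h *: (1:R)) - c t) = w.
    near=> h; rewrite /c /=.
    have -> : (h *: (1 : R) + t) *: w = h *: w + t *: w by rewrite scalerDl [h *: 1]mulr1.
    rewrite addrCA addrK scalerA mulVf ?scale1r//.
    by near: h; exact: nbhs_dnbhs_neq.
  by split; [apply/cvg_ex; exists w; exact: cvg_near_cst | apply: cvg_lim => //; exact: cvg_near_cst].
have dcE : derive1 c = fun=> w.
  by apply/funext => t; rewrite derive1E; exact: (@derive_val _ _ _ _ _ _ _ (dc t)).
exists (arc_length i c + 0)%E.
  have := @path_cons R d M X i c (psi i (v + w)) 0%E.
  rewrite /c scale0r addr0 scale1r; apply => //.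
  - by rewrite -/c dcE => t; exact: cst_continuous.
  - exact: path_nil.
rewrite adde0 /arc_length dcE.
apply: (@le_trans _ _ (\int[lambda]_(t in `[0%R, 1%R]) (Num.sqrt B)%:E)%E).
  apply: ge0_le_integral_on => t; rewrite /= in_itv/= => t01; rewrite lee_fin ?sqrtr_ge0//.
  by rewrite ler_wsqrtr// Bw.
by rewrite integral_cst//= lebesgue_measure_itv/= lte_fin ltr01 oppr0 adde0 mule1.
Unshelve. all: by end_near. Qed.

End Paths.
Lemma qform_shift_continuous {R : realType} {d : nat} (G : 'M[R]_d) (v0 : 'rV[R]_d) :
  continuous (fun v : 'rV[R]_d => qform G (v - v0)).
Proof.
move=> v; have sc : {for v, continuous (fun w : 'rV[R]_d => w - v0)}.
  by apply: (@continuousB _ _ _ id (cst v0)); [exact: cvg_id | exact: cst_continuous].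
exact: (continuous_comp sc (@qform_continuous R d G (v - v0))).
Qed.

Section Distance.
Context {R : realType} {d : nat} {M : ptopologicalType}.
Variable X : riemannianManifold R d M.
Local Notation lambda := (@lebesgue_measure R).

(** Both directions are recorded: [power_singularity] measures the distance to [xs] and [geoball]
    the distance from it, and paths are never reversed. *)
Lemma near_segment_length (i : idx X) v0 (e : R) : img i v0 -> 0 < e ->
  \forall v \near v0, exists l l',
    [/\ path_length X (psi i v0) (psi i v) l, path_length X (psi i v) (psi i v0) l',
        (l <= (Num.sqrt ((1 + e) * qform (metric i v0) (v - v0)))%:E)%E &
        (l' <= (Num.sqrt ((1 + e) * qform (metric i v0) (v - v0)))%:E)%E].
Proof.
move=> iv0 e0.
have H1 : \forall v \near v0, img i v by apply: open_nbhs_nbhs; split => //; exact: img_open.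
have H2 := near_qform_compare (metric_posdef iv0)
  (fun l m => metric_continuous (l := l) (m := m) iv0) e0.
have [r /= r0 rP] := (@nbhs_ballP _ _ _ _).1 (filterI H1 H2).
apply/nbhs_ballP; exists r => // v; rewrite -ball_normE /= => vr.
have inb (t : R) : 0 <= t <= 1 -> ball v0 r (v0 + t *: (v - v0)).
  move=> /andP[t0 t1]; rewrite -ball_normE /= opprD addrA subrr sub0r normrN normrZ ger0_norm//.
  by rewrite (le_lt_trans _ vr)// -normrN opprB ler_piMl.
have [|t t01|l pl ll] := @segment_length R d M X i v0 (v - v0)
  ((1 + e) * qform (metric i v0) (v - v0)).
- by move=> t t01; have [] := rP _ (inb t t01).
- by have [_ /(_ (v - v0))/andP[]] := rP _ (inb t t01).
have rv (t : R) : v + t *: (v0 - v) = v0 + (1 - t) *: (v - v0).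
  rewrite scalerBl scale1r addrA (addrC v0 (v - v0)) subrK; congr (_ + _).
  by rewrite -scalerN opprB.
have ct (t : R) : 0 <= t <= 1 -> 0 <= 1 - t <= 1.
  by move=> /andP[t0 t1]; rewrite subr_ge0 t1 gerBl.
have [|t t01|l' pl' ll'] := @segment_length R d M X i v (v0 - v)
  ((1 + e) * qform (metric i v0) (v - v0)).
- by move=> t t01; rewrite rv; have [] := rP _ (inb _ (ct t t01)).
- rewrite rv; have [_ /(_ (v0 - v))/andP[_]] := rP _ (inb _ (ct t t01)).
  by rewrite -(opprB v v0) !qformN.
exists l, l'; rewrite (addrC v0) subrK in pl; rewrite (addrC v) subrK in pl'.
by split.
Qed.

Lemma near_chart (i : idx X) x (P : 'rV[R]_d -> Prop) : dom i x ->
  (\forall v \near phi i x, P v) -> \forall y \near x, dom i y /\ P (phi i y).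
Proof.
move=> ix HP; apply: filterI; last exact: (phi_continuous ix).
by apply: open_nbhs_nbhs; split => //; exact: dom_open.
Qed.

Lemma near_dist_le (i : idx X) x (e : R) : dom i x -> 0 < e ->
  \forall y \near x, dom i y /\
   ((dist X x y <= (Num.sqrt ((1 + e) * qform (metric i (phi i x)) (phi i y - phi i x)))%:E)%E /\
    (dist X y x <= (Num.sqrt ((1 + e) * qform (metric i (phi i x)) (phi i y - phi i x)))%:E)%E).
Proof.
move=> ix e0; have iv : img i (phi i x) by exists x.
have := near_chart ix (near_segment_length iv e0); apply: filterS => y [iy [l [l' [p p' ll ll']]]].
rewrite !phiK// in p p'; split => //; split.
  by apply: le_trans ll; exact: dist_le_length.
by apply: le_trans ll'; exact: dist_le_length.
Qed.

(** A path of length below [r] is prolonged by a short segment in a chart. Openness makes geodesic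
    balls Borel, which the use of slow recurrence requires. *)
Lemma geoball_open x r : open (geoball X x r).
Proof.
rewrite openE => y; rewrite /geoball /= => /ereal_inf_lt[l pl lr].
have [i iy] := dom_cover X y; have iv : img i (phi i y) by exists y.
have lfin : (l \is a fin_num)%E.
  by rewrite ge0_fin_numE ?(path_length_ge0 pl)// (lt_trans lr)// ltry.
pose B (v : 'rV[R]_d) := Num.sqrt ((1 + 1) * qform (metric i (phi i y)) (v - phi i y)).
have B0 : B (phi i y) = 0 by rewrite /B subrr qform0 mulr0 sqrtr0.
have Bc : {for phi i y, continuous B}.
  pose b (v : 'rV[R]_d) := (1 + 1) * qform (metric i (phi i y)) (v - phi i y).
  have bc : {for phi i y, continuous b}.
    have h1 := @qform_shift_continuous R d (metric i (phi i y)) (phi i y) (phi i y).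
    have h2 := @cst_continuous 'rV[R]_d R (1 + 1) (phi i y).
    exact: (continuousM h2 h1).
  exact: (continuous_comp bc (@sqrt_continuous R (b (phi i y)))).
have {}Bc : B v @[v --> phi i y] --> (0 : R) by rewrite -B0.
have rl : 0 < r - fine l by rewrite subr_gt0 -lte_fin fineK.
move/cvgrPdist_lt : Bc => /(_ _ rl) Bs.
have n1 := near_chart iy Bs; have n2 := near_chart iy (near_segment_length iv ltr01).
have FF := nbhs_filter y; move: n1 n2; apply: filterS2 => z [iz Bz] [_ [l1 [_ [p1 _ ll1 _]]]].
rewrite !phiK// in p1.
rewrite /geoball /=; apply: le_lt_trans (dist_le_length (path_length_cat pl p1)) _.
rewrite -(fineK lfin); apply: (@le_lt_trans _ _ ((fine l)%:E + (B (phi i z))%:E)%E).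
  by rewrite leeD2l.
rewrite -EFinD lte_fin addrC -ltrBrDr.
by move: Bz; rewrite sub0r normrN ger0_norm// sqrtr_ge0.
Qed.

(** An arc is controlled on [0, 1] only, whereas [increment_le_integral] expects a bound continuous
    on the whole line. *)
Let clamp (t : R) : R := Num.max 0 (Num.min t 1).

Let clamp01 t : 0 <= clamp t <= 1.
Proof. by rewrite /clamp le_max lexx ge_max ler01 ge_min lexx orbT. Qed.

Let clamp_id t : 0 <= t <= 1 -> clamp t = t.
Proof. by move=> /andP[t0 t1]; rewrite /clamp (min_idPl t1) (max_idPr t0). Qed.

Let clamp_continuous : continuous clamp.
Proof.
have h1 : continuous (fun t : R => Num.min t 1).
  have i1 : continuous (fun t : R => t) by move=> s; exact: cvg_id.
  exact: (min_fun_continuous i1 (@cst_continuous R R 1)).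
exact: (max_fun_continuous (@cst_continuous R R 0) h1).
Qed.

(** A lower bound on the distance must account for all paths, including those that leave the chart
    of the centre; hence a function [F] on all of [M]. The hypothesis along curves needs
    one-variable calculus only. *)
Lemma path_variation (F : M -> R) (C : R) : 0 < C ->
  (forall (i : idx X) (c : R -> 'rV[R]_d) (t : R), derivable c t 1 -> img i (c t) ->
    exists2 l : R, is_derive t 1 (fun s => F (psi i (c s))) l &
      `|l| <= C * Num.sqrt (qform (metric i (c t)) (derive1 c t))) ->
  forall x y l, path_length X x y l -> (`|F y - F x|%:E <= C%:E * l)%E.
Proof.
move=> C0 dF x y l; elim => {x y l} [x|i c y l dc cdc ic p IH].
  by rewrite subrr normr0 mule0.
have arcle : (`|F (psi i (c 1%R)) - F (psi i (c 0%R))|%:E <= C%:E * arc_length i c)%E.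
  pose h t := Num.sqrt (qform (metric i (c (clamp t))) (derive1 c (clamp t))).
  have ch : continuous h.
    move=> t.
    pose b t := qform (metric i (c (clamp t))) (derive1 c (clamp t)).
    suff bc : {for t, continuous b} by exact: (continuous_comp bc (@sqrt_continuous R (b t))).
    rewrite (_ : b = (fun t => \sum_l \sum_m derive1 c (clamp t) 0 l *
       derive1 c (clamp t) 0 m * metric i (c (clamp t)) l m)); last first.
      by apply/funext => s; rewrite /b qformE.
    have FF := nbhs_filter t.
    have c1 k : {for t, continuous (fun t => derive1 c (clamp t) 0 k)}.
      have h1 := continuous_comp (@clamp_continuous t) (cdc (clamp t)).
      exact: (continuous_comp h1 (@coord_continuous R 1 d 0 k _)).
    have c2 l0 m : {for t, continuous (fun t => metric i (c (clamp t)) l0 m)}.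
      have h2 : {for clamp t, continuous c}.
        by apply: differentiable_continuous; apply/derivable1_diffP; exact: dc.
      have h1 := continuous_comp (@clamp_continuous t) h2.
      have h3 := metric_continuous (l := l0) (m := m) (ic _ (clamp01 t)).
      exact: (continuous_comp h1 h3).
    apply: (@cvg_sumr _ _ _ _ _ FF) => k _; apply: (@cvg_sumr _ _ _ _ _ FF) => m _.
    apply: cvgM; last exact: c2.
    by apply: cvgM; exact: c1.
  have h0 t : 0 <= h t by exact: sqrtr_ge0.
  rewrite -lee_pdivrMl// -EFinM.
  have -> : C^-1 * `|F (psi i (c 1)) - F (psi i (c 0))| =
      `|C^-1 * F (psi i (c 1)) - C^-1 * F (psi i (c 0))|.
    by rewrite -mulrBr normrM gtr0_norm// invr_gt0.
  have := @increment_le_integral R h (fun s => C^-1 * F (psi i (c s))) ch h0.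
  move=> /(_ _)/le_trans; apply.
    move=> t t01; rewrite /h clamp_id//.
    have [l1 dl1 ll1] := dF i c t (dc t) (ic t t01).
    exists (C^-1 * l1); first exact: is_deriveZ.
    by rewrite normrM gtr0_norm ?invr_gt0// ler_pdivrMl.
  rewrite /arc_length.
  apply: ge0_le_integral_on => t /=; rewrite in_itv/= => t01; first by rewrite lee_fin; exact: h0.
  by rewrite /h clamp_id; [exact: lexx | exact: t01].
rewrite ge0_muleDr ?arc_length_ge0 ?(path_length_ge0 p)//.
apply: (@le_trans _ _ (`|F (psi i (c 1%R)) - F (psi i (c 0%R))|%:E + `|F y - F (psi i (c 1%R))|%:E)%E).
  rewrite -EFinD lee_fin.
  have -> : F y - F (psi i (c 0)) = (F (psi i (c 1)) - F (psi i (c 0))) + (F y - F (psi i (c 1))).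
    by rewrite [RHS]addrC addrA subrK.
  exact: ler_normD.
exact: leeD.
Qed.

Lemma dist_variation (F : M -> R) (C : R) : 0 < C ->
  (forall (i : idx X) (c : R -> 'rV[R]_d) (t : R), derivable c t 1 -> img i (c t) ->
    exists2 l : R, is_derive t 1 (fun s => F (psi i (c s))) l &
      `|l| <= C * Num.sqrt (qform (metric i (c t)) (derive1 c t))) ->
  forall x y, (`|F y - F x|%:E <= C%:E * dist X x y)%E.
Proof.
move=> C0 dF x y; rewrite -lee_pdivrMl//.
apply: le_ereal_inf_tmp => l pl; rewrite lee_pdivrMl//.
exact: path_variation C0 dF _ _ _ pl.
Qed.

End Distance.

(** * A smooth substitute for the squared distance *)
(** Both bounds follow from 1 - z^(n+2) = (1 - z) (1 + z + ... + z^(n+1)). With y = Q / delta they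
    compare the truncated power with the quadratic form. *)
Lemma one_sub_pow_bounds {R : realFieldType} (y : R) n : 0 <= y ->
  n.+2%:R * y * Num.max 0 (1 - y) ^+ n.+1 <= 1 - Num.max 0 (1 - y) ^+ n.+2 <= n.+2%:R * y.
Proof.
move=> y0; set z := Num.max 0 (1 - y).
have z0 : 0 <= z by rewrite le_max lexx.
have z1 : z <= 1 by rewrite ge_max ler01 gerBl.
have zy : 1 - z <= y by rewrite lerBlDr -lerBlDl le_max lexx orbT.
have S : 1 - z ^+ n.+2 = (1 - z) * \sum_(i < n.+2) z ^+ i.
  rewrite -[X in X - z ^+ _ = _](expr1n _ n.+2) subrXX; congr (_ * _); apply: eq_bigr => i _.
  by rewrite expr1n mul1r.
rewrite S; apply/andP; split; last first.
  rewrite mulrC; apply: ler_pM => //; first by apply: sumr_ge0 => i _; exact: exprn_ge0.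
    by rewrite subr_ge0.
  apply: (@le_trans _ _ (\sum_(i < n.+2) 1)).
    by apply: ler_sum => i _; exact: exprn_ile1.
  by rewrite sumr_const card_ord.
have [->|zn] := eqVneq z 0.
  by rewrite exprS mul0r mulr0 subr0 mul1r sumr_ge0// => i _; exact: exprn_ge0.
have yE : y = 1 - z.
  move: zn; rewrite /z; case: leP => //; last by rewrite eqxx.
  by move=> _ _; rewrite opprB addrC subrK.
rewrite yE [n.+2%:R * _]mulrC -mulrA ler_wpM2l ?subr_ge0//.
apply: (@le_trans _ _ (\sum_(i < n.+2) z ^+ n.+1)).
  by rewrite sumr_const card_ord mulr_natl.
by apply: ler_sum => i _; apply: ler_wiXn2l => //; rewrite -ltnS.
Qed.

Lemma compact_psi_image {R : realType} {d : nat} {M : ptopologicalType}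
    (X : riemannianManifold R d M) (i : idx X) (B : set 'rV[R]_d) :
  compact B -> B `<=` img i -> compact (psi i @` B).
Proof.
move=> cB Bi; apply: continuous_compact => //.
apply/continuous_in_subspaceT => v; rewrite inE => Bv.
by apply: psi_continuous; exact: Bi.
Qed.

Lemma open_psi_preimage {R : realType} {d : nat} {M : ptopologicalType}
    (X : riemannianManifold R d M) (i : idx X) (O : set M) :
  open O -> open (img i `&` psi i @^-1` O).
Proof.
move=> oO; rewrite openE => v [iv Ov]; apply: filterI.
  by apply: open_nbhs_nbhs; split => //; exact: img_open.
by apply: (psi_continuous iv); apply: open_nbhs_nbhs.
Qed.

(** Since b^2 <= b, the weight can be moved under the root, where [b * Qz <= q]. The derivative of
    [q] is then bounded by sqrt q, as for an exact squared distance. *)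
Lemma weighted_cauchy_schwarz {R : rcfType} (b q Qz Qw k sp P : R) : 0 <= b <= 1 ->
  0 <= Qz -> b * Qz <= q -> 0 <= k -> Qw <= k * sp ->
  `|P| <= Num.sqrt Qz * Num.sqrt Qw ->
  `|b * (2 * P)| <= 2 * Num.sqrt q * (Num.sqrt k * Num.sqrt sp).
Proof.
move=> /andP[b0 b1] Qz0 bq k0 Qsp hP.
have hb : b * Num.sqrt Qz <= Num.sqrt q.
  rewrite -{1}(ger0_norm b0) -sqrtr_sqr -sqrtrM ?sqr_ge0// ler_wsqrtr//.
  by apply: le_trans bq; apply: ler_wpM2r => //; rewrite expr2 ler_piMl.
have hw : Num.sqrt Qw <= Num.sqrt k * Num.sqrt sp by rewrite -sqrtrM// ler_wsqrtr.
rewrite mulrCA normrM ger0_norm// -mulrA ler_pM2l// normrM (ger0_norm b0).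
apply: (@le_trans _ _ (b * (Num.sqrt Qz * Num.sqrt Qw))); first exact: ler_wpM2l.
rewrite [leLHS]mulrA; apply: ler_pM; [|exact: sqrtr_ge0|exact: hb|exact: hw].
by rewrite mulr_ge0 ?sqrtr_ge0.
Qed.

Lemma is_derive_sumr {R : realType} n (h : 'I_n -> R -> R) (t : R) (dh : 'I_n -> R) :
  (forall i, is_derive t 1 (h i) (dh i)) ->
  is_derive t 1 (fun s => \sum_i h i s) (\sum_i dh i).
Proof.
move=> H; rewrite (_ : (fun s => _) = \sum_i h i); first exact: is_derive_sum.
by apply/funext => s; rewrite fct_sumE.
Qed.

Lemma qform_curve_derive {R : realType} {d : nat} (G : 'M[R]_d) v0 (z : R -> 'rV[R]_d) (t : R) :
  G^T = G -> derivable z t 1 ->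
  is_derive t 1 (fun s => qform G (z s - v0)) (2 * (derive1 z t *m G *m (z t - v0)^T) 0 0).
Proof.
move=> GT dz; pose a l s := z s 0 l - v0 0 l.
have da l : is_derive t 1 (a l) (derive1 z t 0 l).
  have dl : is_derive t 1 (fun s => z s 0 l) (derive1 z t 0 l).
    apply: DeriveDef; first exact: (derivable_mxP _ _ _).1.
    by rewrite derive1E derive_mx// mxE.
  have dc : is_derive t 1 (cst (v0 0 l) : R -> R) 0 by exact: is_derive_cst.
  by apply: is_derive_eq (is_deriveB dl dc) _; rewrite subr0.
rewrite (_ : (fun s => _) = (fun s => \sum_l \sum_k a l s * a k s * G l k)); last first.
  apply/funext => s; rewrite qformE; apply: eq_bigr => l _; apply: eq_bigr => k _.
  by rewrite !mxE.
have E1 : (derive1 z t *m G *m (z t - v0)^T) 0 0 =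
    \sum_l \sum_k G l k * (a k t * derive1 z t 0 l).
  rewrite !mxE exchange_big /=; apply: eq_bigr => k _.
  rewrite !mxE mulr_suml; apply: eq_bigr => l _; rewrite /a; ring.
have E2 : (derive1 z t *m G *m (z t - v0)^T) 0 0 =
    \sum_l \sum_k G l k * (a l t * derive1 z t 0 k).
  rewrite E1 exchange_big /=; apply: eq_bigr => k _; apply: eq_bigr => l _.
  by rewrite -[in LHS]GT mxE.
have -> : 2 * (derive1 z t *m G *m (z t - v0)^T) 0 0 =
    \sum_l \sum_k (G l k * (a l t * derive1 z t 0 k) + G l k * (a k t * derive1 z t 0 l)).
  rewrite mulr_natl mulr2n {1}E2 E1 -big_split /=; apply: eq_bigr => l _.
  by rewrite -big_split.
apply: is_derive_sumr => l; apply: is_derive_sumr => k.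
have dG : is_derive t 1 (cst (G l k) : R -> R) 0 by exact: is_derive_cst.
apply: is_derive_eq (is_deriveM (is_deriveM (da l) (da k)) dG) _.
by rewrite scaler0 add0r -mulrDr.
Qed.

Lemma transition_differentiable {R : realType} {d : nat} {M : ptopologicalType}
    (X : riemannianManifold R d M) (i j : idx X) v :
  img j v -> dom i (psi j v) -> differentiable (phi i \o psi j) v.
Proof.
move=> jv iv; apply: differentiable_rowP => l.
pose V := phi j @` (dom j `&` dom i).
have VE : V = img j `&` psi j @^-1` dom i.
  apply/seteqP; split => [_ [x [jx ix'] <-]|_ [[x jx <-] /=]]; last by rewrite phiK// => ?; exists x.
  by split; [exists x | rewrite /= phiK].
have Vv : V v by rewrite VE.
have oV : open V by rewrite VE; exact: open_psi_preimage (dom_open _).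
have [_ _ /= T1] := smooth_tame 1 (@transition_smooth R d M X j i l).
have t01 : 0 < (1 : R) <= 1 by rewrite ltr01 lexx.
have h := @diff_continuous_partials R d (fun w => phi i (psi j w) 0 l) v.
have [|k|df _] := h; last exact: df.
- have : \near v, V v by apply: open_nbhs_nbhs.
  by apply: filterS => w Vw k; have [dk _] := T1 k; exact: dk 1 w t01 Vw.
- by have [_ [ck _ _]] := T1 k; exact: ck 1 v t01 Vv.
Qed.

Section Bump.
Context {R : realType} {d : nat} {M : ptopologicalType}.
Variable X : riemannianManifold R d M.
Variables (i0 : idx X) (xs : M) (G : 'M[R]_d) (delta : R) (m : nat).
Hypothesis ixs : dom i0 xs.
Hypothesis Gp : posdef G.
Hypothesis delta0 : 0 < delta.
Let v0 := phi i0 xs.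
Let Q (v : 'rV[R]_d) := qform G (v - v0).
Hypothesis ellipsoid_img : forall v, Q v <= delta -> img i0 v.

Let rad (x : M) := Q (phi i0 x).

(* [quasi_sqdist] is [Q - O(Q^2 / delta)] near [xs], of class C^(m+1) on all of [M]
   because it is constant off the ellipsoid [Q <= delta], and at most [Q]. *)
Definition bump (x : M) : R :=
  if `[< dom i0 x >] then Num.max 0 (1 - delta^-1 * rad x) ^+ m.+2 else 0.

Definition quasi_sqdist (x : M) : R := delta / m.+2%:R * (1 - bump x).

Local Notation q := quasi_sqdist.

Let Q0 v : 0 <= Q v. Proof. exact: posdef_ge0. Qed.
Let dm0 : 0 < delta / m.+2%:R. Proof. by rewrite divr_gt0. Qed.

Lemma bump01 x : 0 <= bump x <= 1.
Proof.
rewrite /bump; case: ifP => _; last by rewrite lexx ler01.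
set z := Num.max _ _; have z0 : 0 <= z by rewrite le_max lexx.
rewrite exprn_ge0//= exprn_ile1// ge_max ler01 gerBl /=.
by apply: mulr_ge0; [rewrite invr_ge0 ltW | exact: Q0].
Qed.

Lemma quasi_sqdist_ge0 x : 0 <= q x.
Proof. by rewrite mulr_ge0 ?(ltW dm0)// subr_ge0; have /andP[] := bump01 x. Qed.

Lemma quasi_sqdist_center : q xs = 0.
Proof.
rewrite /q /bump; case: asboolP => // _.
by rewrite /rad /Q subrr qform0 mulr0 subr0 max_r ?expr1n ?subrr ?mulr0.
Qed.

Let inner x : dom i0 x ->
  Num.max 0 (1 - delta^-1 * rad x) ^+ m.+1 * rad x <= q x <= rad x.
Proof.
move=> ix; rewrite /q /bump; case: asboolP => // _.
have y0 : 0 <= delta^-1 * rad x by rewrite mulr_ge0 ?invr_ge0 ?(ltW delta0)//; exact: Q0.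
have /andP[h1 h2] := one_sub_pow_bounds m y0.
have E : rad x = delta / m.+2%:R * (m.+2%:R * (delta^-1 * rad x)).
  by rewrite [RHS]mulrA divfK ?pnatr_eq0// mulVKf// gt_eqF.
apply/andP; split; last by rewrite [leRHS]E ler_pM2l.
by rewrite mulrC [X in X * _]E -[leLHS]mulrA ler_pM2l.
Qed.

Lemma quasi_sqdist_le x : dom i0 x -> q x <= qform G (phi i0 x - v0).
Proof. by move=> /inner/andP[]. Qed.

(** Off the chart [q] takes its maximal value [delta / m.+2%:R], so a smaller value places the point
    in the chart and bounds its bump from below. *)
Lemma quasi_sqdist_small (z : R) x : 0 <= z -> q x < delta / m.+2%:R * (1 - z ^+ m.+2) ->
  dom i0 x /\ z ^+ m.+1 * qform G (phi i0 x - v0) <= q x.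
Proof.
move=> z0; rewrite {1}/q ltr_pM2l// ltrD2l ltrN2 => h.
have ix : dom i0 x.
  apply: contrapT => nix; move: h; rewrite /bump; case: asboolP => // _.
  by rewrite ltNge exprn_ge0.
split => //; have /andP[h1 _] := inner ix; apply: le_trans h1.
apply: ler_wpM2r; first exact: Q0.
move: h; rewrite /bump; case: asboolP => // _ h; apply: ltW.
by rewrite ltr_pXn2r ?nnegrE ?le_max ?lexx// -(ltr_pXn2r (n := m.+2)) ?nnegrE ?le_max ?lexx.
Qed.

Let E := [set v | Q v <= delta].

Let compactE : compact E.
Proof.
have [l l0 lP] := posdef_lower Gp.
apply: bounded_closed_compact.
  exists (`|v0| + Num.max 1 (delta / l)); split; first exact: num_real.
  move=> r rr v /= Ev; apply: ltW; apply: le_lt_trans rr.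
  rewrite -{1}(subrK v0 v) addrC; apply: le_trans (ler_normD _ _) _; rewrite lerD2l le_max.
  have [n1|n1] := leP `|v - v0| 1; first by [].
  rewrite ler_pdivlMr//= mulrC; apply: le_trans Ev; apply: le_trans (lP _).
  by rewrite ler_pM2l// expr2 ler_peMr// ltW.
rewrite (_ : E = Q @^-1` [set s | s <= delta])//.
apply: preimage_closed => [? _|]; [exact: qform_shift_continuous|exact: closed_le].
Qed.

Let K : set M := psi i0 @` E.

Let closedK : closed K.
Proof.
apply: compact_closed; first exact: manifold_hausdorff X.
exact: compact_psi_image.
Qed.

Let bump_out x : ~ K x -> bump x = 0.
Proof.
move=> nK; rewrite /bump; case: asboolP => // ix.
rewrite max_l ?exprS ?mul0r// subr_le0 ler_pdivlMl// mulr1 ltW// ltNge.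
by apply/negP => h; apply: nK; exists (phi i0 x) => //; exact: phiK.
Qed.

Let K_dom x : K x -> dom i0 x.
Proof. by move=> [v /ellipsoid_img[y iy <-] <-]; rewrite phiK. Qed.

(** [M] is Hausdorff, so the compact [K] is closed and [q] is constant near every point outside the
    chart of the centre. Inside that chart [q] is a truncated power of a polynomial in smooth
    transition functions. *)
Lemma quasi_sqdist_tame n (j : idx X) : (n < m.+2)%N ->
  tame n (img j) (fun=> q \o psi j).
Proof.
move=> nm; apply: tame_local => v jv.
have [ix|nix] := pselect (dom i0 (psi j v)); last first.
  pose V := img j `&` psi j @^-1` (~` K).
  have oV : open V by apply: open_psi_preimage; exact: closed_openC.
  exists V; split; first by split => // /K_dom.
  apply: (@tame_eq _ _ n V (fun _ _ => delta / m.+2%:R)) => //; last exact: tame_cst.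
  by move=> t w _ [_ /bump_out wK]; rewrite /= /q wK subr0 mulr1.
pose V := phi j @` (dom j `&` dom i0).
have oV : open V.
  rewrite (_ : V = img j `&` psi j @^-1` dom i0); first exact: open_psi_preimage (dom_open _).
  apply/seteqP; split => [_ [x [jx ix'] <-]|_ [[x jx <-] /=]]; last by rewrite phiK// => ?; exists x.
  by split; [exists x | rewrite /= phiK].
exists V; split.
  by case: jv ix => x jx <-; rewrite phiK// => ix; exists x.
pose a l w := phi i0 (psi j w) 0 l + (- v0 0 l).
have ta l : tame n V (fun=> a l).
  apply: (tameD oV (F := fun _ w => phi i0 (psi j w) 0 l) (G := fun _ _ => - v0 0 l)); last exact: tame_cst.
  by apply: smooth_tame; exact: transition_smooth.
pose b w := \sum_l \sum_k a l w * a k w * G l k.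
have tb : tame n V (fun=> b).
  apply: (@tame_sum _ _ n V _ _ (fun l _ w => \sum_k a l w * a k w * G l k)) => // l.
  apply: (@tame_sum _ _ n V _ _ (fun k _ w => a l w * a k w * G l k)) => // k.
  apply: (tameM oV (F := fun _ w => a l w * a k w) (G := fun _ _ => G l k)); last exact: tame_cst.
  exact: (tameM oV (ta l) (ta k)).
have t1 : tame n V (fun _ w => 1 + (- delta^-1) * b w).
  apply: (tameD oV (F := fun _ _ => 1) (G := fun _ w => (- delta^-1) * b w)); first exact: tame_cst.
  exact: (tameM oV (tame_cst _ _ _) tb).
have t2 := tame_pos_pow oV nm t1.
have t3 : tame n V (fun _ w => delta / m.+2%:R * (1 + (-1) * Num.max 0 (1 + (- delta^-1) * b w) ^+ m.+2)).
  apply: (tameM oV (F := fun _ _ => _) (G := fun _ w => 1 + (-1) * Num.max 0 (1 + (- delta^-1) * b w) ^+ m.+2)); first exact: tame_cst.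
  apply: (tameD oV (F := fun _ _ => 1) (G := fun _ w => (-1) * Num.max 0 (1 + (- delta^-1) * b w) ^+ m.+2)); first exact: tame_cst.
  exact: (tameM oV (tame_cst _ _ _) t2).
apply: (tame_eq oV _ t3) => t w _ [x [jx ix'] <-].
rewrite /= /q /bump phiK//; case: asboolP => // _.
rewrite mulN1r /b /rad /Q qformE mulNr; congr (_ * (1 - Num.max 0 (1 - _ * _) ^+ _)).
by apply: eq_bigr => l _; apply: eq_bigr => k _; rewrite /a phiK// !mxE.
Qed.

(** The derivative of [q] is that of the quadratic form times the truncated power of one degree
    less, to which [weighted_cauchy_schwarz] applies. [metric_compat] carries the speed from the
    chart [j] to the chart of the centre; off [K] the derivative is 0. *)
Lemma quasi_sqdist_derive (e : R) : 0 < e < 1 ->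
  (forall v, Q v <= delta -> forall w, (1 - e) * qform G w <= qform (metric i0 v) w) ->
  forall (j : idx X) (c : R -> 'rV[R]_d) (t : R), derivable c t 1 -> img j (c t) ->
  exists2 l : R, is_derive t 1 (fun s => q (psi j (c s))) l &
    `|l| <= 2 * Num.sqrt (q (psi j (c t))) *
      (Num.sqrt (1 - e)^-1 * Num.sqrt (qform (metric j (c t)) (derive1 c t))).
Proof.
move=> /andP[e0 e1] cmp j c t dc jc.
have d1 : differentiable c t := (@derivable1_diffP _ _ c t).1 dc.
have cc : {for t, continuous c} := differentiable_continuous d1.
have nearO (O : set M) : open O -> O (psi j (c t)) -> \forall s \near t, O (psi j (c s)).
  move=> oO Oc; have oW := open_psi_preimage (X := X) (i := j) oO.
  have : \forall v \near c t, (img j `&` psi j @^-1` O) v by apply: open_nbhs_nbhs.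
  move=> H; have FF := nbhs_filter t.
  have : nbhs t [set s | img j (c s) /\ O (psi j (c s))] by exact: (cc _ H).
  by apply: filterS => s [].
have [Kx|nKx] := pselect (K (psi j (c t))); last first.
  exists 0; last by rewrite normr0 !mulr_ge0 ?sqrtr_ge0.
  have N : \near t, delta / m.+2%:R = q (psi j (c t)).
    have := nearO _ (closed_openC closedK) nKx; apply: filterS => s /bump_out.
    by rewrite /q => ->; rewrite subr0 mulr1.
  apply: near_eq_is_derive N _; exact: is_derive_cst.
have ix := K_dom Kx.
pose z s := phi i0 (psi j (c s)).
have dtr := transition_differentiable jc ix.
have dzd : differentiable z t := differentiable_comp d1 dtr.
have dz : derivable z t 1 := (@derivable1_diffP _ _ z t).2 dzd.
pose w := derive1 z t.
have zE : w = derive1 c t *m jacobian (phi i0 \o psi j) (c t).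
  rewrite /jacobian mul_rV_lin1 /w !derive1E (deriveE _ dzd) (deriveE _ d1).
  exact: (congr1 (fun h : R -> 'rV[R]_d => h 1) (diff_comp d1 dtr)).
have speed : qform (metric j (c t)) (derive1 c t) = qform (metric i0 (z t)) w.
  have cV : (phi j @` (dom j `&` dom i0)) (c t).
    by case: jc ix => x jx <-; rewrite phiK// => ix; exists x.
  have /= -> := @metric_compat R d M X j i0 (c t) cV.
  by rewrite zE /qform trmx_mul !mulmxA.
have EQ : Q (z t) <= delta.
  case: Kx => v Ev vE; have [x ix0 xE] := ellipsoid_img Ev.
  rewrite /z -vE -xE phiK ?xE; [exact: Ev | exact: ix0].
have speed_ge : qform G w <= (1 - e)^-1 * qform (metric j (c t)) (derive1 c t).
  rewrite speed ler_pdivlMl; [exact: cmp | by rewrite subr_gt0].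
pose y := 1 - delta^-1 * Q (z t); pose b := Num.max 0 y ^+ m.+1.
pose D := 2 * (w *m G *m (z t - v0)^T) 0 0.
have dQ : is_derive t 1 (fun s => Q (z s)) D := qform_curve_derive v0 Gp.1 dz.
exists (b * D).
  have N : \forall s \near t, delta / m.+2%:R * (1 - Num.max 0 (1 - delta^-1 * Q (z s)) ^+ m.+2) = q (psi j (c s)).
    have := nearO _ (dom_open i0) ix; apply: filterS => s si.
    by rewrite /q /bump; case: asboolP => [_|ni]; [ | case: (ni si)].
  apply: near_eq_is_derive N _.
  pose g s := 1 - delta^-1 * Q (z s).
  have dg : is_derive t 1 g (- (delta^-1 * D)).
    have c1 : is_derive t 1 (cst 1 : R -> R) 0 by exact: is_derive_cst.
    by apply: is_derive_eq (is_deriveB c1 (is_deriveZ delta^-1 dQ)) _; rewrite sub0r.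
  have dp : is_derive (g t) 1 (fun r : R => Num.max 0 r ^+ m.+2) (m.+2%:R * b) by exact: is_derive_pos_pow.
  have dh := @is_derive1_comp R _ g t _ _ dp dg.
  have c1 : is_derive t 1 (cst 1 : R -> R) 0 by exact: is_derive_cst.
  apply: is_derive_eq (is_deriveZ (delta / m.+2%:R) (is_deriveB c1 dh)) _.
  have alg (k u v : R) : k != 0 -> delta / k * (0 - k * u * - (delta^-1 * v)) = u * v.
    by move=> k0; field; rewrite k0 gt_eqF.
  by apply: alg; rewrite pnatr_eq0.
have z0 : 0 <= Num.max 0 y by rewrite le_max lexx.
have b0 : 0 <= b by exact: exprn_ge0.
have b1 : b <= 1.
  apply: exprn_ile1; first exact: z0.
  rewrite ge_max ler01 /= gerBl; apply: mulr_ge0; last exact: Q0.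
  by rewrite invr_ge0 ltW.
apply: (@weighted_cauchy_schwarz _ b _ (Q (z t)) (qform G w)).
- by rewrite b0 b1.
- exact: Q0.
- by have /andP[] := inner ix.
- by rewrite invr_ge0 subr_ge0 ltW.
- exact: speed_ge.
- exact: posdef_cauchy_schwarz.
Qed.

End Bump.

(** * Comparison of the quasi-distance with the distance and with the singularity *)

Section DistanceLower.
Context {R : realType} {d : nat} {M : ptopologicalType}.
Variable X : riemannianManifold R d M.
Variables (i0 : idx X) (xs : M) (G : 'M[R]_d) (delta : R) (m : nat).
Hypothesis ixs : dom i0 xs.
Hypothesis Gp : posdef G.
Hypothesis delta0 : 0 < delta.
Let v0 := phi i0 xs.
Variable e : R.
Hypothesis e01 : 0 < e < 1.
Hypothesis ellipsoid_metric : forall v, qform G (v - v0) <= delta ->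
  img i0 v /\ forall w, (1 - e) * qform G w <= qform (metric i0 v) w.
Local Notation q := (quasi_sqdist i0 xs G delta m).

Let sq (h : R) (x : M) := Num.sqrt (q x + h).

(** The square root is not differentiable at 0, so [q] is first raised by [h > 0]; letting [h] tend
    to 0 gives the estimate for [sqrt q]. *)
Let sq_variation (h : R) x y : 0 < h ->
  (`|sq h y - sq h x|%:E <= (Num.sqrt (1 - e)^-1)%:E * dist X x y)%E.
Proof.
move=> h0; have e1 : 0 < 1 - e by rewrite subr_gt0; case/andP: e01.
apply: dist_variation; first by rewrite sqrtr_gt0 invr_gt0.
move=> j c t dc jc.
have [l dl hl] := quasi_sqdist_derive m Gp delta0 (fun v Qv => (ellipsoid_metric Qv).1)
  e01 (fun v Qv => (ellipsoid_metric Qv).2) dc jc.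
set x0 := psi j (c t) in hl.
have q0 : 0 <= q x0 := quasi_sqdist_ge0 i0 xs m Gp delta0 x0.
have qh : 0 < q x0 + h by exact: ltr_wpDl.
have dg : is_derive t 1 (fun s => q (psi j (c s)) + h) l.
  have dc0 : is_derive t 1 (cst h : R -> R) 0 by exact: is_derive_cst.
  by apply: is_derive_eq (is_deriveD dl dc0) _; rewrite addr0.
have ds := @is_derive1_comp R _ (fun s => q (psi j (c s)) + h) t _ _ (is_derive1_sqrt qh) dg.
exists ((2 * Num.sqrt (q x0 + h))^-1 * l); first exact: ds.
have s0 : 0 < 2 * Num.sqrt (q x0 + h) by rewrite mulr_gt0// sqrtr_gt0.
rewrite normrM gtr0_norm ?invr_gt0// ler_pdivrMl//; apply: (le_trans hl).
apply: ler_wpM2r; first by rewrite mulr_ge0 ?sqrtr_ge0.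
by rewrite ler_pM2l// ler_wsqrtr// lerDl ltW.
Qed.

Let sqrt_le_of_shift (D : \bar R) x :
  (forall h : R, 0 < h -> ((sq h x - sq h xs)%:E <= D)%E) -> ((Num.sqrt (q x))%:E <= D)%E.
Proof.
move=> H; have q0 := quasi_sqdist_ge0 i0 xs m Gp delta0 x.
have qs : q xs = 0 by exact: quasi_sqdist_center.
apply/lee_addgt0Pr => h h0.
have h2 : 0 < h ^+ 2 by exact: exprn_gt0.
rewrite -leeBlDr//; apply: le_trans (H _ h2); rewrite -EFinB lee_fin.
rewrite /sq qs add0r sqrtr_sqr (gtr0_norm h0) lerD2r ler_wsqrtr// lerDl; exact: ltW.
Qed.

Lemma sqrt_quasi_sqdist_le_dist x :
  ((Num.sqrt (q x))%:E <= (Num.sqrt (1 - e)^-1)%:E * dist X xs x)%E /\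
  ((Num.sqrt (q x))%:E <= (Num.sqrt (1 - e)^-1)%:E * dist X x xs)%E.
Proof.
split; apply: sqrt_le_of_shift => h h0.
  apply: le_trans (sq_variation xs x h0); rewrite lee_fin; exact: ler_norm.
by apply: le_trans (sq_variation x xs h0); rewrite lee_fin distrC; exact: ler_norm.
Qed.

End DistanceLower.

Section Asymptotics.
Context {R : realType} {d : nat} {M : ptopologicalType}.
Variable X : riemannianManifold R d M.
Variables (i0 : idx X) (xs : M).
Hypothesis ixs : dom i0 xs.
Let v0 := phi i0 xs.
Let G := metric i0 v0.

Let iv0 : img i0 v0. Proof. by exists xs. Qed.
Let Gp : posdef G. Proof. exact: metric_posdef. Qed.

Lemma near_ellipsoid (P : 'rV[R]_d -> Prop) : (\forall v \near v0, P v) ->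
  exists2 D, 0 < D & forall v, qform G (v - v0) <= D -> P v.
Proof.
move=> /nbhs_ballP[r /= r0 rP]; have [l l0 lP] := posdef_lower Gp.
have r2 : 0 < r / 2 by rewrite divr_gt0.
exists (l * (r / 2) ^+ 2); first by rewrite mulr_gt0// exprn_gt0.
move=> v Qv; apply: rP; rewrite -ball_normE /= -normrN opprB.
have h : l * `|v - v0| ^+ 2 <= l * (r / 2) ^+ 2 by exact: le_trans (lP _) Qv.
rewrite ler_pM2l// ler_pXn2r// ?nnegrE ?(ltW r2)// in h.
by apply: (le_lt_trans h); rewrite ltr_pdivrMr// ltr_pMr// ltr1n.
Qed.

Lemma near_metric_compare (e : R) : 0 < e -> exists2 D, 0 < D &
  forall v, qform G (v - v0) <= D -> img i0 v /\
    forall w, (1 - e) * qform G w <= qform (metric i0 v) w.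
Proof.
move=> e0; apply: near_ellipsoid.
have H1 : \forall v \near v0, img i0 v by apply: open_nbhs_nbhs; split => //; exact: img_open.
have H2 := near_qform_compare Gp (fun l m => metric_continuous (l := l) (m := m) iv0) e0.
have FF := nbhs_filter v0; move: H1 H2; apply: filterS2 => v iv cv; split => // w.
by have /andP[] := cv w.
Qed.

Variable m : nat.
Local Notation Q x := (qform G (phi i0 x - v0)).

Lemma quasi_sqdist_equiv (delta e : R) : 0 < delta -> 0 < e < 1 -> exists2 s0, 0 < s0 &
  forall x, quasi_sqdist i0 xs G delta m x < s0 ->
    [/\ dom i0 x, (1 - e) * Q x <= quasi_sqdist i0 xs G delta m x &
        quasi_sqdist i0 xs G delta m x <= Q x].
Proof.
(* By Bernoulli [(1 - y) ^+ m.+2 >= 1 - e]; below the level chosen next [quasi_sqdist_small] applies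
   with [z = 1 - y]. *)
move=> delta0 /andP[e0 e1]; pose y := e / m.+2%:R.
have y0 : 0 < y by rewrite divr_gt0.
have y1 : y < 1 by rewrite ltr_pdivrMr// mul1r (lt_le_trans e1)// ler1n.
have z0 : 0 < 1 - y by rewrite subr_gt0.
have z1 : 1 - y < 1 by rewrite gtrBl.
exists (delta / m.+2%:R * (1 - (1 - y) ^+ m.+2)).
  by rewrite mulr_gt0 ?divr_gt0// subr_gt0 exprn_ilt1// ltW.
move=> x qx; have [ix h] := quasi_sqdist_small Gp delta0 (ltW z0) qx.
split => //; last exact: quasi_sqdist_le.
apply: le_trans h; apply: ler_wpM2r; first exact: posdef_ge0.
apply: (@le_trans _ _ ((1 - y) ^+ m.+2)); last by apply: ler_wiXn2l; rewrite ?ltW.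
have /andP[_] := one_sub_pow_bounds m (ltW y0).
rewrite max_r ?(ltW z0)//.
have -> : m.+2%:R * y = e by rewrite /y mulrC divfK ?pnatr_eq0.
by rewrite lerBlDr addrC -lerBlDr.
Qed.

Variable delta : R.
Hypothesis delta0 : 0 < delta.
Local Notation q := (quasi_sqdist i0 xs G delta m).

(** No point far from [xs] has small [q], so statements near [xs] become statements about small
    values of [q]. *)
Lemma quasi_sqdist_small_near (P : M -> Prop) : (\forall y \near xs, P y) ->
  exists2 s0, 0 < s0 & forall x, q x < s0 -> P x.
Proof.
move=> HP.
have h0 : \forall v \near v0, P (psi i0 v).
  apply: (psi_continuous iv0); rewrite phiK//; exact: HP.
have [D D0 DP] := near_ellipsoid h0.
have [|s0 s00 s0P] := @quasi_sqdist_equiv delta 2^-1 delta0.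
  by rewrite invr_gt0 ltr0n invf_lt1// ltr1n.
exists (Num.min s0 (D / 2)); first by rewrite lt_min s00 divr_gt0.
move=> x; rewrite lt_min => /andP[/s0P[ix h _] qD].
rewrite -(phiK ix); apply: DP; apply: ltW; move: h qD; set u := qform _ _; lra.
Qed.

(** [delta] is fixed while [e] tends to 0. The sharp lower bound on the distance comes from an
    auxiliary quasi-distance on a smaller ellipsoid [D], where the metric is within [e] of its value
    at the centre; near [xs] both are asymptotic to the same form. *)
Lemma quasi_sqdist_dist_equiv (e : R) : 0 < e < 1 -> exists2 s0, 0 < s0 &
  forall x, q x < s0 -> [/\ dom i0 x, (1 - e) * Q x <= q x, q x <= Q x &
    forall D, D = dist X x xs \/ D = dist X xs x ->
      [/\ D \is a fin_num, (1 - e) * Num.sqrt (Q x) <= fine D &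
          fine D <= Num.sqrt ((1 + e) * Q x)]].
Proof.
move=> e01; have /andP[e0 e1] := e01; have [s1 s10 s1P] := quasi_sqdist_equiv delta0 e01.
have [s2 s20 s2P] := quasi_sqdist_small_near (near_dist_le ixs e0).
have [D D0 DP] := near_metric_compare e0.
have [s3 s30 s3P] := quasi_sqdist_equiv D0 e01.
have e1' : 0 < 1 - e by rewrite subr_gt0.
exists (Num.min s1 (Num.min s2 ((1 - e) * s3))); first by rewrite !lt_min s10 s20 mulr_gt0.
move=> x; rewrite !lt_min => /and3P[/s1P[ix h1 h2] /s2P[_ [up1 up2]] qx3].
split => // D' D'E.
have Q0 : 0 <= Q x by exact: posdef_ge0.
have qD : quasi_sqdist i0 xs G D m x < s3.
  apply: le_lt_trans (quasi_sqdist_le xs m Gp D0 ix) _.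
  by rewrite -(ltr_pM2l e1'); exact: le_lt_trans qx3.
have [_ h3 _] := s3P x qD.
have [l1 l2] := sqrt_quasi_sqdist_le_dist m ixs Gp D0 e01 DP x.
have up : (D' <= (Num.sqrt ((1 + e) * Q x))%:E)%E by case: D'E => ->.
have lo : ((Num.sqrt (quasi_sqdist i0 xs G D m x))%:E <= (Num.sqrt (1 - e)^-1)%:E * D')%E.
  by case: D'E => ->.
have D'0 : (0 <= D')%E by case: D'E => ->; exact: dist_ge0.
have Dfin : D' \is a fin_num by rewrite ge0_fin_numE// (le_lt_trans up)// ltry.
split => //; last by rewrite -lee_fin fineK.
rewrite -(fineK Dfin) -EFinM lee_fin in lo.
have se : 0 < Num.sqrt (1 - e) by rewrite sqrtr_gt0.
have h4 : Num.sqrt (1 - e) * Num.sqrt (Q x) <= (Num.sqrt (1 - e))^-1 * fine D'.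
  by rewrite -sqrtrV ?(ltW e1')//; apply: le_trans lo; rewrite -sqrtrM ?(ltW e1')// ler_wsqrtr.
rewrite ler_pdivlMl// mulrA -expr2 sqr_sqrtr ?(ltW e1')// in h4.
Qed.

End Asymptotics.
Lemma class_CM_continuous {R : realType} {d : nat} {M : ptopologicalType}
    (X : riemannianManifold R d M) kappa (W : set M) (f : M -> R) x :
  class_CM X kappa W f -> W x -> {for x, continuous f}.
Proof.
move=> fW Wx; have [i ix] := dom_cover X x.
have [c _ _] := fW i [::] isT.
have fc : {for phi i x, continuous (f \o psi i)} by apply: c; exists x.
have cp := phi_continuous ix.
apply: (near_eq_continuous _ (continuous_comp cp fc)).
have : \forall y \near x, dom i y by apply: open_nbhs_nbhs; split => //; exact: dom_open.
by apply: filterS => y iy; rewrite /= phiK.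
Qed.

Lemma open_continuous_measurable {R : realType} {M : ptopologicalType} (f : M -> R) :
  continuous f -> measurable_fun [set: borel M] (f : borel M -> R).
Proof.
move=> cf; apply: (measurability _ (RGenOpens.measurableE R)) => //.
move=> _ [_ [a [b ->]] <-]; rewrite setTI; apply: sub_sigma_algebra.
apply: open_comp => [x _|]; [exact: cf | exact: interval_open].
Qed.

(** The power d/2 of (1 - e)^2 is (1 - e)^d, at least 1 - d e by Bernoulli; this bounds the power of
    [b] from both sides. *)
Lemma pow_ratio_bounds {R : realType} (e b : R) d : 0 <= e -> d%:R * e <= 2^-1 -> e < 1 ->
  (1 - e) / (1 + e) <= b -> b * (1 - e) ^+ 2 <= 1 ->
  `|b `^ (d%:R / 2) - 1| <= 2 * (d%:R * e).
Proof.
move=> e0 de e1 bl bu; have e1' : 0 < 1 - e by rewrite subr_gt0.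
have e2 : 0 < 1 + e by rewrite ltr_wpDr.
have b0 : 0 < b by apply: lt_le_trans bl; exact: divr_gt0.
pose E := (1 - e) ^+ d.
have E0 : 0 < E by exact: exprn_gt0.
have sq : E = ((1 - e) ^+ 2) `^ (d%:R / 2).
  rewrite -powR_mulrn ?(ltW e1')// -powRrM mulrC divfK ?pnatr_eq0//.
  by rewrite powR_mulrn// ltW.
have p0 : 0 <= d%:R / 2 :> R by rewrite divr_ge0.
have El : 1 - d%:R * e <= E.
  rewrite /E; elim: d {de E E0 sq p0} => [|n IH]; first by rewrite mul0r subr0 expr0.
  rewrite exprS; apply: (@le_trans _ _ ((1 - e) * (1 - n%:R * e))); last by rewrite ler_pM2l.
  have : 0 <= n%:R * (e * e) by rewrite mulr_ge0// mulr_ge0.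
  by rewrite -natr1; set k := n%:R; have -> : (1 - e) * (1 - k * e) = 1 - (k + 1) * e + k * (e * e) by [ring]; lra.
have l : E <= b `^ (d%:R / 2).
  rewrite sq; apply: ge0_ler_powR; rewrite ?nnegrE ?(ltW b0) ?exprn_ge0 ?(ltW e1')//.
  apply: le_trans bl; rewrite expr2 ler_pM2l// -div1r ler_pdivlMr//.
  by rewrite -subr_sqr expr1n gerBl exprn_ge0.
have u : b `^ (d%:R / 2) * E <= 1.
  rewrite sq -powRM ?exprn_ge0 ?(ltW b0) ?(ltW e1')//.
  have : (b * (1 - e) ^+ 2) `^ (d%:R / 2) <= 1 `^ (d%:R / 2).
    apply: ge0_ler_powR; rewrite ?nnegrE//.
    by rewrite mulr_ge0 ?(ltW b0)// exprn_ge0// ltW.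
  by rewrite powR1.
set y := b `^ _ in l u *; set k := d%:R * e in de El *.
have y2 : y <= 1 + 2 * k.
  have k0 : 0 <= k by rewrite mulr_ge0.
  have h : y * (1 - k) <= 1 by apply: le_trans u; rewrite ler_wpM2l// powR_ge0.
  have k1 : 0 < 1 - k by lra.
  rewrite -(ler_pM2r k1); apply: (le_trans h).
  have -> : (1 + 2 * k) * (1 - k) = 1 + k * (1 - 2 * k) by ring.
  by rewrite lerDl mulr_ge0//; lra.
have k0 : 0 <= k by rewrite mulr_ge0.
by rewrite ler_norml; apply/andP; split; move: y2 l El k0; lra.
Qed.

Section LocalAnalysis.
Context {R : realType} {d : nat} {M : ptopologicalType}.
Variable X : riemannianManifold R d M.
Variables (i0 : idx X) (xs : M).
Hypothesis ixs : dom i0 xs.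
Let v0 := phi i0 xs.
Let G := metric i0 v0.
Variables (delta : R) (m : nat).
Hypothesis delta0 : 0 < delta.
Hypothesis ellipsoid_metric : forall v, qform G (v - v0) <= delta ->
  img i0 v /\ forall w, (1 - 2^-1) * qform G w <= qform (metric i0 v) w.
Local Notation q := (quasi_sqdist i0 xs G delta m).
Local Notation Q x := (qform G (phi i0 x - v0)).
Local Notation p := (d%:R / 2 : R).

Let iv0 : img i0 v0. Proof. by exists xs. Qed.
Let Gp : posdef G. Proof. exact: metric_posdef. Qed.
Let half01 : 0 < (2^-1 : R) < 1.
Proof. by rewrite invr_gt0 ltr0n invf_lt1// ltr1n. Qed.

Lemma quasi_sqdist_continuous : continuous q.
Proof.
move=> x; have [i ix] := dom_cover X x.
have T := quasi_sqdist_tame Gp delta0 (fun v Qv => (ellipsoid_metric Qv).1) (n := 0) (m := m) i isT.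
have [c _ _] := T.
have fc : {for phi i x, continuous (q \o psi i)}.
  by apply: (c 1); [rewrite ltr01 lexx | exists x].
apply: (near_eq_continuous _ (continuous_comp (phi_continuous ix) fc)).
have : \forall y \near x, dom i y by apply: open_nbhs_nbhs; split => //; exact: dom_open.
by apply: filterS => y iy; rewrite /= phiK.
Qed.

(** [f] is continuous on the compact set where [q >= s], which misses [xs]; the bound is that of a
    constant family, read at [t = 1]. *)
Lemma bounded_off_singularity (kappa : R) (f : M -> R) (s : R) : compact [set: M] ->
  class_CM X kappa [set~ xs] f -> 0 < s ->
  exists2 C, 0 <= C & forall x, s <= q x -> `|f x| <= C.
Proof.
move=> cM fC s0.
have cA : compact [set x | s <= q x].
  apply: (subclosed_compact _ cM) => //.
  rewrite (_ : [set x | _] = q @^-1` [set t | s <= t])//.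
  by apply: preimage_closed => [? _|]; [exact: quasi_sqdist_continuous | exact: closed_ge].
have lb : loc_poly_bounded [set x | s <= q x] (fun _ : R => f).
  apply: loc_poly_bounded_continuous => x /= sx; apply: (class_CM_continuous fC) => /= xxs.
  by move: sx; rewrite xxs quasi_sqdist_center// leNgt s0.
have [N NP] := compact_poly_bounded cA lb.
have t01 : 0 < (1 : R) <= 1 by rewrite ltr01 lexx.
exists (pbound N 1); first exact: pbound_ge0.
by move=> x sx; exact: NP 1 x t01 sx.
Qed.

(** f q^(d/2) is g times the power d/2 of q / dist^2: the first factor tends to [res] by continuity
    and the second to 1. *)
Lemma singularity_normal_form (kappa : R) (f : M -> R) (res e : R) :
  power_singularity X kappa xs f d%:R res -> 0 < e ->
  exists2 s, 0 < s & forall x, 0 < q x < s -> `|f x * q x `^ p - res| <= e.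
Proof.
move=> [_ _ d0 [U [g [Uxs gC gE gxs ->]]]] e0.
have gc := class_CM_continuous gC (nbhs_singleton (open_nbhs_nbhs Uxs)).
have e4 : 0 < e / 4 by rewrite divr_gt0.
move/cvgrPdist_le : (gc) => /(_ _ e4) gnear.
have [s1 s10 s1P] := quasi_sqdist_small_near ixs m delta0 (filterI (open_nbhs_nbhs Uxs) gnear).
have d1 : 1 <= d%:R :> R by move: d0; rewrite ltr0n ler1n.
pose mn := Num.min 2^-1 (e / (4 * g xs)); pose e' := mn / (d%:R * 2).
have mn0 : 0 < mn by rewrite lt_min invr_gt0 ltr0n divr_gt0// mulr_gt0.
have mn2 : mn <= 2^-1 by rewrite /mn ge_min lexx.
have mne : mn <= e / (4 * g xs) by rewrite /mn ge_min lexx orbT.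
have e'0 : 0 < e' by rewrite divr_gt0// mulr_gt0.
have de' : d%:R * e' <= mn.
  rewrite /e' mulrCA ler_piMr ?(ltW mn0)// invfM mulrA divff ?gt_eqF// mul1r.
  by rewrite invf_le1// ler1n.
have e'1 : e' < 1.
  apply: (@le_lt_trans _ _ 2^-1); last by rewrite invf_lt1// ltr1n.
  by apply: le_trans mn2; apply: le_trans de'; rewrite ler_peMl// ltW.
have [|s2 s20 s2P] := @quasi_sqdist_dist_equiv R d M X i0 xs ixs m delta delta0 e'.
  by rewrite e'0.
exists (Num.min s1 s2); first by rewrite lt_min s10.
move=> x /andP[qx]; rewrite lt_min => /andP[/s1P[Ux gx] /s2P[ix h1 h2 hD]].
have xxs : x <> xs by move=> xE; move: qx; rewrite xE quasi_sqdist_center// ltxx.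
have [|_ Dl Du] := hD (dist X x xs); first by left.
have := gE x Ux xxs; set D := fine (dist X x xs) in Dl Du *; set u := q x in qx h1 h2 *.
move: h1 h2 Dl Du gx; set w := qform _ _ => h1 h2 Dl Du gx gxE.
have w0 : 0 < w by exact: lt_le_trans h2.
have e'1' : 0 < 1 - e' by rewrite subr_gt0.
have sw0 : 0 < Num.sqrt w by rewrite sqrtr_gt0.
have D0 : 0 < D by apply: lt_le_trans Dl; exact: mulr_gt0.
have D2 : 0 < D ^+ 2 by exact: exprn_gt0.
have D2u : D ^+ 2 <= (1 + e') * w.
  have ew : 0 <= (1 + e') * w by rewrite mulr_ge0 ?(ltW w0)// addr_ge0// ltW.
  by rewrite -(sqr_sqrtr ew) ler_pXn2r// nnegrE ?sqrtr_ge0// ltW.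
have D2l : (1 - e') ^+ 2 * w <= D ^+ 2.
  rewrite -(sqr_sqrtr (ltW w0)) -exprMn ler_pXn2r// nnegrE ?(ltW D0)// mulr_ge0 ?sqrtr_ge0//.
  exact: ltW.
pose b := u / D ^+ 2.
have b0 : 0 < b by exact: divr_gt0.
have hb : `|b `^ p - 1| <= 2 * (d%:R * e').
  apply: pow_ratio_bounds => //; first exact: ltW.
  - exact: le_trans de' mn2.
  - rewrite /b ler_pdivrMr ?ltr_wpDr ?(ltW e'0)// mulrAC ler_pdivlMr//.
    apply: (@le_trans _ _ ((1 - e') * ((1 + e') * w))); first by rewrite ler_pM2l.
    by rewrite mulrCA [_ * (1 + e')]mulrC ler_pM2l ?ltr_wpDr ?(ltW e'0).
  - rewrite /b mulrAC ler_pdivrMr// mul1r; apply: le_trans D2l; rewrite mulrC.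
    by rewrite ler_pM2l// exprn_gt0.
have fE : f x * u `^ p = g x * b `^ p.
  have -> : u = b * D ^+ 2 by rewrite /b divfK// gt_eqF.
  rewrite powRM ?(ltW b0) ?(ltW D2)// -powR_mulrn ?(ltW D0)// -powRrM.
  by rewrite [2 * _]mulrC divfK ?pnatr_eq0// gxE mulrCA mulrC.
rewrite fE.
have -> : g x * b `^ p - g xs = (g x - g xs) * b `^ p + g xs * (b `^ p - 1) by ring.
apply: le_trans (ler_normD _ _) _; rewrite !normrM (gtr0_norm gxs).
have k1 : d%:R * e' <= 2^-1 by exact: le_trans mn2.
have k2 : d%:R * e' <= e / (4 * g xs) by exact: le_trans mne.
have bp : `|b `^ p| <= 2.
  rewrite ger0_norm ?powR_ge0//; move: hb k1; set z := b `^ p; set k := d%:R * e'.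
  by rewrite ler_norml => /andP[_]; lra.
have -> : e = e / 4 * 2 + g xs * (2 * (e / (4 * g xs))).
  by field; rewrite gt_eqF.
apply: lerD; first by apply: ler_pM => //; rewrite distrC.
by rewrite ler_pM2l//; apply: (le_trans hb); rewrite ler_pM2l.
Qed.

Lemma sublevel_sub_geoball : exists2 s0, 0 < s0 &
  forall s, 0 < s < s0 -> [set x | q x < s] `<=` geoball X xs (2 * Num.sqrt s).
Proof.
have [s0 s00 s0P] := quasi_sqdist_dist_equiv ixs m delta0 half01.
exists s0 => // s /andP[s_gt0 ss0] x /= qx.
have [ix h1 _ h2] := s0P x (lt_trans qx ss0).
have [|Dfin _ up] := h2 (dist X xs x); first by right.
rewrite /geoball /= -(fineK Dfin) lte_fin; apply: (le_lt_trans up).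
have -> : 2 * Num.sqrt s = Num.sqrt (4 * s).
  have -> : 4 = 2 ^+ 2 :> R by rewrite -natrX.
  by rewrite sqrtrM ?sqr_ge0// sqrtr_sqr ger0_norm.
rewrite ltr_sqrt ?mulr_gt0//.
have : 0 <= q x by exact: quasi_sqdist_ge0.
by move: h1 qx; rewrite [qform _ _](lock); move: (locked _) => u; lra.
Qed.

(** Every [r] is allowed because [sqrt_quasi_sqdist_le_dist] holds on all of [M]; the 2 is the
    inverse of 1 - 1/2. *)
Lemma geoball_sub_sublevel r : geoball X xs r `<=` [set x | q x < 2 * r ^+ 2].
Proof.
move=> x /= Dr; have [h _] := sqrt_quasi_sqdist_le_dist m ixs Gp delta0 half01 ellipsoid_metric x.
have Dfin : dist X xs x \is a fin_num.
  by rewrite ge0_fin_numE ?dist_ge0// (lt_trans Dr)// ltry.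
rewrite /geoball /= -(fineK Dfin) lte_fin in Dr.
rewrite -(fineK Dfin) -EFinM lee_fin in h.
have D0 : 0 <= fine (dist X xs x) by rewrite fine_ge0// dist_ge0.
have q0 : 0 <= q x by exact: quasi_sqdist_ge0.
have -> : q x = (Num.sqrt (q x)) ^+ 2 by rewrite sqr_sqrtr.
apply: (@le_lt_trans _ _ ((Num.sqrt (1 - 2^-1)^-1 * fine (dist X xs x)) ^+ 2)).
  by rewrite ler_pXn2r// nnegrE ?sqrtr_ge0// mulr_ge0 ?sqrtr_ge0.
rewrite exprMn sqr_sqrtr; last by rewrite invr_ge0; lra.
have -> : (1 - 2^-1)^-1 = 2 :> R by field.
by rewrite ltr_pM2l// ltr_pXn2r// nnegrE ltW// (le_lt_trans D0).
Qed.

End LocalAnalysis.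

(** * Measure of small sublevel sets and mixing *)
Lemma squeeze_algebra {R : realType} (c e t : R) d : 0 <= c -> 0 <= e -> e <= 4^-1 ->
  d%:R * e <= 2^-1 ->
  (1 - e) ^+ 2 * c <= t <= (1 + e) ^+ 2 * ((1 - e)^-1 `^ (d%:R / 2)) * c ->
  `|c - t| <= 8 * ((d%:R + 1) * e) * c.
Proof.
move=> c0 e0 e4 de /andP[tl tu].
have e1 : 0 < 1 - e by lra.
have h : `|(1 - e)^-1 `^ (d%:R / 2) - 1| <= 2 * (d%:R * e).
  apply: pow_ratio_bounds => //; first by lra.
  - rewrite ler_pdivrMr; last by lra.
    rewrite mulrC ler_pdivlMr//; have ee : e * e <= e by rewrite ler_piMl//; lra.
    by have -> : (1 - e) * (1 - e) = 1 - 2 * e + e * e by [ring]; lra.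
  - by rewrite expr2 mulrA mulVf ?gt_eqF// mul1r; lra.
set y := _ `^ _ in h tu; set k := d%:R * e in de h *.
have k0 : 0 <= k by rewrite mulr_ge0.
have yu : y <= 1 + 2 * k by move: h; rewrite ler_norml => /andP[_]; lra.
have y0 : 0 <= y by exact: powR_ge0.
have -> : (d%:R + 1) * e = k + e by rewrite mulrDl mul1r.
have ee : e * e <= e by rewrite ler_piMl//; lra.
have ek : e * k <= e * 2^-1 by rewrite ler_wpM2l.
have h1 : (1 + e) ^+ 2 * y <= 1 + 8 * (k + e).
  apply: (@le_trans _ _ ((1 + 3 * e) * (1 + 2 * k))).
    apply: ler_pM => //; rewrite ?exprn_ge0 ?addr_ge0//.
    by have -> : (1 + e) ^+ 2 = 1 + 2 * e + e * e by [ring]; lra.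
  have -> : (1 + 3 * e) * (1 + 2 * k) = 1 + 2 * k + 3 * e + 6 * (e * k) by ring.
  by move: ek e0 k0; lra.
have h2 : 1 - 8 * (k + e) <= (1 - e) ^+ 2.
  have -> : (1 - e) ^+ 2 = 1 - 2 * e + e * e by ring.
  by have : 0 <= e * e by [exact: mulr_ge0]; lra.
have u : t <= (1 + 8 * (k + e)) * c by apply: (le_trans tu); rewrite ler_wpM2r.
have l : (1 - 8 * (k + e)) * c <= t by apply: le_trans tl; rewrite ler_wpM2r.
rewrite mulrDl mul1r in u; rewrite mulrBl mul1r in l.
by rewrite ler_norml; apply/andP; split; move: u l; lra.
Qed.

Section MeasureTail.
Context {R : realType} {d : nat} {M : ptopologicalType}.
Variable X : riemannianManifold R d M.
Variables (vol : {measure set (borel M) -> \bar R}).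
Hypothesis vol_def : is_riemannian_volume X vol.
Variables (mu : probability (borel M) R) (rho : M -> R).
Hypothesis rho_continuous : continuous rho.
Hypothesis rho_density : forall A : set (borel M), measurable A ->
  mu A = (\int[vol]_(x in A) (rho x)%:E)%E.
Variables (i0 : idx X) (xs : M).
Hypothesis rho_xs : 0 < rho xs.
Hypothesis ixs : dom i0 xs.
Let v0 := phi i0 xs.
Let G := metric i0 v0.
Variables (delta : R) (m : nat).
Hypothesis delta0 : 0 < delta.
Hypothesis ellipsoid_metric : forall v, qform G (v - v0) <= delta ->
  img i0 v /\ forall w, (1 - 2^-1) * qform G w <= qform (metric i0 v) w.
Local Notation q := (quasi_sqdist i0 xs G delta m).
Local Notation Q x := (qform G (phi i0 x - v0)).
Local Notation p := (d%:R / 2 : R).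
Local Notation cd := (unit_ball_volume d : R).
Local Notation sub s := ([set x | (q x < s)%R] : set (borel M)).

Let iv0 : img i0 v0. Proof. by exists xs. Qed.
Let Gp : posdef G. Proof. exact: metric_posdef. Qed.

Lemma measurable_sublevel s : measurable (sub s).
Proof.
apply: sub_sigma_algebra.
rewrite (_ : [set x | _] = q @^-1` [set t | t < s])//.
apply: open_comp => [x _|]; last exact: open_lt.
exact: quasi_sqdist_continuous.
Qed.

Let sd := Num.sqrt (\det G).
Let sd0 : 0 < sd. Proof. by rewrite sqrtr_gt0 posdef_det_gt0. Qed.

Lemma unit_ball_volume_ge0 : 0 <= cd.
Proof. by rewrite -lee_fin unit_ball_volumeE ball_volume_ge0. Qed.

(** The Riemannian density [sd] at the centre cancels the determinant of the ellipsoid, which leaves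
    the Euclidean ball volume. *)
Let ellipsoid_volume (k s : R) : 0 <= k -> 0 < s ->
  lebesgue_int (fun v : 'rV[R]_d => (k * sd * \1_[set v | qform G (v - v0) < s] v)%:E)
  = (k * (s `^ p) * cd)%:E.
Proof.
move=> k0 s0; have ks : 0 <= k * sd by rewrite mulr_ge0// ltW.
rewrite (lebesgue_int_ellipsoid (- v0) s Gp ks) ball_volume_homog// -unit_ball_volumeE.
by rewrite -/sd mulfK ?gt_eqF// -!EFinM mulrA.
Qed.

(** The sublevel set of [q] lies between the ellipsoids Q < s and Q < s / (1 - e). The two other
    factors 1 - e or 1 + e come from the oscillation of [rho] and of the volume density. *)
Let sublevel_bounds (e : R) : 0 < e < 1 -> exists2 s0, 0 < s0 & forall s, 0 < s < s0 ->
  ((((1 - e) ^+ 2 * (cd * rho xs)) * s `^ p)%R%:E <= mu (sub s))%E /\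
  (mu (sub s) <= (((1 + e) ^+ 2 * ((1 - e)^-1 `^ p) * (cd * rho xs)) * s `^ p)%R%:E)%E.
Proof.
move=> e01; have /andP[e0 e1] := e01.
have e1' : 0 < 1 - e by rewrite subr_gt0.
have [s1 s10 s1P] := quasi_sqdist_equiv ixs m delta0 e01.
have er0 : 0 < e * rho xs by exact: mulr_gt0.
have := @rho_continuous xs; move/cvgrPdist_le => /(_ _ er0) rnear.
have [s2 s20 s2P] := quasi_sqdist_small_near ixs m delta0 rnear.
pose D v := Num.sqrt (\det (metric i0 v)).
have Dc : {for v0, continuous D}.
  have dc := det_continuous_at (fun l k => metric_continuous (l := l) (m := k) iv0).
  exact: (continuous_comp dc (@sqrt_continuous R _)).
have es0 : 0 < e * sd by exact: mulr_gt0.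
have Dnear : \forall v \near v0, `|sd - D v| <= e * sd by move/cvgrPdist_le : Dc; apply.
have [s3 s30 s3P] := quasi_sqdist_small_near ixs m delta0 (near_chart ixs Dnear).
exists (Num.min (Num.min s1 s2) (Num.min s3 delta)).
  by rewrite !lt_min s10 s20 s30.
move=> s /andP[s_gt0]; rewrite !lt_min => /andP[/andP[ss1 ss2] /andP[ss3 sdl]].
set A := [set x | q x < s].
have A1 x : A x -> [/\ dom i0 x, (1 - e) * Q x <= q x & q x <= Q x].
  by move=> Ax; apply: s1P; exact: lt_trans ss1.
have A2 x : A x -> (1 - e) * rho xs <= rho x <= (1 + e) * rho xs.
  move=> Ax; have := s2P x (lt_trans Ax ss2).
  by rewrite ler_norml => /andP[]; rewrite mulrBl mulrDl mul1r; lra.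
have A3 x : A x -> (1 - e) * sd <= D (phi i0 x) <= (1 + e) * sd.
  move=> Ax; have [_] := s3P x (lt_trans Ax ss3).
  by rewrite ler_norml => /andP[]; rewrite mulrBl mulrDl mul1r; lra.
have mA : measurable (A : set (borel M)) by exact: measurable_sublevel.
have Adom : A `<=` dom i0 by move=> x /A1[].
have vE := vol_def mA Adom.
have volu : (vol A <= ((1 + e) * ((s / (1 - e)) `^ p) * cd)%:E)%E.
  rewrite vE -ellipsoid_volume ?divr_gt0//; last by rewrite addr_ge0// ltW.
  apply: le_lebesgue_int => v; rewrite lee_fin; first by rewrite mulr_ge0// sqrtr_ge0.
  have [vA|nvA] := pselect ((phi i0 @` A) v); last first.
    rewrite indicE memNset// mul0r !mulr_ge0 ?(ltW sd0) ?addr_ge0 ?(ltW e0)//.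
  case: vA => x Ax <-; have [ix h1 h2] := A1 x Ax.
  rewrite !indicE !mem_set ?mul1r ?mulr1; last by exists x.
    by have /andP[] := A3 x Ax.
  by rewrite /= ltr_pdivlMr// mulrC; exact: le_lt_trans Ax.
have voll : (((1 - e) * (s `^ p) * cd)%:E <= vol A)%E.
  rewrite vE -ellipsoid_volume//; last exact: ltW.
  have k0 : 0 <= (1 - e) * sd by rewrite mulr_ge0// ltW.
  apply: le_lebesgue_int => v; rewrite lee_fin; first by rewrite mulr_ge0.
  have [Qv|nQv] := pselect (qform G (v - v0) < s); last first.
    by rewrite indicE memNset// mulr0 mulr_ge0 ?sqrtr_ge0.
  have [[x ix xE] _] := ellipsoid_metric (ltW (lt_trans Qv sdl)).
  have Ax : A x.
    by apply: le_lt_trans (quasi_sqdist_le xs m Gp delta0 ix) _; rewrite xE.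
  rewrite !indicE !mem_set// ?mul1r ?mulr1; last by exists x.
  by rewrite -xE; have /andP[] := A3 x Ax.
rewrite (rho_density mA); split.
  apply: (@le_trans _ _ (\int[vol]_(x in A) ((1 - e) * rho xs)%:E)%E); last first.
    apply: ge0_le_integral_on => x Ax; rewrite lee_fin; first by rewrite mulr_ge0// ltW.
    by have /andP[] := A2 x Ax.
  rewrite integral_cst//.
  apply: (@le_trans _ _ (((1 - e) * rho xs)%:E * ((1 - e) * (s `^ p) * cd)%:E)%E).
    by rewrite -EFinM lee_fin; rewrite le_eqVlt; apply/orP; left; apply/eqP; ring.
  by apply: lee_wpmul2l => //; rewrite lee_fin mulr_ge0// ltW.
apply: (@le_trans _ _ (\int[vol]_(x in A) ((1 + e) * rho xs)%:E)%E).
  apply: ge0_le_integral_on => x Ax; rewrite lee_fin; have /andP[h1 h2] := A2 x Ax => //.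
  by apply: le_trans h1; rewrite mulr_ge0// ltW.
rewrite integral_cst//.
apply: (@le_trans _ _ (((1 + e) * rho xs)%:E * ((1 + e) * ((s / (1 - e)) `^ p) * cd)%:E)%E).
  by apply: lee_wpmul2l => //; rewrite lee_fin mulr_ge0 ?addr_ge0 ?ltW.
rewrite -EFinM lee_fin powRM ?(ltW s_gt0) ?invr_ge0 ?(ltW e1')//.
by rewrite le_eqVlt; apply/orP; left; apply/eqP; ring.
Qed.

Lemma sublevel_measure (eps : R) : 0 < eps -> exists2 s0, 0 < s0 &
  forall s, 0 < s < s0 -> `|cd * rho xs - fine (mu (sub s)) / s `^ p| <= eps.
Proof.
move=> eps0; set c := cd * rho xs.
have c0 : 0 <= c by rewrite mulr_ge0 ?unit_ball_volume_ge0// ltW.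
pose mn := Num.min 4^-1 (eps / (8 * (c + 1))).
have c1 : 0 < 8 * (c + 1) by rewrite mulr_gt0// ltr_wpDl.
have mn0 : 0 < mn by rewrite lt_min invr_gt0 ltr0n divr_gt0.
have mn4 : mn <= 4^-1 by rewrite ge_min lexx.
have mne : mn <= eps / (8 * (c + 1)) by rewrite ge_min lexx orbT.
pose e := mn / (d%:R + 1).
have d1 : 0 < d%:R + 1 :> R by rewrite ltr_wpDl.
have e0 : 0 < e by exact: divr_gt0.
have de : (d%:R + 1) * e = mn by rewrite /e mulrC divfK// gt_eqF.
have em : e <= mn by rewrite -de ler_peMl ?(ltW e0)// lerDr.
have dem : d%:R * e <= mn by rewrite -de ler_pM2r// lerDl.
have e4 : e <= 4^-1 by exact: le_trans mn4.
have [|s0 s00 s0P] := @sublevel_bounds e; first by rewrite e0 (le_lt_trans e4)// invf_lt1// ltr1n.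
exists s0 => // s ss; have [l u] := s0P s ss; have /andP[s_gt0 _] := ss.
have sp : 0 < s `^ p by exact: powR_gt0.
have muE : mu (sub s) = (fine (mu (sub s)))%:E.
  by rewrite fineK// fin_num_measure//; exact: measurable_sublevel.
rewrite muE lee_fin in l; rewrite muE lee_fin in u.
apply: (@le_trans _ _ (8 * ((d%:R + 1) * e) * c)).
  apply: squeeze_algebra => //; first exact: ltW.
  - by apply: (le_trans dem); apply: (le_trans mn4); lra.
  - by rewrite ler_pdivlMr// ler_pdivrMr// l u.
rewrite de; apply: (@le_trans _ _ (8 * (eps / (8 * (c + 1))) * c)).
  by rewrite ler_wpM2r// ler_pM2l.
have -> : 8 * (eps / (8 * (c + 1))) * c = eps * (c / (c + 1)).
  by field; rewrite gt_eqF// ltr_wpDl.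
by rewrite ler_piMr ?(ltW eps0)// ler_pdivrMr ?ltr_wpDl// mul1r lerDl.
Qed.

End MeasureTail.
Lemma borel_continuous_measurable {M : ptopologicalType} (T : M -> M) :
  continuous T -> measurable_fun [set: borel M] (T : borel M -> borel M).
Proof.
move=> cT; apply: (@measurability _ _ (borel M) (borel M) setT T (@open M)) => //.
move=> _ [V oV <-]; rewrite setTI; apply: sub_sigma_algebra.
by apply: open_comp => // x _; exact: cT.
Qed.

(** Compares the logarithm of the radius 2 sqrt s with that of the level s; below e^(-4) the term ln
    2 is absorbed. *)
Lemma ln_two_sqrt_bounds {R : realType} (s : R) : 0 < s < expR (- 4) ->
  4^-1 * `|ln s| <= `|ln (2 * Num.sqrt s)| /\ 4 <= `|ln s|.
Proof.
move=> /andP[s0 s4].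
have l4 : ln s < - 4 by rewrite -[ltRHS]expRK ltr_ln ?posrE ?expR_gt0.
have l2 : 0 <= ln (2 : R) <= 1.
  rewrite ln_ge0 ?ler1n//= -[leRHS]expRK ler_ln ?posrE ?expR_gt0//.
  by apply: le_trans (expR_ge1Dx 1); lra.
have -> : ln (2 * Num.sqrt s) = ln 2 + 2^-1 * ln s.
  rewrite lnM ?posrE ?sqrtr_gt0//; congr (_ + _).
  have sE : s = Num.sqrt s ^+ 2 by rewrite sqr_sqrtr// ltW.
  have -> : ln s = 2 * ln (Num.sqrt s).
    by rewrite {1}sE lnXn ?sqrtr_gt0// (mulr_natl (ln (Num.sqrt s))).
  by rewrite mulKf ?pnatr_eq0.
have /andP[l20 l21] := l2; move: l4; set u := ln s; set v := ln 2 in l20 l21 *.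
move=> l4; rewrite (@ltr0_norm _ u); last by lra.
by rewrite ltr0_norm; last lra; split; lra.
Qed.

Lemma prod_ord2 {R : realType} (F : nat -> R) : \prod_(j < 2) F j = F 0%N * F 1%N.
Proof. by rewrite !big_ord_recl big_ord0 mulr1. Qed.

Lemma mule_ord2 {R : realType} (F : nat -> \bar R) :
  (\big[mule/1]_(j < 2) F j = F 0%N * F 1%N)%E.
Proof. by rewrite !big_ord_recl big_ord0 mule1. Qed.

(** * Mixing, recurrence and orbits for the quasi-distance *)

Section Assembly.
Context {R : realType} {d : nat} {M : ptopologicalType}.
Variable X : riemannianManifold R d M.
Hypothesis M_compact : compact [set: M].
Variables (vol : {measure set (borel M) -> \bar R}).
Hypothesis vol_def : is_riemannian_volume X vol.
Variables (kappa : R).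
Hypothesis kappa0 : 0 <= kappa.
Variables (T : M -> M) (mu : probability (borel M) R).
Hypothesis T_continuous : continuous T.
Hypothesis mu_inv : forall A : set (borel M), measurable A -> mu (T @^-1` A) = mu A.
Variable rho : M -> R.
Hypothesis rho_continuous : continuous rho.
Hypothesis rho_density : forall A : set (borel M), measurable A ->
  mu A = (\int[vol]_(x in A) (rho x)%:E)%E.
Variables (i0 : idx X) (xs : M).
Hypothesis rho_xs : 0 < rho xs.
Hypothesis ixs : dom i0 xs.
Let v0 := phi i0 xs.
Let G := metric i0 v0.
Variables (delta : R) (m : nat).
Hypothesis delta0 : 0 < delta.
Hypothesis ellipsoid_metric : forall v, qform G (v - v0) <= delta ->
  img i0 v /\ forall w, (1 - 2^-1) * qform G w <= qform (metric i0 v) w.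
Hypothesis m_kappa : (Num.truncn kappa <= m)%N.
Hypothesis d0 : (0 < d)%N.
Local Notation q := (quasi_sqdist i0 xs G delta m).
Local Notation p := (d%:R / 2 : R).
Local Notation c0 := (unit_ball_volume d * rho xs : R).
Local Notation sub s := ([set x | (q x < s)%R] : set (borel M)).

Let Gp : posdef G. Proof. by apply: metric_posdef; exists xs. Qed.
Let p0 : 0 < p. Proof. by rewrite divr_gt0// ltr0n. Qed.
Let q0 x : 0 <= q x. Proof. exact: quasi_sqdist_ge0. Qed.
Let mT := borel_continuous_measurable T_continuous.
Let msub s : measurable (sub s).
Proof. exact: (measurable_sublevel ixs m delta0 ellipsoid_metric s). Qed.

Lemma quasi_sqdist_mixing C0 gam n (ci : 'I_n -> idx X) (K : 'I_n -> set M) :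
  chart_cover ci K -> 0 <= C0 ->
  (forall (f : nat -> M -> R) (k : nat -> nat),
    (forall j, (j < 2)%N -> class_CM X kappa setT (f j)) ->
    (forall j, (j.+1 < 2)%N -> (k j <= k j.+1)%N) ->
    let gap := \big[minn/(k 1 - k 0)%N]_(0 <= j < 1) (k j.+1 - k j)%N in
    (`| \int[mu]_x (\prod_(j < 2) f j (iter (k j) T x))
        - \prod_(j < 2) \int[mu]_x f j x |%:E
     <= (C0 * expR (- gam * gap%:R))%:E *
        \big[mule/1]_(j < 2) norm_C kappa ci K (f j))%E) ->
  forall r : R, 0 < r -> exists C k, 0 <= C /\ forall (t : R) n, 0 < t <= 1 ->
  Ex mu (fun x => (q x + t) `^ (- r) * (q (iter n T x) + t) `^ (- r))
    - Ex mu (fun x => (q x + t) `^ (- r)) ^+ 2 <= C * t^-1 ^+ k * expR (- gam * n%:R).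
Proof.
move=> cov C00 mix r r0; pose w (t : R) (x : M) := (q x + t) `^ (- r).
have tw (i : idx X) : tame (Num.truncn kappa).+1 (img i) (fun t => w t \o psi i).
  apply: (@tame_shift_powR _ _ _ _ _ (q \o psi i)); [exact: img_open|exact: r0|by move=> x _; exact: q0|].
  have hn : ((Num.truncn kappa).+1 < m.+2)%N by rewrite !ltnS.
  exact: (@quasi_sqdist_tame R d M X i0 xs G delta m Gp delta0
    (fun v Qv => (ellipsoid_metric Qv).1) _ i hn).
have [N NP] := norm_C_poly_bound kappa0 cov tw.
exists (C0 * N%:R ^+ 2), (N * 2)%N; split; first by rewrite mulr_ge0// exprn_ge0.
move=> t n1 t01.
have cw : class_CM X kappa setT (w t).
  move=> i; rewrite setIT; apply: (@tame_class_C _ _ kappa (img i) (fun t => w t \o psi i) t) => //.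
  exact: img_open.
(* The two times are 0 and [n1], so the seeded minimum of the gaps is [n1]. *)
pose kk (j : nat) := if j is 0%N then 0%N else n1.
have hk j : (j.+1 < 2)%N -> (kk j <= kk j.+1)%N by case: j.
have gapE : \big[minn/(kk 1 - kk 0)%N]_(0 <= j < 1) (kk j.+1 - kk j)%N = n1.
  by rewrite big_ltn// big_geq// /kk subn0 minnn.
have := mix (fun=> w t) kk (fun _ _ => cw) hk; cbv zeta; rewrite gapE => h.
have /andP[nC0 nCN] := NP t t01.
have P0 : 0 <= pbound N t by exact: pbound_ge0.
have {}h : (`|Ex mu (fun x => w t x * w t (iter n1 T x)) - Ex mu (w t) ^+ 2|%:E <=
    (C0 * expR (- gam * n1%:R))%:E * (pbound N t * pbound N t)%:E)%E.
  have e1 : (fun x => \prod_(j < 2) w t (iter (kk j) T x)) = (fun x => w t x * w t (iter n1 T x)).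
    by apply/funext => x; exact: (prod_ord2 (fun j => w t (iter (kk j) T x))).
  rewrite e1 (prod_ord2 (fun=> \int[mu]_x w t x)%R) (mule_ord2 (fun=> norm_C kappa ci K (w t))) in h.
  apply: (le_trans h); apply: lee_wpmul2l; first by rewrite lee_fin mulr_ge0// expR_ge0.
  rewrite EFinM; apply: lee_pmul; [exact: nC0 | exact: nC0 | exact: nCN | exact: nCN].
rewrite -EFinM lee_fin in h; apply: le_trans (ler_norm _) _; apply: (le_trans h).
by rewrite /pbound exprM le_eqVlt; apply/orP; left; apply/eqP; ring.
Qed.

Let c00 : 0 <= c0.
Proof. by rewrite mulr_ge0 ?unit_ball_volume_ge0// ltW. Qed.

Lemma sublevel_measure_le : exists2 s0, 0 < s0 & forall s, 0 < s < s0 ->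
  fine (mu (sub s)) <= (c0 + 1) * s `^ p.
Proof.
have [s0 s00 s0P] := sublevel_measure vol_def rho_continuous rho_density rho_xs ixs m delta0
  ellipsoid_metric ltr01.
exists s0 => // s ss; have := s0P s ss; have /andP[s_gt0 _] := ss.
rewrite distrC ler_norml => /andP[_]; rewrite lerBlDl ler_pdivrMr ?powR_gt0//.
Qed.

(** A sublevel set at [s] lies in the ball of radius 2 sqrt s, which lies in the sublevel set at 8
    s. The passage through balls thus costs a factor 8^p in measure and a factor 4 in the
    logarithms. *)
Lemma quasi_sqdist_recurrence : slowly_recurrent X mu T xs ->
  forall D : R, 0 < D -> exists C s0, [/\ 0 <= C, 0 < s0 &
  forall (s : R) n, 0 < s < s0 -> (0 < n)%N -> n%:R <= D * `|ln s| ->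
    fine (mu (sub s `&` iter n T @^-1` sub s)) <= C * s `^ p / `|ln s| ^+ 5].
Proof.
move=> slow D D0.
(* 5 is the logarithmic exponent that the block estimates consume; the factor 4 makes up for the
   logarithm of the radius being possibly four times smaller than that of the level. *)
have [||r0 r00 r0P] := slow 5 (4 * D); rewrite ?mulr_gt0//.
have [s1 s10 s1P] := sublevel_measure_le.
have [s2 s20 s2P] := sublevel_sub_geoball ixs m delta0.
exists ((c0 + 1) * 8 `^ p * 4 ^+ 5), (Num.min (Num.min (expR (- 4)) s2) (Num.min (s1 / 8) ((r0 / 2) ^+ 2))).
split.
- by rewrite !mulr_ge0 ?powR_ge0 ?addr_ge0.
- by rewrite !lt_min expR_gt0 s20 divr_gt0//= exprn_gt0// divr_gt0.
move=> s n /andP[s0]; rewrite !lt_min => /andP[/andP[se ss2] /andP[ss1 sr]] n0 nD.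
have [lr l4] := @ln_two_sqrt_bounds R s ltac:(by rewrite s0 se).
pose r := 2 * Num.sqrt s.
have rr : 0 < r < r0.
  rewrite mulr_gt0 ?sqrtr_gt0//= /r mulrC -ltr_pdivlMr//.
  by rewrite -[ltRHS]ger0_norm ?divr_ge0 ?(ltW r00)// -sqrtr_sqr ltr_sqrt// exprn_gt0// divr_gt0.
have nr : n%:R <= 4 * D * `|ln r|.
  apply: (le_trans nD); rewrite [4 * D]mulrC -mulrA ler_pM2l//.
  by rewrite -ler_pdivrMl// in lr *.
have ms := msub s.
have mB : measurable (geoball X xs r : set (borel M)) by apply: sub_sigma_algebra; exact: geoball_open.
have mS : measurable (sub s `&` iter n T @^-1` sub s).
  by apply: measurableI => //; exact: (measurable_preimage_iter mT).
have mBB : measurable ((geoball X xs r : set (borel M)) `&` iter n T @^-1` geoball X xs r).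
  by apply: measurableI => //; exact: (measurable_preimage_iter mT).
have sB : sub s `<=` geoball X xs r by apply: s2P; rewrite s0.
have Bq : geoball X xs r `<=` sub (8 * s).
  have -> : 8 * s = 2 * r ^+ 2 by rewrite /r exprMn sqr_sqrtr ?(ltW s0)//; ring.
  exact: (geoball_sub_sublevel ixs m delta0 ellipsoid_metric (r := r)).
have fin A : measurable A -> mu A = (fine (mu A))%:E.
  by move=> mA; rewrite fineK// fin_num_measure.
have h := r0P r n rr n0 nr.
have {h} : (mu (sub s `&` iter n T @^-1` sub s) <= mu (sub (8 * s)) * (`|ln r| `^ (- 5))%:E)%E.
  apply: (@le_trans _ _ (mu ((geoball X xs r : set (borel M)) `&` iter n T @^-1` geoball X xs r))).
    apply: le_measure; rewrite ?inE//.
    by move=> x [h1 h2]; split; exact: sB.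
  apply: (le_trans h); apply: lee_wpmul2r; first by rewrite lee_fin powR_ge0.
  by apply: le_measure; rewrite ?inE//; exact: msub.
rewrite fin// [X in (_ <= X * _)%E]fin; last exact: msub.
rewrite -EFinM lee_fin => h; apply: (le_trans h).
have l0 : 0 < `|ln s| by exact: lt_le_trans l4.
have l4' : 0 < 4^-1 * `|ln s| by rewrite mulr_gt0// invr_gt0.
have -> : (c0 + 1) * 8 `^ p * 4 ^+ 5 * s `^ p / `|ln s| ^+ 5 =
    (c0 + 1) * (8 * s) `^ p * (4^-1 * `|ln s|) ^- 5.
  rewrite powRM ?(ltW s0)//; by field; rewrite gt_eqF.
apply: ler_pM; rewrite ?fine_ge0 ?powR_ge0//.
  by apply: s1P; rewrite mulr_gt0//= mulrC -ltr_pdivlMr.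
rewrite powRN (powR_mulrn 5)// lef_pV2 ?posrE ?exprn_gt0//; last by exact: lt_le_trans lr.
by rewrite ler_pXn2r// ?nnegrE ?(ltW l4').
Qed.

(** [f] is unconstrained at [xs], so non-negativity along an orbit requires that the orbit avoid
    [xs]. The zero set of [q] is null because it lies in all sublevel sets. *)
Lemma ae_orbit_off_center : {ae mu, forall x : borel M, forall n, 0 < q (iter n T x)}.
Proof.
pose Z : set (borel M) := ~` [set x | 0 < q x].
have mZ : measurable Z.
  apply: measurableC; apply: sub_sigma_algebra.
  rewrite (_ : [set x | _] = q @^-1` [set t | 0 < t])//.
  by apply: open_comp => [x _|]; [exact: (@quasi_sqdist_continuous R d M X i0 xs ixs delta m delta0 ellipsoid_metric x) | exact: open_gt].
have muZ : mu Z = 0%E.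
  apply/eqP; rewrite eq_le measure_ge0 andbT; apply/lee_addgt0Pr => e e0; rewrite add0e.
  have [s1 s10 s1P] := sublevel_measure_le.
  have c1 : 0 < c0 + 1 by rewrite ltr_wpDl.
  pose s := Num.min (s1 / 2) ((e / (c0 + 1)) `^ p^-1).
  have s0 : 0 < s by rewrite lt_min divr_gt0// powR_gt0// divr_gt0.
  have ss1 : s < s1 by rewrite gt_min ltr_pdivrMr// ltr_pMr// ltr1n.
  have sp : s `^ p <= e / (c0 + 1).
    have ee : 0 <= e / (c0 + 1) by rewrite divr_ge0// ltW.
    have eE : e / (c0 + 1) = ((e / (c0 + 1)) `^ p^-1) `^ p by rewrite -powRrM mulVf ?gt_eqF// powRr1.
    rewrite [leRHS]eE.
    by apply: ge0_ler_powR; rewrite ?nnegrE ?powR_ge0 ?(ltW s0) ?(ltW p0)// ge_min lexx orbT.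
  apply: (@le_trans _ _ (mu (sub s))).
    apply: le_measure; rewrite ?inE//.
    by move=> x /= /negP; rewrite -leNgt => qx; exact: le_lt_trans s0.
  rewrite -(@fineK _ (mu (sub s))) ?fin_num_measure// lee_fin.
  apply: le_trans (s1P s _) _; first by rewrite s0.
  by rewrite mulrC -ler_pdivlMr.
apply: ae_foralln => n; exists (iter n T @^-1` Z); split.
- exact: (measurable_preimage_iter mT).
- exact: (etrans (mu_iter mT mu_inv n mZ) muZ).
- by move=> x.
Qed.

End Assembly.

Theorem theorem5 (R : realType) (d : nat) (M : ptopologicalType)
  (X : riemannianManifold R d M) (M_compact : compact [set: M])
  (vol : {measure set (borel M) -> \bar R}) (vol_def : is_riemannian_volume X vol)
  (kappa : R) (kappa_ge1 : 1 <= kappa)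
  (T : M -> M) (T_Ckappa : class_C_map X kappa T)
  (mu : probability (borel M) R)
  (mu_invariant : forall A : set (borel M), measurable A -> mu (T @^-1` A) = mu A)
  (rho : M -> R) (rho_continuous : continuous rho)
  (rho_density : forall A : set (borel M), measurable A ->
     mu A = (\int[vol]_(x in A) (rho x)%:E)%E)
  (mixing : exp_mixing X kappa mu T)
  (xs : M) (xs_recurrent : slowly_recurrent X mu T xs) (rho_xs : 0 < rho xs)
  (f : M -> R) (res : R)
  (f_sing : power_singularity X kappa xs f d%:R res)
  (K : nat) (K_ge1 : (1 <= K)%N) :
  {ae mu, forall x : borel M,
    (fun N : nat => trimmed_sum T f K N x / (N%:R * ln N%:R)) @ \oo
      --> res * unit_ball_volume d * rho xs}.
Proof.
have kappa0 : 0 <= kappa by exact: le_trans kappa_ge1.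
have cT : continuous T by case: T_Ckappa.
have [fC f_ge0 dR0 [U [g [_ _ _ gxs resE]]]] := f_sing.
have res0 : 0 < res by rewrite resE.
(* The dimension is positive because the order of the singularity is. *)
have d0 : (0 < d)%N by rewrite -(ltr0n R).
have p0 : 0 < d%:R / 2 :> R by rewrite divr_gt0.
have [i0 ixs] := dom_cover X xs.
have half0 : 0 < 2^-1 :> R by rewrite invr_gt0.
have [delta delta0 ell] := near_metric_compare ixs half0.
(* This [m] makes [q] of class C^(m+1), one order above the integer part of [kappa], as the Hoelder
   part of the norm requires. *)
pose m := Num.truncn kappa; pose q := quasi_sqdist i0 xs (metric i0 (phi i0 xs)) delta m.
have Gp : posdef (metric i0 (phi i0 xs)) by apply: metric_posdef; exists xs.
have mT := borel_continuous_measurable cT.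
have mq : measurable_fun [set: borel M] (q : borel M -> R).
  by apply: open_continuous_measurable; exact: quasi_sqdist_continuous.
have q0 x : 0 <= q x by exact: quasi_sqdist_ge0.
have [n [ci [Kc [cov [C0 [gam [C00 gam0 mix]]]]]]] := mixing.
have off := ae_orbit_off_center vol_def cT mu_invariant rho_continuous rho_density rho_xs ixs m delta0 ell d0.
have fT : {ae mu, forall x : borel M, forall n, 0 <= f (iter n T x)}.
  apply: filterS off => x qx n1; apply: f_ge0 => xE.
  by have := qx n1; rewrite xE quasi_sqdist_center// ltxx.
rewrite -mulrA.
apply: (@trimmed_strong_law_power _ (borel M) R mu T mT mu_invariant q (d%:R / 2)
  (unit_ball_volume d * rho xs) p0 mq q0 _ gam gam0 _ _ f res res0 fT) => //.
- exact: (fun e => @sublevel_measure R d M X vol vol_def mu rho rho_continuous rho_density i0 xs rho_xs ixs delta m delta0 ell e).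
- exact: (quasi_sqdist_mixing kappa0 ixs delta0 ell (leqnn _) cov C00 mix).
- exact: (quasi_sqdist_recurrence vol_def cT rho_continuous rho_density rho_xs ixs m delta0 ell xs_recurrent).
- exact: (fun e => singularity_normal_form ixs m delta0 f_sing (e := e)).
- exact: (fun s => bounded_off_singularity ixs m delta0 ell (s := s) M_compact fC).
Qed.
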